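(* Let $(C[[\hbar]],1_C,\cdot,\mathbf K)$ and $(C'[[\hbar]],1_{C'},\cdot',\mathbf K')$ be anomaly-free binary QFT algebras over $\Bbbk$ with classical cohomologies $H$, $H'$, let $\mathfrak f$ be a homotopy equivalence of binary QFT algebras from the first to the second, with quantum descendant $\underline{\boldsymbol\psi}$, and let $I:H\to H'$ be the map induced on classical cohomology by the classical limit of $\mathfrak f$. Then $I$ is an isomorphism of graded vector spaces with $I(1_H)=1_{H'}$, and $\mathfrak f$ induces an isomorphism of on-shell quantum correlation algebras and sends quantum (flat) structures to quantum (flat) structures, in the following sense: if $\underline{\boldsymbol\phi}$ represents a quantum structure on the first algebra, then $$\boldsymbol\phi'_n:=(\underline{\boldsymbol\psi}\bullet\underline{\boldsymbol\phi})_n\circ (I^{-1})^{\odot n},\qquad n\ge1,$$ represents a quantum structure on the second algebra, and, for the associated on-shell quantum correlation algebras $(H,1_H,\underline{\grave m})$ and $(H',1_{H'},\underline{\grave m}')$, $$I\,\grave m_n(v_1,\dots,v_n)=\grave m'_n(Iv_1,\dots,Iv_n)\qquad\text{for all } n\ge2,\ v_1,\dots,v_n\in H.$$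
   Context: Conventions. $\Bbbk$ is a field of characteristic zero, $\hbar$ a formal parameter of degree $0$. Spaces are $\mathbb Z$-graded, $|x|$ is the degree, $Jx=(-1)^{|x|}x$. $\mathrm{Hom}(V,W)^j$ is the space of $\Bbbk$-linear maps of degree $j$; $V[[\hbar]]=\bigoplus_jV^j[[\hbar]]$; series in $\mathrm{Hom}(V,W)^j[[\hbar]]$ are identified with the $\Bbbk[[\hbar]]$-linear maps $V[[\hbar]]\to W[[\hbar]]$ they determine; the coefficient of $\hbar^0$ is the classical limit. $[\tau]$ denotes polynomial dependence on a formal time $\tau$. $S^nV$ is the $n$-th graded-symmetric power. Partitions. $P(n)$ is the set of partitions $\mathfrak p=B_1\sqcup\cdots\sqcup B_{|\mathfrak p|}$ of $\{1,\dots,n\}$ into nonempty blocks, ordered by increasing maximal elements, each block in increasing order. For $B=\{j_1<\dots<j_r\}$, $v_B=v_{j_1}\otimes\cdots\otimes v_{j_r}$, $Jv_B$ means $J$ applied to every entry, $\beta(v_B)=\beta_r(v_{j_1},\dots,v_{j_r})$. $\varepsilon(\mathfrak p)$ is the Koszul sign: $v_1\odot\cdots\odot v_n=\varepsilon(\mathfrak p)v_{B_1}\odot\cdots\odot v_{B_{|\mathfrak p|}}$. Sums over ''$\mathfrak p\in P(n)$, $|B_i|=n-|\mathfrak p|+1$'' run over pairs $(\mathfrak p,i)$. Binary QFT algebra. A tuple $(C[[\hbar]],1_C,\cdot,\mathbf K)$ where $(C,1_C,\cdot)$ is a unital graded-commutative associative $\Bbbk$-algebra, $\mathbf K=K^{(0)}+\hbar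 K^{(1)}+\cdots\in\mathrm{Hom}(C,C)^1[[\hbar]]$, $\mathbf K1_C=0$, $\mathbf K\mathbf K=0$, $1_C\ne K^{(0)}x$ for all $x$, such that the family $\underline{\boldsymbol\ell}$ (quantum descendant) determined by $\mathbf K(x_1\cdots x_n)=\sum_{\mathfrak p\in P(n),|B_i|=n-|\mathfrak p|+1}(-\hbar)^{n-|\mathfrak p|}\varepsilon(\mathfrak p)Jx_{B_1}\cdots Jx_{B_{i-1}}\cdot\boldsymbol\ell(x_{B_i})\cdot x_{B_{i+1}}\cdots x_{B_{|\mathfrak p|}}$ satisfies $\boldsymbol\ell_n\in\mathrm{Hom}(S^nC,C)^1[[\hbar]]$. Morphisms. A morphism of binary QFT algebras is $\mathfrak f\in\mathrm{Hom}(C,C')^0[[\hbar]]$ with $\mathfrak f(1_C)=1_{C'}$, $\mathbf K'\mathfrak f=\mathfrak f\mathbf K$, such that the family $\underline{\boldsymbol\psi}$ (its quantum descendant) determined by $\mathfrak f(x_1\cdots x_n)=\sum_{\mathfrak p\in P(n)}(-\hbar)^{n-|\mathfrak p|}\varepsilon(\mathfrak p)\boldsymbol\psi(x_{B_1})\cdot'\cdots\cdot'\boldsymbol\psi(x_{B_{|\mathfrak p|}})$ satisfies $\boldsymbol\psi_n\in\mathrm{Hom}(S^nC,C')^0[[\hbar]]$. Morphisms compose as maps. Homotopy. A homotopy pair is $(\mathfrak f(\tau)|\boldsymbol\xi(\tau))\in\mathrm{Hom}(C,C')^0[[\hbar]][\tau]\oplus\mathrm{Hom}(C,C')^{-1}[[\hbar]][\tau]$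 with $\boldsymbol\xi(\tau)(1_C)=0$, $\frac{d}{d\tau}\mathfrak f(\tau)=\mathbf K'\boldsymbol\xi(\tau)+\boldsymbol\xi(\tau)\mathbf K$, and $(-\hbar)^{-(n-1)}\breve{\boldsymbol\lambda}_n(\tau)\in\mathrm{Hom}(S^nC,C')^{-1}[[\hbar]][\tau]$ for all $n$, where $\breve{\boldsymbol\psi}(\tau),\breve{\boldsymbol\lambda}(\tau)$ are determined by $\mathfrak f(\tau)(x_1\cdots x_n)=\sum_{\mathfrak p}\varepsilon(\mathfrak p)\breve{\boldsymbol\psi}(\tau)(x_{B_1})\cdot'\cdots\cdot'\breve{\boldsymbol\psi}(\tau)(x_{B_{|\mathfrak p|}})$ and $\boldsymbol\xi(\tau)(x_1\cdots x_n)=\sum_{\mathfrak p}\sum_{i}\varepsilon(\mathfrak p)\breve{\boldsymbol\psi}(\tau)(Jx_{B_1})\cdot'\cdots\cdot'\breve{\boldsymbol\psi}(\tau)(Jx_{B_{i-1}})\cdot'\breve{\boldsymbol\lambda}(\tau)(x_{B_i})\cdot'\breve{\boldsymbol\psi}(\tau)(x_{B_{i+1}})\cdot'\cdots\cdot'\breve{\boldsymbol\psi}(\tau)(x_{B_{|\mathfrak p|}})$. Two morphisms are homotopic if they are the values at $\tau=0,1$ of $\mathfrak f(\tau)$ for some homotopy pair. A morphism $\mathfrak f$ is a homotopy equivalence if there is a morphism $\mathfrak f'$ in the opposite direction with $\mathfrak f'\mathfrak f$ and $\mathfrak f\mathfrak f'$ homotopic to the identities. $sL_\infty$ notions. A unital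 $sL_\infty$-algebra $(V[[\hbar]],1_V,\underline l)$: $l_n\in\mathrm{Hom}(S^nV,V)^1[[\hbar]]$, $l_n(\dots,1_V)=0$, $\sum_{\mathfrak p,|B_i|=n-|\mathfrak p|+1}\varepsilon(\mathfrak p)l_{|\mathfrak p|}(Jv_{B_1},\dots,Jv_{B_{i-1}},l(v_{B_i}),v_{B_{i+1}},\dots)=0$; quantum descendants are such. A unital $sL_\infty$-morphism $\underline\varphi$: $\varphi_n\in\mathrm{Hom}(S^nV,V')^0[[\hbar]]$, $\varphi_1(1_V)=1_{V'}$, $\varphi_n(\dots,1_V)=0$ ($n\ge2$), $\sum_{\mathfrak p}\varepsilon(\mathfrak p)l'_{|\mathfrak p|}(\varphi(v_{B_1}),\dots,\varphi(v_{B_{|\mathfrak p|}}))=\sum_{\mathfrak p,|B_i|=n-|\mathfrak p|+1}\varepsilon(\mathfrak p)\varphi_{|\mathfrak p|}(Jv_{B_1},\dots,Jv_{B_{i-1}},l(v_{B_i}),v_{B_{i+1}},\dots)$; a quasi-isomorphism if $\varphi_1$ is. Composition: $(\underline\varphi'\bullet\underline\varphi)_n(v_1,\dots,v_n)=\sum_{\mathfrak p}\varepsilon(\mathfrak p)\varphi'_{|\mathfrak p|}(\varphi(v_{B_1}),\dots,\varphi(v_{B_{|\mathfrak p|}}))$. Two unital $sL_\infty$-morphisms are homotopic if they are $\varphi(0),\varphi(1)$ for some pair $\varphi_n(\tau)\in\mathrm{Hom}(S^nV,V')^0[[\hbar]][\tau]$, $\lambda_n(\tau)\in\mathrm{Hom}(S^nV,V')^{-1}[[\hbar]][\tau]$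 with $\lambda_n(\tau)(\dots,1_V)=0$ and $\frac d{d\tau}\varphi_n(\tau)(v_1,\dots,v_n)=\sum_{\mathfrak p,|B_i|=n-|\mathfrak p|+1}\varepsilon(\mathfrak p)\lambda_{|\mathfrak p|}(\tau)(Jv_{B_1},\dots,Jv_{B_{i-1}},l(v_{B_i}),v_{B_{i+1}},\dots)+\sum_{\mathfrak p}\sum_i\varepsilon(\mathfrak p)l'_{|\mathfrak p|}(\varphi(\tau)(Jv_{B_1}),\dots,\varphi(\tau)(Jv_{B_{i-1}}),\lambda(\tau)(v_{B_i}),\varphi(\tau)(v_{B_{i+1}}),\dots)$. Anomaly-free. $K=K^{(0)}$; $H$ is the cohomology of $(C,K)$ (classical cohomology), $1_H=[1_C]$. For a retract $(f,h,s)$ ($f\in\mathrm{Hom}(H,C)^0$, $h\in\mathrm{Hom}(C,H)^0$, $s\in\mathrm{Hom}(C,C)^{-1}$, $f(1_H)=1_C$, $Kf=0$, $f$ inducing the identity on cohomology, $h(1_C)=1_H$, $hK=0$, $hf=\mathrm{id}$, $fh=\mathrm{id}-Ks-sK$, $K=KsK$, $s(1_C)=0$, $ss=sf=hs=0$) put $f^{(0)}=f$, $g^{(n)}=\sum_{j=0}^{n-1}K^{(n-j)}f^{(j)}-\sum_{j=1}^{n-1}f^{(n-j)}\kappa^{(j)}$, $\kappa^{(n)}=hg^{(n)}$, $f^{(n)}=-sg^{(n)}$. Anomaly-free means all $\kappa^{(n)}=0$ (independent of the retract). Quantum structure. On an anomaly-free binary QFT algebra, call a unital $sL_\infty$-quasi-isomorphism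 $\underline{\boldsymbol\phi}:(H[[\hbar]],1_H,\underline0)\to(C[[\hbar]],1_C,\underline{\boldsymbol\ell})$ distinguished if the classical limit of $\boldsymbol\phi_1$ induces the identity on $H$ and there are $\grave{\boldsymbol\pi}_1=\mathrm{id}_H$, $\grave{\boldsymbol\pi}_n=\sum_{j=0}^{n-2}(-\hbar)^j\grave\pi_n^{(j)}$ with $\grave\pi_n^{(j)}\in\mathrm{Hom}(S^nH,H)^0$ ($n\ge2$), $\grave{\boldsymbol\pi}_n(v_1,\dots,v_{n-1},1_H)=\grave{\boldsymbol\pi}_{n-1}(v_1,\dots,v_{n-1})$, such that $\boldsymbol\Pi_n-\boldsymbol\phi_1\circ\grave{\boldsymbol\pi}_n=\mathbf K\circ\boldsymbol\eta_n$ for some $\boldsymbol\eta_n\in\mathrm{Hom}(S^nH,C)^{-1}[[\hbar]]$, for all $n\geq 1$, where $\boldsymbol\Pi_n(v_1,\dots,v_n)=\sum_{\mathfrak p\in P(n)}(-\hbar)^{n-|\mathfrak p|}\varepsilon(\mathfrak p)\boldsymbol\phi(v_{B_1})\cdots\boldsymbol\phi(v_{B_{|\mathfrak p|}})$. (The $\grave{\boldsymbol\pi}_n$ are uniquely determined by $\underline{\boldsymbol\phi}$, in fact by its homotopy type.) The homotopy type of such a $\underline{\boldsymbol\phi}$ is a quantum structure; its associated on-shell quantum correlation algebra is $(H,1_H,\underline{\grave m})$ with $\grave m_n=\grave\pi_n^{(n-2)}$, $n\ge2$. *)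

(* Defs.v *)
From HB Require Import structures.
From mathcomp Require Import all_boot all_order all_algebra.
From mathcomp Require Import boolp.

Set Implicit Arguments.
Unset Strict Implicit.
Unset Printing Implicit Defensive.

Import Order.TTheory GRing.Theory Num.Theory.
Local Open Scope ring_scope.
Local Open Scope quotient_scope.

(* A Z-graded vector space is carried by its total space, the (internal)
   direct sum of its homogeneous components; [hpart j x] is the component of
   degree [j] of [x].  Linear maps of degree [j] of graded spaces are then the
   linear maps of total spaces that shift degrees by [j]. *)
HB.mixin Record isGraded (k : fieldType) V of GRing.Lmodule k V := {
  hpart : int -> V -> V;
  hpart_linear : forall j, linear (hpart j);
  hpart_hpart : forall i j x,
    hpart i (hpart j x) = if i == j then hpart j x else 0;
  hpart_sum : forall x, exists2 s : seq int,
    uniq s & x = \sum_(j <- s) hpart j x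
}.

#[short(type="gradedType")]
HB.structure Definition Graded (k : fieldType) :=
  {V of isGraded k V & GRing.Lmodule k V}.

Definition homog (k : fieldType) (V : gradedType k) (j : int) (x : V) : Prop :=
  hpart j x = x.

Definition parity (j : int) : bool := odd `|j|%N.

HB.mixin Record isGradedCommutative (k : fieldType) C
    of Graded k C & GRing.Algebra k C := {
  homog1 : homog 0 (1 : C);
  homogM : forall i j (x y : C),
    homog i x -> homog j y -> homog (i + j) (x * y);
  gcommutative : forall i j (x y : C), homog i x -> homog j y ->
    x * y = (-1) ^+ (parity i && parity j) * (y * x)
}.

#[short(type="gcAlgType")]
HB.structure Definition GCAlg (k : fieldType) :=
  {C of isGradedCommutative k C & Graded k C & GRing.Algebra k C}.

Section Hom.
Variables (k : fieldType) (V W : gradedType k).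

Definition graded_hom (j : int) (g : V -> W) : Prop :=
  linear g /\ forall i x, homog i x -> homog (i + j) (g x).

(* Hom(S^n V, W)^j: the graded-symmetric n-linear maps of degree j.  Families
   (g_n)_{n >= 1} of multilinear maps are functions on sequences of arguments,
   g_n being the restriction to sequences of size n. *)
Definition sym_hom (n : nat) (j : int) (g : seq V -> W) : Prop :=
  [/\ forall (s1 s2 : seq V) c x y, (size s1 + size s2).+1 = n ->
        g (s1 ++ (c *: x + y) :: s2)
          = c *: g (s1 ++ x :: s2) + g (s1 ++ y :: s2),
      forall (s1 s2 : seq V) x y p q, (size s1 + size s2).+2 = n ->
        homog p x -> homog q y ->
        g (s1 ++ x :: y :: s2)
          = (-1) ^+ (parity p && parity q) *: g (s1 ++ y :: x :: s2)
    & forall (x : n.-tuple V) (d : n.-tuple int),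
        (forall i, homog (tnth d i) (tnth x i)) ->
        homog (\sum_(i < n) tnth d i + j) (g x)].

End Hom.

Section Cohomology.
Variables (k : fieldType) (V : gradedType k) (d : V -> V).

Record differential : Prop := Differential {
  diff_hom : graded_hom 1 d;
  diff_sq : forall x, d (d x) = 0
}.

Hypothesis dP : differential.

Local Lemma dlin : linear d. Proof. by case: dP => -[]. Qed.
Local Lemma d0 : d 0 = 0.
Proof.
have := dlin 1 0 0; rewrite !scale1r addr0 => /(congr1 (fun z => z - d 0)).
by rewrite subrr addrK.
Qed.
Local Lemma dD x y : d (x + y) = d x + d y.
Proof. by have := dlin 1 x y; rewrite !scale1r. Qed.
Local Lemma dZ c x : d (c *: x) = c *: d x.
Proof. by have := dlin c x 0; rewrite d0 !addr0. Qed.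
Local Lemma dN x : d (- x) = - d x.
Proof. by rewrite -scaleN1r dZ scaleN1r. Qed.
Local Lemma dsum (s : seq int) (F : int -> V) :
  d (\sum_(i <- s) F i) = \sum_(i <- s) d (F i).
Proof. by elim/big_rec2: _ => [|i y x _ <-]; rewrite ?d0 ?dD. Qed.

Lemma hpartD i (x y : V) : hpart i (x + y) = hpart i x + hpart i y.
Proof. by have := @hpart_linear _ V i 1 x y; rewrite !scale1r. Qed.
Lemma hpart0 i : hpart i (0 : V) = 0.
Proof.
have := hpartD i 0 0; rewrite addr0 => /(congr1 (fun z => z - hpart i 0)).
by rewrite subrr addrK.
Qed.
Lemma hpartZ i c (x : V) : hpart i (c *: x) = c *: hpart i x.
Proof. by have := @hpart_linear _ V i c x 0; rewrite hpart0 !addr0. Qed.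

Local Lemma hpart_d i x : hpart (i + 1) (d x) = d (hpart i x).
Proof.
have hp j y : d (hpart j y) = hpart (j + 1) (d (hpart j y)).
  case: dP => -[_ h] _; symmetry; apply: h.
  by rewrite /homog hpart_hpart eqxx.
have hpsum l (s : seq int) (F : int -> V) :
    hpart l (\sum_(j <- s) F j) = \sum_(j <- s) hpart l (F j).
  by elim/big_rec2: _ => [|j y z _ <-]; rewrite ?hpart0 ?hpartD.
have [s _ {1 2}->] := hpart_sum x; rewrite dsum !hpsum dsum.
apply: eq_bigr => j _; rewrite hp hpart_hpart (inj_eq (addIr _)) -hp.
by rewrite hpart_hpart; case: ifP; rewrite ?d0.
Qed.

Definition cocycle := {x : V | d x == 0}.

Definition cohomologous (x y : cocycle) : bool :=
  `[< exists z, val x - val y = d z >].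

Lemma cohomologous_refl : reflexive cohomologous.
Proof. by move=> x; apply/asboolP; exists 0; rewrite subrr d0. Qed.
Lemma cohomologous_sym : symmetric cohomologous.
Proof.
move=> x y; apply: asbool_equiv_eq.
by split=> -[z e]; exists (- z); rewrite dN -e opprB.
Qed.
Lemma cohomologous_trans : transitive cohomologous.
Proof.
move=> y x z /asboolP[u e] /asboolP[v e']; apply/asboolP; exists (u + v).
by rewrite dD -e -e' addrA subrK.
Qed.

Definition cohomologous_equiv :=
  EquivRel cohomologous cohomologous_refl cohomologous_sym cohomologous_trans.

Definition coh := {eq_quot cohomologous_equiv}.
HB.instance Definition _ := Choice.on coh.
HB.instance Definition _ := EqQuotient.on coh.

Definition zero_cocycle : cocycle := exist _ 0 (introT eqP d0).

(* [cls x] is only meaningful when [d x = 0]. *)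
Definition cls (x : V) : coh := \pi_coh (insubd zero_cocycle x : cocycle).
Definition crep (a : coh) : V := val (repr a).

Lemma d_crep a : d (crep a) = 0.
Proof. by apply/eqP; exact: (valP (repr a)). Qed.

Lemma crepK a : cls (crep a) = a.
Proof. by rewrite /cls /crep valKd reprK. Qed.

Lemma clsP x y : d x = 0 -> d y = 0 ->
  (exists z, x - y = d z) <-> cls x = cls y.
Proof.
move=> /eqP dx /eqP dy; rewrite /cls; split.
  by move=> h; apply/eqmodP; apply/asboolP; rewrite !insubdK.
by move=> /eqmodP/asboolP; rewrite !insubdK.
Qed.

Lemma crep_cls x : d x = 0 -> exists z, crep (cls x) - x = d z.
Proof. by move=> dx; apply/clsP; rewrite ?d_crep ?crepK. Qed.

Local Lemma dD0 x y : d x = 0 -> d y = 0 -> d (x + y) = 0.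
Proof. by move=> dx dy; rewrite dD dx dy addr0. Qed.
Local Lemma dZ0 c x : d x = 0 -> d (c *: x) = 0.
Proof. by move=> dx; rewrite dZ dx scaler0. Qed.
Local Lemma dN0 x : d x = 0 -> d (- x) = 0.
Proof. by move=> dx; rewrite dN dx oppr0. Qed.
Local Lemma dh0 i x : d x = 0 -> d (hpart i x) = 0.
Proof. by move=> dx; rewrite -hpart_d dx hpart0. Qed.

Definition coh_add a b := cls (crep a + crep b).
Definition coh_opp a := cls (- crep a).
Definition coh_scale c a := cls (c *: crep a).
Definition coh_hpart i a := cls (hpart i (crep a)).

Local Lemma addE x y : d x = 0 -> d y = 0 -> coh_add (cls x) (cls y) = cls (x + y).
Proof.
move=> dx dy; apply/clsP; [by apply: dD0; exact: d_crep | exact: dD0 |].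
have [u eu] := crep_cls dx; have [v ev] := crep_cls dy.
by exists (u + v); rewrite dD -eu -ev opprD addrACA.
Qed.
Local Lemma oppE x : d x = 0 -> coh_opp (cls x) = cls (- x).
Proof.
move=> dx; apply/clsP; [by apply: dN0; exact: d_crep | exact: dN0 |].
by have [u eu] := crep_cls dx; exists (- u); rewrite dN -eu opprD.
Qed.
Local Lemma scaleE c x : d x = 0 -> coh_scale c (cls x) = cls (c *: x).
Proof.
move=> dx; apply/clsP; [by apply: dZ0; exact: d_crep | exact: dZ0 |].
by have [u eu] := crep_cls dx; exists (c *: u); rewrite dZ -eu scalerBr.
Qed.
Local Lemma hpartE i x : d x = 0 -> coh_hpart i (cls x) = cls (hpart i x).
Proof.
move=> dx; apply/clsP; [by apply: dh0; exact: d_crep | exact: dh0 |].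
have [u eu] := crep_cls dx; exists (hpart (i - 1) u).
rewrite -hpart_d subrK -eu -[- x]scaleN1r hpartD hpartZ scaleN1r //.
Qed.

Local Lemma cohP (P : coh -> Prop) : (forall x, d x = 0 -> P (cls x)) -> forall a, P a.
Proof. by move=> h a; rewrite -(crepK a); apply: h; exact: d_crep. Qed.

Lemma coh_addA : associative coh_add.
Proof.
elim/cohP => x dx; elim/cohP => y dy; elim/cohP => z dz.
by rewrite !addE ?addrA //; exact: dD0.
Qed.
Lemma coh_addC : commutative coh_add.
Proof. by move=> a b; rewrite /coh_add addrC. Qed.
Lemma coh_add0 : left_id (cls 0) coh_add.
Proof. by elim/cohP => x dx; rewrite addE ?add0r ?d0. Qed.
Lemma coh_addN : left_inverse (cls 0) coh_opp coh_add.
Proof. by elim/cohP => x dx; rewrite oppE // addE ?addNr //; exact: dN0. Qed.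

HB.instance Definition _ :=
  GRing.isZmodule.Build coh coh_addA coh_addC coh_add0 coh_addN.

Local Lemma clsD x y : d x = 0 -> d y = 0 -> cls (x + y) = cls x + cls y.
Proof. by move=> dx dy; rewrite [RHS]addE. Qed.

Lemma coh_scaleA c e a : coh_scale c (coh_scale e a) = coh_scale (c * e) a.
Proof.
by elim/cohP: a => x dx; rewrite !scaleE ?scalerA //; exact: dZ0.
Qed.
Lemma coh_scale1 : left_id 1 coh_scale.
Proof. by elim/cohP => x dx; rewrite scaleE ?scale1r. Qed.
Lemma coh_scaleDr : right_distributive coh_scale +%R.
Proof.
move=> c; elim/cohP => x dx; elim/cohP => y dy.
rewrite -clsD // !scaleE ?scalerDr ?clsD //; by [exact: dD0 | exact: dZ0].
Qed.
Lemma coh_scaleDl a : {morph coh_scale^~ a : c e / c + e}.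
Proof.
move=> c e; elim/cohP: a => x dx.
by rewrite !scaleE // scalerDl clsD //; exact: dZ0.
Qed.

HB.instance Definition _ := GRing.Zmodule_isLmodule.Build k coh
  coh_scaleA coh_scale1 coh_scaleDr coh_scaleDl.

Local Lemma clsZ c x : d x = 0 -> cls (c *: x) = c *: cls x.
Proof. by move=> dx; rewrite [RHS]scaleE. Qed.

Lemma coh_hpart_linear j : linear (coh_hpart j).
Proof.
move=> c; elim/cohP => x dx; elim/cohP => y dy.
rewrite -clsZ // -clsD ?hpartE ?hpartD ?hpartZ ?clsD ?clsZ //;
  by [exact: dh0 | exact: dZ0 | exact: dD0 (dZ0 _ _) _ | exact: dZ0 (dh0 _ _)].
Qed.
Lemma coh_hpart_hpart i j a :
  coh_hpart i (coh_hpart j a) = if i == j then coh_hpart j a else 0.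
Proof.
elim/cohP: a => x dx; rewrite !hpartE ?hpart_hpart //; last exact: dh0.
by case: ifP.
Qed.
Lemma coh_hpart_sum a : exists2 s : seq int,
  uniq s & a = \sum_(j <- s) coh_hpart j a.
Proof.
elim/cohP: a => x dx; have [s us e] := hpart_sum x; exists s => //.
rewrite [LHS](congr1 cls e) (eq_bigr (fun j => cls (hpart j x))) => [|j _];
  last exact: hpartE.
have: d (\sum_(j <- s) hpart j x) = 0 /\
      cls (\sum_(j <- s) hpart j x) = \sum_(j <- s) cls (hpart j x).
  elim/big_rec2: _ => [|j y z _ [dz <-]]; first by rewrite d0.
  by rewrite clsD ?dD0 //; exact: dh0.
by case.
Qed.

HB.instance Definition _ := isGraded.Build k coh
  coh_hpart_linear coh_hpart_hpart coh_hpart_sum.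

End Cohomology.

(* [x : ser V] is the formal series \sum_(a, b) hbar^a tau^b (x a b).  The
   spaces V[[hbar]] and V[[hbar]][tau] are regarded as subspaces of [ser V]
   (predicates [tau_free], [in_hbar] and the bounds in [hom_hbar_tau],
   [shom_hbar_tau] below), so that all the formulas in hbar and tau are
   evaluated in [ser V]. *)
Definition ser (V : Type) := nat -> nat -> V.

Section Series.
Variables (k : fieldType).
Implicit Types V W : gradedType k.

Definition cst V (v : V) : ser V :=
  fun a b => if (a == 0%N) && (b == 0%N) then v else 0.

(* multiplication by (- hbar)^m *)
Definition mulNhbar V (m : nat) (x : ser V) : ser V :=
  fun a b => if (m <= a)%N then (-1) ^+ m *: x (a - m)%N b else 0.

Definition dtau V (x : ser V) : ser V := fun a b => x a b.+1 *+ b.+1.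

Definition tau_free V (x : ser V) : Prop := forall a b, x a b.+1 = 0.

(* V^j[[hbar]] *)
Definition in_hbar V (j : int) (x : ser V) : Prop :=
  tau_free x /\ forall a b, homog j (x a b).

(* Hom(V, W)^j[[hbar]] *)
Definition hom_hbar V W (j : int) (f : V -> ser W) : Prop :=
  (forall a b, graded_hom j (fun x => f x a b)) /\ (forall x, tau_free (f x)).

(* Hom(V, W)^j[[hbar]][tau] *)
Definition hom_hbar_tau V W (j : int) (f : V -> ser W) : Prop :=
  (forall a b, graded_hom j (fun x => f x a b)) /\
  (exists N, forall x a b, (N <= b)%N -> f x a b = 0).

(* Hom(S^n V, W)^j[[hbar]] *)
Definition shom_hbar V W (n : nat) (j : int) (g : seq V -> ser W) : Prop :=
  (forall a b, sym_hom n j (fun s => g s a b)) /\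
  (forall s, size s = n -> tau_free (g s)).

(* Hom(S^n V, W)^j[[hbar]][tau] *)
Definition shom_hbar_tau V W (n : nat) (j : int) (g : seq V -> ser W) : Prop :=
  (forall a b, sym_hom n j (fun s => g s a b)) /\
  (exists N, forall s a b, size s = n -> (N <= b)%N -> g s a b = 0).

Definition lin_ext V W (f : V -> ser W) (x : ser V) : ser W :=
  fun a b => \sum_(i < a.+1) \sum_(j < b.+1) f (x i j) (a - i)%N (b - j)%N.

(* The extension of a family of multilinear maps with values in series to
   arguments that are series:
   g (\sum hbar^i tau^j x_ij, s) = \sum hbar^i tau^j g (x_ij, s). *)
Fixpoint mul_ext V W (g : seq V -> ser W) (s : seq (ser V)) : ser W :=
  if s is x :: s' then
    fun a b => \sum_(i < a.+1) \sum_(j < b.+1)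
      mul_ext (fun t => g (x i j :: t)) s' (a - i)%N (b - j)%N
  else g [::].

Definition ser_prod (C : gcAlgType k) (s : seq (ser C)) : ser C :=
  foldr (fun (x y : ser C) a b =>
    \sum_(i < a.+1) \sum_(j < b.+1) x i j * y (a - i)%N (b - j)%N) (cst 1) s.

End Series.

Section Partitions.
Variables (k : fieldType) (V : gradedType k) (n : nat).
Implicit Types (d : n.-tuple int) (x : n.-tuple V) (p : {set {set 'I_n}}).

Definition homog_tuple d x : Prop := forall i, homog (tnth d i) (tnth x i).

(* The blocks of a partition by increasing maximal elements; [enum B] lists the
   elements of B in increasing order. *)
Definition blocks p : seq {set 'I_n} :=
  sort (fun B B' : {set 'I_n} => (\max_(i in B) i <= \max_(i in B') i)%N)
       (enum p).

(* The sign of the rearrangement of x_0 ... x_(n-1) in the order given by the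
   concatenation of the blocks: the parity of the number of inversions between
   arguments of odd degree. *)
Definition koszul d p : k :=
  let w := flatten [seq enum B | B : {set 'I_n} <- blocks p] in
  (-1) ^+ (\sum_(i < n) \sum_(j < n | (i < j)%N && (index j w < index i w)%N)
             (parity (tnth d i) && parity (tnth d j)))%N.

Definition block_args x (B : {set 'I_n}) : seq V :=
  [seq tnth x i | i <- enum B].

Definition block_Jargs d x (B : {set 'I_n}) : seq V :=
  [seq (-1) ^+ parity (tnth d i) *: tnth x i | i <- enum B].

Variable W : gradedType k.
Implicit Types f g : seq V -> ser W.

Definition block_values f x p : seq (ser W) :=
  [seq f (block_args x B) | B <- blocks p].

(* f(J x_B1), ..., f(J x_B(i-1)), g(x_Bi), f(x_B(i+1)), ..., blocks being
   numbered from 0 *)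
Definition block_values_at f g d x p (i : nat) : seq (ser W) :=
  [seq (let B := nth set0 (blocks p) j in
        if (j < i)%N then f (block_Jargs d x B)
        else if j == i then g (block_args x B) else f (block_args x B))
    | j <- iota 0 #|p|].

End Partitions.

Section Sums.
Variables (k : fieldType) (V W U : gradedType k).

(* Below M is a product or the extension of a family of multilinear maps, and
   w : nat is 1 for the sums with weights (- hbar)^(n - |p|) and 0 for the
   unweighted ones. *)

(* \sum_p (- hbar)^(w (n - |p|)) eps(p) M(f(x_B1), ..., f(x_B|p|)) *)
Definition sum_blocks (w : nat) (M : seq (ser W) -> ser U)
    (f : seq V -> ser W) n (d : n.-tuple int) (x : n.-tuple V) : ser U :=
  fun a b => \sum_(p : {set {set 'I_n}} | partition p [set: 'I_n])
    koszul k d p *: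
      mulNhbar (w * (n - #|p|)) (M (block_values f x p)) a b.

(* \sum_p \sum_i eps(p) M(f(J x_B1), ..., g(x_Bi), f(x_B(i+1)), ...) *)
Definition sum_blocks_at (M : seq (ser W) -> ser U) (f g : seq V -> ser W)
    n (d : n.-tuple int) (x : n.-tuple V) : ser U :=
  fun a b => \sum_(p : {set {set 'I_n}} | partition p [set: 'I_n])
    \sum_(i < #|p|) koszul k d p *: M (block_values_at f g d x p i) a b.

Definition single (s : seq V) : ser V := if s is [:: v] then cst v else cst 0.

End Sums.

(* \sum_(p, i | |B_i| = n - |p| + 1) (- hbar)^(w (n - |p|)) eps(p)
     M(J x_B1, ..., J x_B(i-1), g(x_Bi), x_B(i+1), ...);
   the size condition forces the blocks other than B_i to be singletons. *)
Definition sum_insert (k : fieldType) (V U : gradedType k) (w : nat)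
    (M : seq (ser V) -> ser U) (g : seq V -> ser V)
    n (d : n.-tuple int) (x : n.-tuple V) : ser U :=
  fun a b => \sum_(p : {set {set 'I_n}} | partition p [set: 'I_n])
    \sum_(i < #|p| | #|nth set0 (blocks p) i| == (n - #|p|).+1)
      koszul k d p *:
        mulNhbar (w * (n - #|p|))
          (M (block_values_at (@single k V) g d x p i)) a b.

(* Equality, in all arities n >= 1 and on homogeneous arguments, of two
   families of maps. *)
Definition eq_homog (k : fieldType) (V W : gradedType k)
    (F G : forall n, n.-tuple int -> n.-tuple V -> ser W) : Prop :=
  forall n (d : n.-tuple int) (x : n.-tuple V), (0 < n)%N -> homog_tuple d x ->
    forall a b, F n d x a b = G n d x a b.

Definition on_prod (k : fieldType) (C : gcAlgType k) (W : gradedType k)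
    (f : C -> ser W) n (d : n.-tuple int) (x : n.-tuple C) : ser W :=
  f (\prod_(i < n) tnth x i).

Record binaryQFT (k : fieldType) := BinaryQFT {
  bq_car :> gcAlgType k;
  bq_K : bq_car -> ser bq_car;
  bq_ell : seq bq_car -> ser bq_car;
  bq_K_hom : hom_hbar 1 bq_K;
  bq_K1 : forall a b, bq_K 1 a b = 0;
  bq_KK : forall x a b, lin_ext bq_K (bq_K x) a b = 0;
  bq_unit : forall x, 1 <> bq_K x 0%N 0%N;
  (* the quantum descendant, determined by K *)
  bq_ellE : eq_homog (on_prod bq_K)
                     (sum_insert 1 (@ser_prod k bq_car) bq_ell);
  bq_ell_hom : forall n, (0 < n)%N -> shom_hbar n 1 bq_ell
}.

Arguments bq_K {k} b x a b : rename.
Arguments bq_ell {k} b s a b : rename.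

Section QFT.
Variable k : fieldType.
Implicit Types A B : binaryQFT k.

Definition is_descendant A B (f : A -> ser B) (psi : seq A -> ser B) : Prop :=
  eq_homog (on_prod f) (sum_blocks 1 (@ser_prod k B) psi) /\
  (forall n, (0 < n)%N -> shom_hbar n 0 psi).

Definition is_morphism A B (f : A -> ser B) : Prop :=
  [/\ hom_hbar 0 f,
      forall a b, f 1 a b = cst (1 : B) a b,
      forall x a b, lin_ext (bq_K B) (f x) a b = lin_ext f (bq_K A x) a b
    & exists psi, is_descendant f psi].

Definition value0 (V W : gradedType k) (F f : V -> ser W) : Prop :=
  forall x a, f x a 0%N = F x a 0%N.

(* The values at tau = 1 of [F] : Hom(A, B)[[hbar]][tau] are those of [f]. *)
Definition value1 (V W : gradedType k) (F f : V -> ser W) : Prop :=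
  exists N, (forall x a b, (N <= b)%N -> F x a b = 0) /\
    forall x a, f x a 0%N = \sum_(b < N) F x a b.

(* The existentially quantified [psi] and [lam] are unique on homogeneous
   arguments, by induction on the arity; [mu]_n is (- hbar)^(-(n - 1)) [lam]_n. *)
Definition is_homotopy_pair A B (F xi : A -> ser B) : Prop :=
  [/\ hom_hbar_tau 0 F /\ hom_hbar_tau (-1) xi,
      forall a b, xi 1 a b = 0,
      forall x a b, dtau (F x) a b =
        lin_ext (bq_K B) (xi x) a b + lin_ext xi (bq_K A x) a b
    & exists psi lam mu : seq A -> ser B,
      [/\ eq_homog (on_prod F) (sum_blocks 0 (@ser_prod k B) psi),
          eq_homog (on_prod xi) (sum_blocks_at (@ser_prod k B) psi lam),
          forall n, (0 < n)%N -> shom_hbar_tau n (-1) mu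
        & forall s a b, (0 < size s)%N ->
            lam s a b = mulNhbar (size s).-1 (mu s) a b]].

Definition homotopic A B (f g : A -> ser B) : Prop :=
  exists F xi : A -> ser B,
    [/\ is_homotopy_pair F xi, value0 F f & value1 F g].

Definition homotopy_equivalence A B (f : A -> ser B) : Prop :=
  is_morphism f /\ exists f' : B -> ser A,
    [/\ is_morphism f',
        homotopic (fun x => lin_ext f' (f x)) (@cst k A)
      & homotopic (fun y => lin_ext f (f' y)) (@cst k B)].

Definition K0 A (x : A) : A := bq_K A x 0%N 0%N.

Lemma K0_differential A : differential (@K0 A).
Proof.
split; first exact: (bq_K_hom A).1.
by move=> x; have := bq_KK x 0 0; rewrite /lin_ext !big_ord1.
Qed.

Definition cohomology A := coh (K0_differential A).

Definition oneH A : cohomology A := cls (K0_differential A) 1.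

(* [x] is a cocycle representing [v] *)
Definition represents_class A (v : cohomology A) (x : A) : Prop :=
  K0 x = 0 /\ cls (K0_differential A) x = v.

(* the map induced on cohomology by the classical limit of [f] *)
Definition induced A B (f : A -> ser B) (v : cohomology A) : cohomology B :=
  cls (K0_differential B) (f (crep v) 0%N 0%N).

Record is_retract A (f : cohomology A -> A) (h : A -> cohomology A)
    (s : A -> A) : Prop := IsRetract {
  ret_f_hom : graded_hom 0 f;
  ret_h_hom : graded_hom 0 h;
  ret_s_hom : graded_hom (-1) s;
  ret_f1 : f (oneH A) = 1;
  ret_fP : forall v, represents_class v (f v);
  ret_h1 : h 1 = oneH A;
  ret_hK : forall x, h (K0 x) = 0;
  ret_hf : forall v, h (f v) = v;
  ret_fh : forall x, f (h x) = x - K0 (s x) - s (K0 x);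
  ret_KsK : forall x, K0 x = K0 (s (K0 x));
  ret_s1 : s 1 = 0;
  ret_ss : forall x, s (s x) = 0;
  ret_sf : forall v, s (f v) = 0;
  ret_hs : forall x, h (s x) = 0
}.

Definition obstruction A (fs : nat -> cohomology A -> A)
    (kappa : nat -> cohomology A -> cohomology A) (n : nat) (v : cohomology A)
    : A :=
  \sum_(0 <= j < n) bq_K A (fs j v) (n - j)%N 0%N
  - \sum_(1 <= j < n) fs (n - j)%N (kappa j v).

(* The vanishing of all the kappa^(n) does not depend on the retract. *)
Definition anomaly_free A : Prop :=
  exists f h s, is_retract f h s /\
  exists (fs : nat -> cohomology A -> A)
         (kappa : nat -> cohomology A -> cohomology A),
    [/\ forall v, fs 0%N v = f v,
        forall n v, (0 < n)%N -> kappa n v = h (obstruction fs kappa n v),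
        forall n v, (0 < n)%N -> fs n v = - s (obstruction fs kappa n v)
      & forall n v, (0 < n)%N -> kappa n v = 0].

End QFT.

(* (V, 1_V, l) and (V', 1_V', l') are given by their unit and operations. *)
Section SLinf.
Variables (k : fieldType) (V V' : gradedType k).
Variables (oneV : V) (oneV' : V').
Variables (l : seq V -> ser V) (l' : seq V' -> ser V').
Implicit Types phi lam : seq V -> ser V'.

Definition is_sLmorphism phi : Prop :=
  [/\ forall n, (0 < n)%N -> shom_hbar n 0 phi,
      forall a b, phi [:: oneV] a b = cst oneV' a b,
      forall s a b, (0 < size s)%N -> phi (rcons s oneV) a b = 0
    & eq_homog (sum_blocks 0 (mul_ext l') phi)
               (sum_insert 0 (mul_ext phi) l)].

(* phi_1 : (V[[hbar]], l_1) -> (V'[[hbar]], l'_1) is bijective on cohomology in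
   every degree. *)
Definition is_quasi_iso phi : Prop :=
  let D := lin_ext (fun v => l [:: v]) in
  let D' := lin_ext (fun v => l' [:: v]) in
  let phi1 := lin_ext (fun v => phi [:: v]) in
  (forall j (x : ser V) (z : ser V'), in_hbar j x -> in_hbar (j - 1) z ->
     (forall a b, D x a b = 0) -> (forall a b, phi1 x a b = D' z a b) ->
     exists2 w : ser V, in_hbar (j - 1) w & forall a b, x a b = D w a b) /\
  (forall j (y : ser V'), in_hbar j y -> (forall a b, D' y a b = 0) ->
     exists (x : ser V) (z : ser V'),
       [/\ in_hbar j x, in_hbar (j - 1) z, forall a b, D x a b = 0
         & forall a b, y a b = phi1 x a b + D' z a b]).

Definition sL_homotopic phi0 phi1 : Prop :=
  [/\ is_sLmorphism phi0, is_sLmorphism phi1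
    & exists phi lam,
      [/\ forall n, (0 < n)%N ->
            shom_hbar_tau n 0 phi /\ shom_hbar_tau n (-1) lam,
          forall s a b, lam (rcons s oneV) a b = 0,
          eq_homog (fun n d x => dtau (phi x))
            (fun n d x a b => sum_insert 0 (mul_ext lam) l d x a b
                              + sum_blocks_at (mul_ext l') phi lam d x a b),
          forall s a, (0 < size s)%N -> phi0 s a 0%N = phi s a 0%N
        & forall n, (0 < n)%N -> exists N,
            (forall s a b, size s = n -> (N <= b)%N -> phi s a b = 0) /\
            forall s a, size s = n -> phi1 s a 0%N = \sum_(b < N) phi s a b]].

End SLinf.

(* The values of (psi . phi)_n on homogeneous arguments of degrees d. *)
Definition sL_comp (k : fieldType) (V V' V'' : gradedType k)
    (psi : seq V' -> ser V'') (phi : seq V -> ser V')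
    n (d : n.-tuple int) (x : n.-tuple V) : ser V'' :=
  sum_blocks 0 (mul_ext psi) phi d x.

Section QuantumStructures.
Variables (k : fieldType) (A : binaryQFT k).
Local Notation H := (cohomology A).
Implicit Types phi : seq H -> ser A.

(* operations of (H[[hbar]], 1_H, 0) *)
Definition zero_ops (s : seq H) : ser H := fun _ _ => 0.

(* The series pi_n = \sum_(0 <= j <= n - 2) (- hbar)^j pi_n^(j) for n >= 2, and
   pi_1 = id, where [pi j] is the family of the pi_n^(j). *)
Definition pi_series (pi : nat -> seq H -> H) (s : seq H) : ser H :=
  if s is [:: v] then cst v
  else fun a b =>
    if (b == 0%N) && (a.+2 <= size s)%N then (-1) ^+ a *: pi a s else 0.

Definition is_distinguished phi (pi : nat -> seq H -> H) : Prop :=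
  [/\ is_sLmorphism (oneH A) 1 zero_ops (bq_ell A) phi /\
      is_quasi_iso zero_ops (bq_ell A) phi,
      forall v, represents_class v (phi [:: v] 0%N 0%N),
      forall n j, (j.+2 <= n)%N -> sym_hom n 0 (pi j),
      forall s a b, (0 < size s)%N ->
        pi_series pi (rcons s (oneH A)) a b = pi_series pi s a b
    & exists eta : seq H -> ser A,
        (forall n, (0 < n)%N -> shom_hbar n (-1) eta) /\
        eq_homog
          (fun n d v a b => sum_blocks 1 (@ser_prod k A) phi d v a b
             - lin_ext (fun u => phi [:: u]) (pi_series pi v) a b)
          (fun n d v => lin_ext (bq_K A) (eta v))].

(* [phi] belongs to the homotopy type [phi0] of a distinguished morphism. *)
Definition in_type_of phi0 phi : Prop :=
  sL_homotopic (oneH A) 1 zero_ops (bq_ell A) phi0 phi.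

(* Quantum structures are the homotopy types of distinguished morphisms;
   [phi] represents one of them. *)
Definition represents_quantum_structure phi : Prop :=
  exists phi0 pi, is_distinguished phi0 pi /\ in_type_of phi0 phi.

(* (H, 1_H, m) is the on-shell quantum correlation algebra associated with the
   quantum structure represented by [phi]: m_n = pi_n^(n-2) for n >= 2. *)
Definition is_correlation_algebra phi (m : seq H -> H) : Prop :=
  exists phi0 pi, [/\ is_distinguished phi0 pi, in_type_of phi0 phi
    & forall s, (1 < size s)%N -> m s = pi (size s - 2)%N s].

End QuantumStructures.

(* Main.v *)
From HB Require Import structures.
From mathcomp Require Import all_boot all_order all_algebra.
From mathcomp Require Import boolp functions zify.
Require Import Defs.
Set Implicit Arguments.
Unset Strict Implicit.
Unset Printing Implicit Defensive.
Import Order.TTheory GRing.Theory Num.Theory.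
Local Open Scope ring_scope.

(** A family [phi] of multilinear maps into a binary QFT algebra has a quantum
    exponential E_phi(s) = \sum_p (- hbar)^(n - |p|) eps(p) phi(s_B1) ... phi(s_B|p|)
    on words [s] of homogeneous arguments, written [fam_exp (wgt phi) s] below.
    The theorem rests on two identities about it.  A morphism [f] with
    descendant [psi] satisfies f E_phi = E_(psi . phi) ([morphism_exp]), and
    the differential satisfies K E_phi = (ell . phi) * E_phi, where [ell . phi]
    is the left-hand side of the [sL]-infinity equation of [phi] and [*] is the
    convolution over unshuffles ([differential_exp]).  Both are the defining
    relations of the descendants, extended by multilinearity to arguments that
    are series and combined with the fact that composition of families is
    compatible with convolution ([comp_conv], [comp_exp]).  An exponential is 1
    on the empty word and [hbar] is not a zero divisor, so such identities can
    be divided by exponentials ([conv_cancel]).  Hence [phi] is an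
    [sL]-infinity morphism from a space with zero operations iff its
    exponential is closed; and as [f] commutes with the differentials,
    [psi . phi] is again such a morphism ([flat_transport]).

    Homotopies are treated by the same identities on words with one extra
    letter, the marker [None] of degree -1: [lambda] is evaluated on the block
    that contains the marker.  In characteristic zero a family that solves the
    homotopy equation and is flat at time 0 is flat at all times, because the
    obstruction solves a linear differential equation ([flat_homotopy]); then
    the time derivative of the exponential is exact ([dtau_exp_exact]).
    Applying [f] and dividing by the exponential gives the homotopy equation of
    the composites ([homotopy_transport], [composite_homotopic]); integrating
    in time shows that homotopic families have cohomologous exponentials
    ([htpy_cobound]).

    Integrating the homotopies of the homotopy equivalence yields ordinary
    chain homotopies ([homotopic_chain]).  Their classical parts show that the
    maps induced by [f] and its homotopy inverse are mutually inverse on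
    cohomology, and the full ones that composition with [psi] preserves
    quasi-isomorphisms ([composite_quasi_iso]).  Since
    Pi - phi_1 pi = K eta implies f Pi - f phi_1 pi = K' f eta, and f Pi is the
    exponential of the composite, [psi . phi . I^-1] is distinguished with
    [I . pi . I^-1] in place of [pi] ([distinguished_composite]).  Finally [pi]
    depends on the homotopy type only: two choices differ by a series that
    [phi_1] maps to a coboundary, hence by zero, [phi_1] being injective on
    cohomology ([distinguished_eq]).  Comparing the coefficients of
    hbar^(n - 2) gives the isomorphism of correlation algebras. *)

(** * Signs *)

(** Signs act on arbitrary additive groups, so that the same sums serve for
    vectors, series and functions; [sgE] recovers (-1)^b as a scalar. *)
Definition sg (R : zmodType) (b : bool) (r : R) : R := if b then - r else r.

Section Signs.
Variable R : zmodType.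
Implicit Types (r : R) (b : bool).
Lemma sgsg b c r : sg b (sg c r) = sg (b (+) c) r.
Proof. by case: b c => [] []; rewrite /sg ?opprK. Qed.
Lemma sgD b r r' : sg b (r + r') = sg b r + sg b r'.
Proof. by case: b; rewrite /sg ?opprD. Qed.
Lemma sg0 b : sg b (0 : R) = 0.
Proof. by case: b; rewrite /sg ?oppr0. Qed.
Lemma sgE (k : fieldType) (V : lmodType k) b (v : V) : (-1) ^+ b *: v = sg b v.
Proof. by case: b; rewrite /sg ?expr1 ?expr0 ?scaleN1r ?scale1r. Qed.
Lemma sg_sum b (I : Type) (s : seq I) (P : pred I) (F : I -> R) :
  sg b (\sum_(i <- s | P i) F i) = \sum_(i <- s | P i) sg b (F i).
Proof. by case: b; rewrite /sg ?sumrN. Qed.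
End Signs.

(** * Signed sums over unshuffles *)

Section Unshuffles.
Variables (T : Type) (p : T -> bool).
Implicit Types (s a b c : seq T) (x : T).

Definition pars s : bool := foldr (fun x => addb (p x)) false s.

Lemma pars_cat a b : pars (a ++ b) = pars a (+) pars b.
Proof. by elim: a => //= x a ->; rewrite addbA. Qed.
Lemma pars_rcons a x : pars (rcons a x) = pars a (+) p x.
Proof. by rewrite -cats1 pars_cat /= addbF. Qed.

(** [ssum H s] sums [H a b] over all ways of splitting [s] into a subword [a]
    and the complementary subword [b], with the Koszul sign of the unshuffle:
    a letter that goes to [b] has to jump over all of [a]. *)
Fixpoint ssum (R : zmodType) (H : seq T -> seq T -> R) s : R :=
  if s is x :: s' then
    ssum (fun a b => H (x :: a) b) s' +
    ssum (fun a b => sg (p x && pars a) (H a (x :: b))) s'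
  else H [::] [::].

Section Theory.
Variable R : zmodType.
Implicit Types (H : seq T -> seq T -> R).

Lemma eq_ssum H H' s :
  (forall a b, (size a + size b)%N = size s -> pars a (+) pars b = pars s ->
     H a b = H' a b) -> ssum H s = ssum H' s.
Proof.
elim: s H H' => [|x s IH] H H' e /=; first exact: e.
congr (_ + _); apply: IH => a b sz pr; first by apply: e; rewrite /= -?pr ?addbA -?sz.
by congr sg; apply: e; rewrite /= -?pr ?addnS ?sz // addbCA.
Qed.

Lemma ssumD H H' s : ssum (fun a b => H a b + H' a b) s = ssum H s + ssum H' s.
Proof.
elim: s H H' => [|x s IH] H H' //=; rewrite IH addrACA; congr (_ + _).
by rewrite -IH; apply: eq_ssum => a b _ _; rewrite sgD.
Qed.

Lemma ssum0 s : ssum (fun _ _ => 0 : R) s = 0.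
Proof.
have := ssumD (fun _ _ => 0) (fun _ _ => 0) s.
rewrite -{1}[ssum _ s]addr0 (eq_ssum (H' := fun _ _ => 0)) => [|? ? _ _];
  last by rewrite addr0.
by move/addrI.
Qed.

Lemma ssum_sg (c : bool) H s : ssum (fun a b => sg c (H a b)) s = sg c (ssum H s).
Proof.
elim: s H => [|x s IH] H //=; rewrite sgD -!IH; congr (_ + _).
by apply: eq_ssum => a b _ _; rewrite !sgsg addbC.
Qed.

(** The recursion on the last letter; it is the one that matches the
    convention of ordering blocks by their maximal elements. *)
Lemma ssum_rcons H s x :
  ssum H (rcons s x) = ssum (fun a b => H a (rcons b x)) s
    + ssum (fun a b => sg (p x && pars b) (H (rcons a x) b)) s.
Proof.
elim: s H => [|y s IH] H /=; first by rewrite andbF /= addrC.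
rewrite !IH /= !addrA; congr (_ + _); last first.
  apply: eq_ssum => a b _ _; rewrite !sgsg pars_rcons; congr sg.
  by case: (p x) (p y) (pars a) (pars b) => [] [] [] [].
by rewrite -!addrA; congr (_ + _); rewrite addrC.
Qed.

Lemma ssumC H s :
  ssum H s = ssum (fun a b => sg (pars a && pars b) (H b a)) s.
Proof.
elim: s H => [|x s IH] H //=; rewrite IH [X in _ + X]IH addrC.
congr (_ + _); apply: eq_ssum => a b _ _ /=; rewrite ?sgsg; congr sg.
  by case: (p x) (pars a) (pars b) => [] [] [].
by case: (p x) (pars a) (pars b) => [] [] [].
Qed.

(** Coassociativity: both sides split [s] into three subwords. *)
Lemma ssumA (H : seq T -> seq T -> seq T -> R) s :
  ssum (fun a b => ssum (fun a1 a2 => H a1 a2 b) a) s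
  = ssum (fun a1 c => ssum (fun a2 b => H a1 a2 b) c) s.
Proof.
elim: s H => [|x s IH] H //=.
rewrite ssumD -addrA; congr (_ + _).
  exact: (IH (fun a1 a2 b => H (x :: a1) a2 b)).
rewrite (IH (fun a1 a2 b => sg (p x && pars a1) (H a1 (x :: a2) b))).
rewrite [X in _ + X](eq_ssum (H' := fun a b => ssum (fun a1 a2 =>
    sg (p x && (pars a1 (+) pars a2)) (H a1 a2 (x :: b))) a)); last first.
  by move=> a b _ _; rewrite -ssum_sg; apply: eq_ssum => a1 a2 _ ->.
rewrite (IH (fun a1 a2 b => sg (p x && (pars a1 (+) pars a2)) (H a1 a2 (x :: b)))).
rewrite -ssumD; apply: eq_ssum => a1 c _ _; rewrite sgD -!ssum_sg; congr (_ + _).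
apply: eq_ssum => a2 b _ _; rewrite sgsg; congr sg.
by case: (p x) (pars a1) (pars a2) => [] [] [].
Qed.

End Theory.

Lemma ssum_additive (R R' : zmodType) (f : R -> R') H s :
  {morph f : x y / x + y} -> ssum (fun a b => f (H a b)) s = f (ssum H s).
Proof.
move=> fD; have f0 : f 0 = 0 by have := fD 0 0; rewrite addr0 -{1}[f 0]addr0 => /addrI.
have fsg (e : bool) r : f (sg e r) = sg e (f r).
  case: e => //=; apply: (addrI (f r)); rewrite -fD !subrr; exact: f0.
elim: s H => [|x s IH] H //=; rewrite fD -!IH; congr (_ + _).
by apply: eq_ssum => a b _ _; rewrite fsg.
Qed.

Section LinearOp.
(** [Lop] is a linear operation on families of values.  A linear combination
    of two values yields multilinearity of the sums, and the extension of a map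
    to series yields their compatibility with series arguments. *)
Variables (R : zmodType) (I : Type) (Lop : (I -> R) -> R).
Hypothesis LD : forall g h, Lop (fun i => g i + h i) = Lop g + Lop h.

Lemma Lop0 : Lop (fun=> 0) = 0.
Proof.
have := LD (fun=> 0) (fun=> 0); rewrite addr0 -{1}[Lop _]addr0.
by move/addrI.
Qed.

Lemma Lop_sg (b : bool) g : Lop (fun i => sg b (g i)) = sg b (Lop g).
Proof.
case: b => //=; apply: (addrI (Lop g)); rewrite -LD subrr -Lop0.
by congr Lop; apply: funext => i; rewrite subrr.
Qed.

Lemma Lop_ssum (F : I -> seq T -> seq T -> R) s :
  Lop (fun i => ssum (F i) s) = ssum (fun a b => Lop (fun i => F i a b)) s.
Proof.
elim: s F => [|z s IH] F //=; rewrite LD !IH; congr (_ + _).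
by apply: eq_ssum => a b _ _; rewrite Lop_sg.
Qed.

Lemma ssum_subst (H : seq T -> seq T -> R) s1 s2 x (y : I -> T) :
  (forall i, p (y i) = p x) ->
  (forall a1 a2 b, (size a2 <= size s2)%N ->
     H (a1 ++ x :: a2) b = Lop (fun i => H (a1 ++ y i :: a2) b)) ->
  (forall a b1 b2, H a (b1 ++ x :: b2) = Lop (fun i => H a (b1 ++ y i :: b2))) ->
  ssum H (s1 ++ x :: s2) = Lop (fun i => ssum H (s1 ++ y i :: s2)).
Proof.
move=> py; elim: s1 H => [|z s1 IH] H Ha Hb /=.
  rewrite LD !Lop_ssum; congr (_ + _); apply: eq_ssum => a b sz _.
    by apply: (Ha [::]); rewrite -sz leq_addr.
  by rewrite (Hb a [::]) -Lop_sg; congr Lop; apply: funext => i; rewrite py.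
rewrite LD; congr (_ + _); apply: IH => [a1 a2 b le|a b1 b2] //.
- exact: (Ha (z :: a1)).
- rewrite Ha // -Lop_sg; congr Lop; apply: funext => i.
  by rewrite !pars_cat /= py.
- by rewrite (Hb a (z :: b1)) -Lop_sg.
Qed.

End LinearOp.

Section Letters.
Variable R : zmodType.
Implicit Types (H : seq T -> seq T -> R).

Lemma ssum_swap H s1 s2 x y :
  (forall a1 a2 b, (size a2 <= size s2)%N -> H (a1 ++ [:: x, y & a2]) b =
     sg (p x && p y) (H (a1 ++ [:: y, x & a2]) b)) ->
  (forall a b1 b2, H a (b1 ++ [:: x, y & b2]) =
     sg (p x && p y) (H a (b1 ++ [:: y, x & b2]))) ->
  ssum H (s1 ++ [:: x, y & s2]) = sg (p x && p y) (ssum H (s1 ++ [:: y, x & s2])).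
Proof.
elim: s1 H => [|z s1 IH] H Ha Hb /=.
  rewrite !sgD -!ssum_sg -!addrA; congr (_ + _).
    by apply: eq_ssum => a b sz _; apply: (Ha [::]); rewrite -sz leq_addr.
  rewrite addrCA; congr (_ + (_ + _)); apply: eq_ssum => a b _ _;
    rewrite ?(Hb a [::]) /= !sgsg; congr sg;
    by case: (p x) (p y) (pars a) => [] [] [].
rewrite sgD; congr (_ + _); apply: IH => [a1 a2 b le|a b1 b2] //.
- exact: (Ha (z :: a1)).
- rewrite Ha // !sgsg !pars_cat /=; congr sg.
  by case: (p z) (p y) (p x) (pars a1) (pars a2) => [] [] [] [] [].
- by rewrite (Hb a (z :: b1)) !sgsg addbC.
Qed.

Lemma ssum_closed (P : R -> Prop) H s :
  P 0 -> (forall r r', P r -> P r' -> P (r + r')) -> (forall r, P r -> P (- r)) ->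
  (forall a b, (size a + size b)%N = size s -> P (H a b)) -> P (ssum H s).
Proof.
move=> P0 PD PN; elim: s H => [|x s IH] H PH /=; first exact: PH.
apply: (PD); apply: IH => a b sz; first by apply: PH; rewrite /= -sz.
have := PH a (x :: b); rewrite /= addnS sz => /(_ erefl).
by case: (_ && _) => //=; apply: PN.
Qed.

(** The term with empty complement is isolated: it is the leading term when an
    equation between convolutions is solved by induction on the length. *)
Lemma ssum_left (P : R -> Prop) H s :
  P 0 -> (forall r r', P r -> P r' -> P (r + r')) -> (forall r, P r -> P (- r)) ->
  (forall a b, (size a + size b)%N = size s -> (size a < size s)%N -> P (H a b)) ->
  P (ssum H s - H s [::]).
Proof.
move=> P0 PD PN; elim: s H => [|x s IH] H PH /=; first by rewrite subrr.
rewrite addrAC; apply: (PD).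
  by apply: (IH (fun a b => H (x :: a) b)) => a b sz lt; apply: PH; rewrite /= ?addSn ?sz.
apply: ssum_closed => // a b sz.
have := PH a (x :: b); rewrite /= addnS sz ltnS -sz leq_addr => /(_ erefl erefl).
by case: (_ && _) => //=; apply: PN.
Qed.

Lemma ssum_left0 H s :
  (forall a b, (size a + size b)%N = size s -> (size a < size s)%N -> H a b = 0) ->
  ssum H s = H s [::].
Proof.
move=> H0; apply/eqP; rewrite -subr_eq0; apply/eqP.
apply: (@ssum_left (fun r => r = 0)) => //.
- by move=> r r' -> ->; rewrite addr0.
- by move=> r ->; rewrite oppr0.
Qed.

Lemma ssum_right0 H s :
  (forall a b, (size a + size b)%N = size s -> (size b < size s)%N -> H a b = 0) ->
  ssum H s = H [::] s.
Proof.
move=> H0; rewrite ssumC ssum_left0 /= ?andbF // => a b sz lt.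
by rewrite H0 ?sg0 // addnC.
Qed.

End Letters.
End Unshuffles.

Lemma ssum_map (T T' : Type) (p : T -> bool) (p' : T' -> bool) (h : T -> T')
    (R : zmodType) (H : seq T' -> seq T' -> R) s :
  (forall x, p' (h x) = p x) ->
  ssum p' H (map h s) = ssum p (fun a b => H (map h a) (map h b)) s.
Proof.
move=> ph; elim: s H => [|x s IH] H //=; rewrite !IH; congr (_ + _).
apply: eq_ssum => a b _ _; rewrite ph; congr (sg (_ && _) _).
by elim: a => //= z a ->; rewrite ph.
Qed.

(** * Signed sums over set partitions *)

Section Partitions.
Variables (T : Type) (p : T -> bool).
Implicit Types (s a b c : seq T) (x : T) (bl : seq (seq T)).

(** [psum G s] sums [G bl] over the set partitions [bl] of the letters of [s],
    with Koszul signs.  The block of the last letter is split off first and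
    placed last, which produces the blocks in increasing order of their maxima.
    The recursion is on the length, bounded by [n] in [psumn]. *)
Fixpoint psumn (R : zmodType) n (G : seq (seq T) -> R) s : R :=
  if n is n'.+1 then
    if s is x :: s' then
      ssum p (fun a b =>
        psumn n' (fun bl => G (rcons bl (rcons b (last x s')))) a) (belast x s')
    else G [::]
  else G [::].

Definition psum (R : zmodType) (G : seq (seq T) -> R) s : R := psumn (size s) G s.

Section Theory.
Variable R : zmodType.
Implicit Types (G : seq (seq T) -> R).

Lemma psumn_fuel n G s : (size s <= n)%N -> psumn n G s = psum G s.
Proof.
rewrite /psum; elim: n {-2}n (leqnn n) G s => [|m IH] [|n] lem G [|x s] //= les.
apply: eq_ssum => a b sz _; rewrite size_belast in sz.
have lea : (size a <= size s)%N by rewrite -sz leq_addr.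
have lean : (size a <= n)%N := leq_trans lea les.
have lesm : (size s <= m)%N := leq_trans les lem.
by rewrite (IH n) // (IH (size s)).
Qed.

Lemma psum0 G : psum G [::] = G [::]. Proof. by []. Qed.

Lemma psum_rcons G s x :
  psum G (rcons s x) =
  ssum p (fun a b => psum (fun bl => G (rcons bl (rcons b x))) a) s.
Proof.
have e : psum G (rcons s x) = ssum p (fun a b =>
   psumn (size s) (fun bl => G (rcons bl (rcons b x))) a) s.
  rewrite /psum size_rcons /=; case: s => [|y s] //=.
  by rewrite belast_rcons last_rcons.
rewrite e; apply: eq_ssum => a b sz _; apply: psumn_fuel.
by rewrite -sz leq_addr.
Qed.

(** Induction on the last letter, the hypothesis being available for all words
    that are not longer. *)
Lemma size_ind (P : seq T -> Prop) :
  P [::] -> (forall s x, (forall a, (size a <= size s)%N -> P a) -> P (rcons s x)) ->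
  forall s, P s.
Proof.
move=> P0 PS s; have [n] := ubnP (size s); elim: n s => // n IH s.
case/lastP: s => [|s x] //; rewrite size_rcons ltnS => lt; apply: PS => a lea.
by apply: IH; apply: leq_trans lt; rewrite ltnS.
Qed.

End Theory.

(** One induction for all relations compatible with sums and signs: equality of
    sums, membership in a subgroup, evaluation at a time. *)
Lemma psum_rel (R R' : zmodType) (Q : R -> R' -> Prop) (G : seq (seq T) -> R) (G' : seq (seq T) -> R') s :
  Q 0 0 -> (forall r1 r2 r1' r2', Q r1 r1' -> Q r2 r2' -> Q (r1 + r2) (r1' + r2')) ->
  (forall r r', Q r r' -> Q (- r) (- r')) ->
  (forall bl, all (fun b => 0 < size b)%N bl -> size (flatten bl) = size s ->
     pars p (flatten bl) = pars p s -> Q (G bl) (G' bl)) ->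
  Q (psum G s) (psum G' s).
Proof.
move=> Q0 QD QN; elim/size_ind: s G G' => [|s x IH] G G' QG; first exact: QG.
have Qss H H' t :
    (forall a b, (size a + size b)%N = size t -> pars p a (+) pars p b = pars p t ->
       Q (H a b) (H' a b)) -> Q (ssum p H t) (ssum p H' t).
  elim: t H H' => [|y t IHt] H H' QH /=; first exact: QH.
  apply: (QD); apply: IHt => a b sz pr.
    by apply: QH; rewrite /= -?pr ?addbA -?sz.
  suff: Q (H a (y :: b)) (H' a (y :: b)) by case: (_ && _) => //=; apply: QN.
  by apply: QH; rewrite /= -?pr ?addnS ?sz // addbCA.
rewrite !psum_rcons; apply: Qss => a b sz pr; apply: IH.
  by rewrite -sz leq_addr.
move=> bl nbl szbl prbl; apply: QG.
- by rewrite all_rcons size_rcons.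
- by rewrite flatten_rcons size_cat szbl !size_rcons addnS sz.
- by rewrite flatten_rcons pars_cat prbl !pars_rcons -pr addbA.
Qed.

Section PartitionTheory.
Variable R : zmodType.
Implicit Types (G : seq (seq T) -> R).

Lemma eq_psum G G' s :
  (forall bl, all (fun b => 0 < size b)%N bl -> size (flatten bl) = size s ->
     pars p (flatten bl) = pars p s -> G bl = G' bl) ->
  psum G s = psum G' s.
Proof.
move=> e; apply: (@psum_rel R R eq) => //.
- by move=> ? ? ? ? -> ->.
- by move=> ? ? ->.
Qed.

Lemma psumD G G' s : psum (fun bl => G bl + G' bl) s = psum G s + psum G' s.
Proof.
elim/size_ind: s G G' => [|s x IH] G G' //; rewrite !psum_rcons -ssumD.
by apply: eq_ssum => a b sz _; rewrite IH // -sz leq_addr.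
Qed.

Lemma psum_zero s : psum (fun=> 0 : R) s = 0.
Proof.
have := psumD (fun=> 0) (fun=> 0) s.
rewrite (@eq_psum _ (fun=> 0)) => [|? _ _ _]; last by rewrite addr0.
by rewrite -{1}[psum _ s]addr0 => /addrI.
Qed.

Section LinearOp.
Variables (I : Type) (Lop : (I -> R) -> R).
Hypothesis LD : forall g h, Lop (fun i => g i + h i) = Lop g + Lop h.

Lemma Lop_psum (F : I -> seq (seq T) -> R) s :
  Lop (fun i => psum (F i) s) = psum (fun bl => Lop (fun i => F i bl)) s.
Proof.
elim/size_ind: s F => [|s z IH] F; first by [].
under [in LHS]eq_fun do rewrite psum_rcons.
rewrite [LHS](@Lop_ssum T p R I Lop LD) psum_rcons; apply: eq_ssum => a b sz _.
by rewrite IH // -sz leq_addr.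
Qed.

Lemma psum_subst G s1 s2 x (y : I -> T) :
  (forall i, p (y i) = p x) ->
  (forall bl1 bl2 b1 b2, G (bl1 ++ (b1 ++ x :: b2) :: bl2)
     = Lop (fun i => G (bl1 ++ (b1 ++ y i :: b2) :: bl2))) ->
  psum G (s1 ++ x :: s2) = Lop (fun i => psum G (s1 ++ y i :: s2)).
Proof.
move=> py; elim/size_ind: s2 s1 G => [|s2 z IH] s1 G HG.
  rewrite cats1 psum_rcons.
  under [in RHS]eq_fun do rewrite cats1 psum_rcons.
  rewrite [RHS](@Lop_ssum T p R I Lop LD); apply: eq_ssum => a b _ _; rewrite Lop_psum.
  apply: eq_psum => bl _ _ _.
  rewrite -!cats1 HG; congr Lop; apply: funext => i; by rewrite -!cats1.
rewrite -rcons_cons -rcons_cat psum_rcons.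
under [in RHS]eq_fun do rewrite -rcons_cons -rcons_cat psum_rcons.
apply: ssum_subst => // [a1 a2 b le|a b1 b2].
  apply: IH => // bl1 bl2 b1 b2; rewrite rcons_cat rcons_cons HG.
  by congr Lop; apply: funext => i; rewrite rcons_cat rcons_cons.
rewrite Lop_psum; apply: eq_psum => bl _ _ _.
rewrite rcons_cat rcons_cons -cats1 HG; congr Lop; apply: funext => i.
by rewrite cats1 rcons_cat rcons_cons.
Qed.

End LinearOp.

Lemma psum_sg (c : bool) G s : psum (fun bl => sg c (G bl)) s = sg c (psum G s).
Proof.
have := @Lop_psum unit (fun g => sg c (g tt)) (fun g h => sgD c _ _) (fun=> G) s.
by [].
Qed.

(** The letters following the two are removed by induction; two last letters
    lie in one block, in whose letters the term is symmetric, or are the maxima of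
    the last two blocks, in which it is symmetric too. *)
Lemma psum_swap G s1 s2 x y :
  (forall bl1 bl2 b1 b2, G (bl1 ++ (b1 ++ [:: x, y & b2]) :: bl2) =
     sg (p x && p y) (G (bl1 ++ (b1 ++ [:: y, x & b2]) :: bl2))) ->
  (forall bl1 bl2 b c, G (bl1 ++ [:: b, c & bl2]) =
     sg (pars p b && pars p c) (G (bl1 ++ [:: c, b & bl2]))) ->
  psum G (s1 ++ [:: x, y & s2])
  = sg (p x && p y) (psum G (s1 ++ [:: y, x & s2])).
Proof.
elim/size_ind: s2 s1 G => [|s2 z IH] s1 G Hx Hb; last first.
  rewrite -!rcons_cons -!rcons_cat !psum_rcons.
  apply: ssum_swap => [a1 a2 b le|a b1 b2].
    apply: IH => // [bl1 bl2 b1 b2|bl1 bl2 b1 b2]; rewrite !rcons_cat !rcons_cons.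
      exact: Hx.
    exact: Hb.
  rewrite -psum_sg; apply: eq_psum => bl _ _ _.
  by rewrite !rcons_cat !rcons_cons -!cats1 Hx.
have e u v : psum G (s1 ++ [:: u; v]) =
    ssum p (fun a b => psum (fun bl => G (rcons bl (b ++ [:: u; v]))) a) s1
    + ssum p (fun a1 c => ssum p (fun a2 b => sg (p u && pars p b)
        (psum (fun bl => G (bl ++ [:: rcons a2 u; rcons b v])) a1)) c) s1.
  rewrite -(cat1s u) catA cats1 cats1 psum_rcons ssum_rcons; congr (_ + _).
    by apply: eq_ssum => a b _ _; apply: eq_psum => bl _ _ _; rewrite -!cats1 -catA.
  rewrite -ssumA; apply: eq_ssum => a b _ _; rewrite psum_rcons -ssum_sg.
  apply: eq_ssum => a1 a2 _ _; congr sg; apply: eq_psum => bl _ _ _.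
  by rewrite -!cats1 -catA.
rewrite !e sgD -!ssum_sg; congr (_ + _).
  apply: eq_ssum => a b _ _; rewrite -psum_sg; apply: eq_psum => bl _ _ _.
  by rewrite -!cats1; exact: Hx.
apply: eq_ssum => a1 c _ _; rewrite -ssum_sg ssumC; apply: eq_ssum => a2 b _ _.
rewrite (eq_psum (G' := fun bl => sg ((pars p b (+) p x) && (pars p a2 (+) p y))
  (G (bl ++ [:: rcons a2 y; rcons b x])))) => [|bl _ _ _]; last first.
  by rewrite Hb !pars_rcons.
rewrite psum_sg !sgsg; congr sg.
by case: (p x) (p y) (pars p a2) (pars p b) => [] [] [] [].
Qed.

(** Here the smallest letter joins a block or forms a new one; this leaves the
    order of the blocks, governed by their largest letters, unchanged. *)
Lemma psum_cons G x s :
  psum G (x :: s) = psum (fun bl => G ([:: x] :: bl)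
    + \sum_(i < size bl) sg (p x && pars p (flatten (take i bl)))
        (G (take i bl ++ (x :: nth [::] bl i) :: drop i.+1 bl))) s.
Proof.
elim/size_ind: s G => [|s z IH] G.
  by rewrite -[[:: x]]/(rcons [::] x) psum_rcons /= !psum0 /= big_ord0 addr0.
rewrite -rcons_cons !psum_rcons /= -ssumD; apply: eq_ssum => a b sz _.
rewrite IH; last by rewrite -sz leq_addr.
rewrite -[in X in _ + X]psum_sg -psumD; apply: eq_psum => bl _ _ prbl.
rewrite size_rcons big_ord_recr /= -addrA; congr (_ + (_ + _)).
  apply: eq_bigr => i _; rewrite drop_rcons ?nth_rcons ?ltn_ord //.
  by rewrite -[rcons bl _]cats1 takel_cat ?(ltnW (ltn_ord i)) // rcons_cat rcons_cons.
have -> : take (size bl) (rcons bl (rcons b z)) = bl by rewrite -cats1 take_size_cat.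
by rewrite prbl nth_rcons ltnn eqxx drop_oversize ?size_rcons // cats1.
Qed.

End PartitionTheory.

Lemma psum_additive (R R' : zmodType) (f : R -> R') G s :
  {morph f : x y / x + y} -> psum (fun bl => f (G bl)) s = f (psum G s).
Proof.
move=> fD; elim/size_ind: s G => [|s x IH] G //.
rewrite !psum_rcons -(ssum_additive _ _ _ fD); apply: eq_ssum => a b sz _.
by rewrite IH // -sz leq_addr.
Qed.

End Partitions.

Lemma psum_map (T T' : Type) (p : T -> bool) (p' : T' -> bool) (h : T -> T')
    (R : zmodType) (G : seq (seq T') -> R) s :
  (forall x, p' (h x) = p x) ->
  psum p' G (map h s) = psum p (fun bl => G (map (map h) bl)) s.
Proof.
move=> ph; elim/size_ind: s G => [|s x IH] G //.
rewrite map_rcons !psum_rcons (ssum_map _ _ ph); apply: eq_ssum => a b sz _.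
rewrite IH ?(leq_trans _ (leq_addr (size b) _)) ?sz // -?sz ?leq_addr //.
by apply: eq_psum => bl _ _ _; rewrite !map_rcons.
Qed.

(** * Partitions of finite sets of indices as sums over words *)

Lemma pars_big (T : Type) (p : T -> bool) s : pars p s = \big[addb/false]_(x <- s) p x.
Proof. by elim: s => [|x s IH]; rewrite ?big_nil // big_cons -IH. Qed.

Lemma perm_pars (T : eqType) (p : T -> bool) s t :
  perm_eq s t -> pars p s = pars p t.
Proof. by move=> e; rewrite !pars_big; exact: perm_big. Qed.

Lemma odd_sum (T : Type) (s : seq T) (P : pred T) (F : T -> nat) :
  odd (\sum_(x <- s | P x) F x)%N = \big[addb/false]_(x <- s | P x) odd (F x).
Proof.
by elim/big_rec2: _ => // x b n _ <-; rewrite oddD.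
Qed.

Section Words.
Variables (n : nat) (q : 'I_n -> bool).
Implicit Types (a b w : seq 'I_n) (D U : {set 'I_n}) (P : {set {set 'I_n}}).

(** The parity of the number of pairs of odd indices, one in [a] and a smaller
    one in [b]. *)
Definition crossing a b : bool :=
  pars (fun x : 'I_n => pars (fun y : 'I_n => [&& (y < x)%N, q x & q y]) b) a.

Arguments crossing : simpl never.

Fixpoint inversions w : bool :=
  if w is x :: w' then crossing [:: x] w' (+) inversions w' else false.

Lemma crossing_catl a a' b : crossing (a ++ a') b = crossing a b (+) crossing a' b.
Proof. exact: pars_cat. Qed.

Lemma crossing_catr a b b' : crossing a (b ++ b') = crossing a b (+) crossing a b'.
Proof.
rewrite /crossing; elim: a => //= x a ->; rewrite pars_cat.
by rewrite -!addbA; congr addb; rewrite addbCA.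
Qed.

Lemma inversions_cat a b :
  inversions (a ++ b) = inversions a (+) inversions b (+) crossing a b.
Proof.
elim: a => [|x a IH]; first by rewrite /= addbF.
rewrite cat_cons /= IH crossing_catr -[x :: a]cat1s crossing_catl.
by case: (crossing [:: x] a) (crossing [:: x] b) (inversions a) (inversions b) (crossing a b)
  => [] [] [] [] [].
Qed.

Lemma perm_crossing a a' b : perm_eq a a' -> crossing a b = crossing a' b.
Proof. exact: perm_pars. Qed.

Lemma pars_false (T : eqType) (p : T -> bool) s :
  {in s, forall x, p x = false} -> pars p s = false.
Proof.
elim: s => //= x s IH e; rewrite e ?mem_head // IH // => y ys.
by rewrite e // inE ys orbT.
Qed.

Lemma pairwise_enum D : pairwise (fun i j : 'I_n => (i < j)%N) (enum D).
Proof.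
rewrite /enum_mem; apply: (subseq_pairwise (filter_subseq _ _)).
rewrite -(@pairwise_map _ _ val ltn) -enumT val_enum_ord.
by rewrite -(sorted_pairwise ltn_trans) iota_ltn_sorted.
Qed.

Lemma enum_rcons D (m : 'I_n) : (forall x, x \in D -> (x < m)%N) ->
  enum (m |: D) = rcons (enum D) m.
Proof.
move=> lt.
have tr : transitive (fun i j : 'I_n => (i < j)%N) by move=> y x z; exact: ltn_trans.
apply: (irr_sorted_eq tr) => [x|||x]; first exact: ltnn.
- by rewrite sorted_pairwise // pairwise_enum.
- rewrite sorted_pairwise // -cats1 pairwise_cat pairwise_enum /= andbT.
  by apply/allrelP => x y; rewrite mem_enum inE => xD /eqP->; exact: lt.
- by rewrite mem_rcons !inE !mem_enum !inE.
Qed.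

Lemma inversions_sorted w : pairwise (fun i j : 'I_n => (i < j)%N) w -> inversions w = false.
Proof.
elim: w => //= x w IH /andP[lt pw]; rewrite IH // /crossing /= !addbF.
apply: pars_false => y yw; have /(allP lt)/ltnW := yw.
by rewrite leqNgt => /negbTE->.
Qed.

Lemma big_subsets (R : zmodType) (F : {set 'I_n} -> R) D m : m \notin D ->
  \sum_(U : {set 'I_n} | U \subset m |: D) F U
  = \sum_(U : {set 'I_n} | U \subset D) F (m |: U)
    + \sum_(U : {set 'I_n} | U \subset D) F U.
Proof.
move=> mD; rewrite (bigID (fun U : {set 'I_n} => m \in U)) /=; congr (_ + _).
  rewrite (reindex_onto (fun U => m |: U) (fun U => U :\ m)) /=; last first.
    by move=> U /andP[_ mU]; rewrite setD1K.
  apply: eq_bigl => U; rewrite setU11 andbT subUset sub1set setU11 /=.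
  apply/andP/idP => [[UmD /eqP e]|UD].
    have mU : m \notin U by rewrite -e setD11.
    apply/subsetP => x xU; have /(subsetP UmD) := xU; rewrite !inE.
    by case: eqP => // xm; rewrite -xm xU in mU.
  rewrite (subset_trans UD (subsetUr _ _)) setU1K //.
  by apply: contra mD; apply: (subsetP UD).
apply: eq_bigl => U; apply/andP/idP => [[UmD mU]|UD].
  apply/subsetP => x xU; have /(subsetP UmD) := xU; rewrite !inE.
  by case: eqP => // xm; rewrite -xm xU in mU.
rewrite (subset_trans UD (subsetUr _ _)); split=> //.
by apply: contra mD; apply: (subsetP UD).
Qed.

(** The decomposition that drives all inductions below: the maximal index is
    the last letter of the word [enum D]. *)
Lemma max_split D : D != set0 -> exists m (E : {set 'I_n}),
  [/\ D = m |: E, m \notin E & forall x, x \in E -> (x < m)%N].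
Proof.
case/set0Pn => x0 x0D; case: (@arg_maxnP _ x0 (fun x => x \in D) val x0D) => m mD le.
exists m, (D :\ m); split; rewrite ?setD1K ?setD11 // => x.
rewrite !inE => /andP[ne /le lexm]; rewrite ltn_neqAle [(x <= m)%N]lexm andbT.
by apply: contraNneq ne => /val_inj ->.
Qed.

(** A subset [U] of the indices is an unshuffle of the increasing word of
    indices; splitting off the maximal index is the recursion [ssum_rcons]. *)
Lemma big_subsets_ssum (R : zmodType) (H : seq 'I_n -> seq 'I_n -> R) D :
  \sum_(U : {set 'I_n} | U \subset D)
     sg (crossing (enum (D :\: U)) (enum U)) (H (enum (D :\: U)) (enum U))
  = ssum q H (enum D).
Proof.
have [N] := ubnP #|D|; elim: N D H => // N IH D H.
case: (eqVneq D set0) => [->|D0].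
  rewrite (big_pred1 set0) => [|U]; last by rewrite subset0.
  by rewrite set0D enum_set0.
have [m [E [-> mE lt]]] := max_split D0; rewrite cardsU1 mE ltnS => cN.
rewrite enum_rcons // ssum_rcons -!(IH E) // big_subsets //; congr (_ + _);
  apply: eq_bigr => U UE.
  have mU : m \notin U by apply: contra mE; apply: (subsetP UE).
  have -> : (m |: E) :\: (m |: U) = E :\: U.
    apply/setP => x; rewrite !inE; case: eqP => //= ->.
    by rewrite (negbTE mE) andbF.
  rewrite enum_rcons => [|x xU]; last by apply: lt; apply: (subsetP UE).
  rewrite -cats1 crossing_catr.
  suff -> : crossing (enum (E :\: U)) [:: m] = false by rewrite addbF.
  apply: pars_false => x; rewrite mem_enum inE => /andP[_ xE] /=.
  by rewrite ltnNge (ltnW (lt _ xE)).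
have mU : m \notin U by apply: contra mE; apply: (subsetP UE).
have -> : (m |: E) :\: U = m |: (E :\: U).
  apply/setP => x; rewrite !inE; case: eqP => //= ->.
  by rewrite (negbTE mU).
rewrite enum_rcons => [|x]; last by rewrite inE => /andP[_ /lt].
rewrite -cats1 crossing_catl sgsg cats1; congr sg; congr addb.
rewrite /crossing /= addbF.
have : {in enum U, forall x : 'I_n, (x < m)%N} by move=> x; rewrite mem_enum => /(subsetP UE)/lt.
elim: (enum U) => [|x w IHw] e; first by rewrite /= andbF.
rewrite /= IHw => [|y yw]; last by apply: e; rewrite inE yw orbT.
by rewrite e ?mem_head //; case: (q m) (q x).
Qed.

Lemma perm_flatten_blocks P D : partition P D ->
  perm_eq (flatten [seq enum B | B : {set 'I_n} <- blocks P]) (enum D).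
Proof.
move=> PD; apply/permP => a; rewrite count_flatten -map_comp.
have e (B : {set 'I_n}) : count a (enum B) = (\sum_(x in B) a x)%N.
  by rewrite -sum1_count big_enum_cond /= big_mkcondr; apply: eq_bigr => i _; case: (a i).
rewrite e (set_partition_big _ PD) /= sumnE big_map.
rewrite (perm_big (enum P)) /=; last by rewrite /blocks perm_sort.
by rewrite big_enum; apply: eq_bigr => B _ /=; rewrite e.
Qed.

(** The elements of all the other blocks are smaller than [m]. *)
Lemma blocks_add P (E : {set 'I_n}) (m : 'I_n) U : (forall x : 'I_n, x \in E -> (x < m)%N) ->
  U \subset E -> partition P (E :\: U) ->
  blocks ((m |: U) |: P) = rcons (blocks P) (m |: U).
Proof.
move=> lt UE PE.
have mE : m \notin E by apply/negP => /lt; rewrite ltnn.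
have max_mU : (\max_(i in m |: U) i = m)%N.
  apply/eqP; rewrite eqn_leq (leq_bigmax_cond (F := fun i : 'I_n => i : nat)) ?setU11 // andbT.
  apply/bigmax_leqP => x; rewrite !inE => /orP[/eqP->//|/(subsetP UE)/lt/ltnW//].
have sP B : B \in P -> B \subset E.
  case/and3P: PE => /eqP cP _ _ BP; apply: (subset_trans (bigcup_sup _ BP)).
  by rewrite -/(cover P) cP subsetDl.
have mUP : m |: U \notin P.
  by apply: contra mE => /sP/subsetP; apply; rewrite setU11.
have tot : total (fun B B' : {set 'I_n} => (\max_(i in B) i <= \max_(i in B') i)%N).
  by move=> B B'; exact: leq_total.
have tr : transitive (fun B B' : {set 'I_n} => (\max_(i in B) i <= \max_(i in B') i)%N).
  by move=> B B' B''; exact: leq_trans.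
rewrite -[RHS](sorted_sort tr); last first.
  rewrite sorted_pairwise // -cats1 pairwise_cat /= andbT -sorted_pairwise //.
  rewrite sort_sorted // andbT; apply/allrelP => B C; rewrite mem_sort mem_enum => BP.
  rewrite inE => /eqP->; rewrite max_mU; apply/bigmax_leqP => x xB.
  by apply/ltnW/lt; apply: (subsetP (sP _ BP)).
apply/perm_sort_inP => [B B' _ _|B B' B'' _ _ _|B B'|].
- exact: tot.
- exact: tr.
- rewrite !mem_enum => BP BP' /anti_leq eq_max.
  have pPU : partition ((m |: U) |: P) ((m |: U) :|: (E :\: U)).
    apply: partitionU1 => //; first by apply/set0Pn; exists m; rewrite setU11.
    rewrite -setI_eq0; apply/eqP/setP => x; rewrite !inE.
    by case: eqP => [->|_] /=; rewrite ?(negbTE mE) ?andbF // andbA andbN.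
  case/and3P: pPU => _ /trivIsetP tI n0.
  have mx C : C \in (m |: U) |: P -> exists2 x, x \in C & \max_(i in C) i = x :> nat.
    move=> CP; have C0 : (0 < #|C|)%N.
      by rewrite card_gt0; apply: contra n0 => /eqP <-.
    by have [x xC ->] := eq_bigmax_cond (fun i : 'I_n => i : nat) C0; exists x.
  have [x xB ex] := mx _ BP; have [y yB ey] := mx _ BP'.
  have exy : x = y by apply: val_inj; rewrite -[LHS]ex -[RHS]ey.
  apply: contraTeq isT => ne; have := tI _ _ BP BP' ne.
  by rewrite -setI_eq0 => /eqP/setP/(_ x); rewrite !inE xB exy yB.
- apply: uniq_perm; first exact: enum_uniq.
    by rewrite rcons_uniq mem_sort mem_enum mUP sort_uniq enum_uniq.
  by move=> B; rewrite mem_rcons !inE mem_sort !mem_enum !inE.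
Qed.

Lemma big_partitions_max (R : zmodType) (F : {set {set 'I_n}} -> R) (E : {set 'I_n}) m :
  m \notin E ->
  \sum_(P | partition P (m |: E)) F P
  = \sum_(U : {set 'I_n} | U \subset E)
      \sum_(P | partition P (E :\: U)) F ((m |: U) |: P).
Proof.
move=> mE; rewrite (partition_big (fun P => pblock P m :\ m) (fun U => U \subset E)) /=.
  apply: eq_bigr => U UE.
  have mU : m \notin U by apply: contra mE; apply: (subsetP UE).
  have eD : (m |: E) :\: (m |: U) = E :\: U.
    apply/setP => x; rewrite !inE; case: eqP => //= ->.
    by rewrite (negbTE mE) andbF.
  have dis : [disjoint m |: U & E :\: U].
    rewrite -setI_eq0; apply/eqP/setP => x; rewrite !inE.
    by case: eqP => [->|_] /=; rewrite ?(negbTE mE) ?andbF // andbA andbN.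
  have eU : (m |: U) :|: (E :\: U) = m |: E.
    apply/setP => x; rewrite !inE; case: eqP => //= _.
    by case: (boolP (x \in U)) => //= /(subsetP UE)->.
  have notin P : partition P (E :\: U) -> m |: U \notin P.
    case/and3P => /eqP cP _ _; apply/negP => /(bigcup_sup (m |: U) (F := id)) /subsetP /(_ m).
    by rewrite setU11 -/(cover P) cP !inE (negbTE mE) andbF => /(_ isT).
  rewrite (reindex_onto (fun P => (m |: U) |: P) (fun P => P :\ (m |: U))) /=; last first.
    move=> P /andP[/and3P[/eqP cP tP n0] /eqP <-].
    have mc : m \in cover P by rewrite cP setU11.
    by rewrite setD1K ?setD1K ?mem_pblock ?pblock_mem.
  apply: eq_bigl => P; apply/andP/idP => [[/andP[pP _] /eqP e]|pP].
    by rewrite -eD -e; apply: partitionD1; rewrite ?setU11.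
  have pUP : partition ((m |: U) |: P) (m |: E).
    by rewrite -eU; apply: partitionU1 => //; apply/set0Pn; exists m; rewrite setU11.
  split; last by rewrite setU1K // notin.
  rewrite pUP /= (@def_pblock _ _ (m |: U)) ?setU11 ?setU1K //.
  by case/and3P: pUP.
move=> P /and3P[/eqP cP tP n0].
have mc : m \in cover P by rewrite cP setU11.
apply/subsetP => x; rewrite !inE => /andP[/negbTE xm xP].
have: x \in cover P by apply/bigcupP; exists (pblock P m); rewrite ?pblock_mem.
by rewrite cP !inE xm.
Qed.

(** A partition amounts to the rest [U] of the block of the maximal index and
    a partition of the complement, which is the recursion [psum_rcons]. *)
Lemma big_partitions_psum (R : zmodType) (G : seq (seq 'I_n) -> R) D :
  \sum_(P | partition P D)
     sg (inversions (flatten [seq enum B | B : {set 'I_n} <- blocks P]))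
        (G [seq enum B | B : {set 'I_n} <- blocks P])
  = psum q G (enum D).
Proof.
have [N] := ubnP #|D|; elim: N D G => // N IH D G.
case: (eqVneq D set0) => [->|D0].
  rewrite (big_pred1 set0) => [|U]; last by rewrite partition_set0.
  by rewrite /blocks !enum_set0.
have [m [E [-> mE lt]]] := max_split D0; rewrite cardsU1 mE ltnS => cN.
rewrite big_partitions_max // enum_rcons // psum_rcons -big_subsets_ssum.
apply: eq_bigr => U UE; rewrite -(IH (E :\: U)); last first.
  by apply: leq_ltn_trans cN; apply: subset_leq_card; apply: subsetDl.
rewrite sg_sum; apply: eq_bigr => P PE; rewrite (blocks_add lt) //.
have eU : enum (m |: U) = rcons (enum U) m.
  by apply: enum_rcons => x /(subsetP UE)/lt.
rewrite sgsg !map_rcons flatten_rcons eU; congr sg.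
rewrite inversions_cat (perm_crossing _ (perm_flatten_blocks PE)) -eU.
rewrite (inversions_sorted (pairwise_enum _)) addbF addbC; congr addb.
rewrite eU -cats1 crossing_catr.
suff -> : crossing (enum (E :\: U)) [:: m] = false by rewrite addbF.
apply: pars_false => x; rewrite mem_enum inE => /andP[_ xE] /=.
by rewrite ltnNge (ltnW (lt _ xE)).
Qed.

(** Matches the sign of [koszul], a double sum over positions, with the
    recursive count of inversions. *)
Lemma odd_inversions w : uniq w ->
  odd (\sum_(i <- w) \sum_(j <- w | (i < j)%N && (index j w < index i w)%N)
         (q i && q j))%N = inversions w.
Proof.
elim: w => [|x w IH] /=; first by rewrite big_nil.
case/andP => xw uw; rewrite big_cons oddD [in X in X (+) _]big1 => [|j]; last first.
  by rewrite eqxx ltn0 andbF.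
rewrite -IH //= (@eq_big_seq _ _ _ _ _ _ (fun i : 'I_n => ([&& (i < x)%N, q x & q i] +
   \sum_(j <- w | (i < j)%N && (index j w < index i w)%N) (q i && q j))%N)); last first.
  move=> i iw; have xi : (x == i) = false by apply: contraNF xw => /eqP->.
  rewrite big_cons eqxx xi ltnS leq0n andbT.
  have -> : (\sum_(j <- w | (i < j)%N && ((if x == j then 0 else (index j w).+1) < (index i w).+1)%N)
      (q i && q j) = \sum_(j <- w | (i < j)%N && (index j w < index i w)%N) (q i && q j))%N.
    rewrite big_seq_cond [RHS]big_seq_cond; apply: eq_bigl => j.
    case: (boolP (j \in w)) => //= jw; have -> // : (x == j) = false.
    by apply: contraNF xw => /eqP->.
  by case: (i < x)%N => //=; rewrite andbC.
rewrite big_split /= oddD odd_sum; congr (_ (+) _).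
rewrite /crossing /= addbF pars_big; apply: eq_bigr => y _.
by rewrite oddb.
Qed.

End Words.

Section Koszul.
Variables (k : fieldType) (n : nat) (d : n.-tuple int).
Local Notation par := (fun i : 'I_n => parity (tnth d i)).

Lemma koszulE (R : lmodType k) (P : {set {set 'I_n}}) (r : R) :
  partition P [set: 'I_n] ->
  koszul k d P *: r =
  sg (inversions par (flatten [seq enum B | B : {set 'I_n} <- blocks P])) r.
Proof.
move=> /perm_flatten_blocks pw; rewrite /koszul -sgE.
set w := flatten _ in pw *.
have pT : perm_eq w (enum 'I_n).
  rewrite (perm_trans pw) //; apply: uniq_perm; rewrite ?enum_uniq // => i.
  by rewrite !mem_enum inE.
have uw : uniq w by rewrite (perm_uniq pT) enum_uniq.
congr (_ *: _); rewrite -signr_odd -(odd_inversions par uw); congr (_ ^+ odd _).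
rewrite [RHS](perm_big _ pT) /= -[LHS]big_enum /=.
by apply: eq_bigr => i _; rewrite [RHS](perm_big _ pT) /= big_enum_cond.
Qed.

(** The right-hand side obeys the recursion [psum_rcons] on the last letter,
    which makes inductive proofs possible. *)
Lemma sum_koszul_psum (R : lmodType k) (T : Type) (p : T -> bool) (t : 'I_n -> T)
    (G : seq (seq T) -> R) :
  (forall i, p (t i) = par i) ->
  \sum_(P : {set {set 'I_n}} | partition P [set: 'I_n])
    koszul k d P *: G [seq map t (enum B) | B : {set 'I_n} <- blocks P]
  = psum p G (map t (enum 'I_n)).
Proof.
move=> pt; rewrite (psum_map (p := par)) //.
have -> : enum 'I_n = enum [set: 'I_n].
  by apply/esym/eq_enum => i; rewrite !inE.
rewrite -big_partitions_psum; apply: eq_bigr => P PT.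
by rewrite koszulE // -map_comp.
Qed.

End Koszul.

(** * Formal series *)

HB.instance Definition _ (k : fieldType) (W : gradedType k) :=
  GRing.Lmodule.copy (ser W) (nat -> nat -> W).

Section Triangles.
Variable R : zmodType.
Implicit Types (G : nat -> nat -> nat -> R).

(** The reindexings of triangular sums behind commutativity and associativity
    of convolution products of coefficient sequences. *)
Lemma tri_swap G a :
  \sum_(i < a.+1) \sum_(j < (a - i).+1) G i j (a - i - j)%N
  = \sum_(j < a.+1) \sum_(i < (a - j).+1) G i j (a - j - i)%N.
Proof.
have e (F : nat -> nat -> R) :
   \sum_(i < a.+1) \sum_(j < (a - i).+1) F i j
   = \sum_(i < a.+1) \sum_(j < a.+1 | (i + j <= a)%N) F i j.
  apply: eq_bigr => i _.
  rewrite (big_ord_widen a.+1 (F i)) ?ltnS ?leq_subr //.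
  by apply: eq_bigl => j; rewrite ltnS leq_subRL // -ltnS.
rewrite (e (fun i j => G i j (a - i - j)%N)) (e (fun j i => G i j (a - j - i)%N)).
rewrite (exchange_big_dep xpredT) //=; apply: eq_bigr => j _.
by apply: eq_big => i; rewrite ?[(i + j)%N]addnC // -!subnDA addnC.
Qed.

Lemma tri_assoc G a :
  \sum_(i < a.+1) \sum_(j < i.+1) G j (i - j)%N (a - i)%N
  = \sum_(j < a.+1) \sum_(m < (a - j).+1) G j m (a - j - m)%N.
Proof.
transitivity (\sum_(i < a.+1) \sum_(j < a.+1 | (j <= i)%N) G j (i - j)%N (a - i)%N).
  apply: eq_bigr => i _.
  by rewrite (big_ord_widen a.+1 (fun j => G j (i - j)%N (a - i)%N)).
rewrite (exchange_big_dep xpredT) //=; apply: eq_bigr => j _.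
have ja : (j <= a)%N by rewrite -ltnS.
rewrite -(big_mkord (fun i => (j <= i)%N) (fun i => G j (i - j)%N (a - i)%N)).
rewrite (@big_cat_nat _ _ _ j) //=; last by rewrite leqW.
rewrite big_nat_cond big_pred0 ?add0r => [|i]; last first.
  by case: (leqP j i) => ij; rewrite ?andbF // ltnNge ij.
rewrite -{1}[nat_of_ord j]add0n big_addn subSn // big_mkord.
by apply: eq_big => m; rewrite ?leq_addl // => _; rewrite addnK -subnDA addnC.
Qed.
End Triangles.

Section Series.
Variable k : fieldType.
Implicit Types (V W U : gradedType k).

Lemma serP V (x y : ser V) : (forall a b, x a b = y a b) -> x = y.
Proof. by move=> e; apply: funext => a; apply: funext => b. Qed.

Lemma serDE V (x y : ser V) a b : (x + y) a b = x a b + y a b.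
Proof. by []. Qed.
Lemma serZE V c (x : ser V) a b : (c *: x) a b = c *: x a b.
Proof. by []. Qed.
Lemma serNE V (x : ser V) a b : (- x) a b = - x a b.
Proof. by []. Qed.

Lemma ser_sumE V (I : Type) (r : seq I) (P : pred I) (F : I -> ser V) a b :
  (\sum_(i <- r | P i) F i) a b = \sum_(i <- r | P i) F i a b.
Proof. by elim/big_rec2: _ => // i y x _ <-. Qed.

Lemma ser_sgE V (e : bool) (x : ser V) a b : sg e x a b = sg e (x a b).
Proof. by case: e. Qed.

Definition slin V W (f : V -> ser W) : Prop :=
  forall c x y, f (c *: x + y) = c *: f x + f y.

Lemma slinD V W (f : V -> ser W) : slin f -> {morph f : x y / x + y}.
Proof. by move=> fl x y; rewrite -[x]scale1r fl !scale1r. Qed.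
Lemma slin0 V W (f : V -> ser W) : slin f -> f 0 = 0.
Proof.
by move/slinD => fD; have := fD 0 0; rewrite addr0 -{1}[f 0]addr0 => /addrI.
Qed.
Lemma slinZ V W (f : V -> ser W) : slin f -> forall c x, f (c *: x) = c *: f x.
Proof. by move=> fl c x; rewrite -[c *: x]addr0 fl (slin0 fl) addr0. Qed.
Lemma slin_sum V W (f : V -> ser W) (I : Type) (r : seq I) (P : pred I) (F : I -> V) :
  slin f -> f (\sum_(i <- r | P i) F i) = \sum_(i <- r | P i) f (F i).
Proof.
by move=> fl; elim/big_rec2: _ => [|i y x _ <-]; rewrite ?(slin0 fl) ?(slinD fl).
Qed.

Lemma lin_extD V W (f g : V -> ser W) x :
  lin_ext (fun v => f v + g v) x = lin_ext f x + lin_ext g x.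
Proof.
apply: serP => a b; rewrite serDE /lin_ext -big_split; apply: eq_bigr => i _.
by rewrite -big_split.
Qed.

Lemma lin_ext_slin V W (f : V -> ser W) c x y : slin f ->
  lin_ext f (c *: x + y) = c *: lin_ext f x + lin_ext f y.
Proof.
move=> fl; apply: serP => a b.
rewrite serDE serZE /lin_ext scaler_sumr -big_split; apply: eq_bigr => i _.
by rewrite /= scaler_sumr -big_split; apply: eq_bigr => j _; rewrite /= fl.
Qed.

Lemma lin_ext_add V W (f : V -> ser W) : slin f -> {morph lin_ext f : x y / x + y}.
Proof. by move=> fl x y; rewrite -[x]scale1r lin_ext_slin // !scale1r. Qed.

Lemma lin_ext0 V W (f : V -> ser W) : slin f -> lin_ext f 0 = 0.
Proof.
by move/lin_ext_add => fD; have := fD 0 0; rewrite addr0 -{1}[lin_ext f 0]addr0 => /addrI.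
Qed.

Lemma lin_ext_sg V W (f : V -> ser W) (e : bool) x : slin f ->
  lin_ext f (sg e x) = sg e (lin_ext f x).
Proof.
move=> fl; case: e => //=; apply: (addrI (lin_ext f x)).
by rewrite -(lin_ext_add fl) !subrr lin_ext0.
Qed.

Lemma lin_ext_zero V W (x : ser V) : lin_ext (fun=> 0 : ser W) x = 0.
Proof. by apply: serP => a b; rewrite /lin_ext big1 // => i _; rewrite big1. Qed.

Lemma lin_ext_cst V W (f : V -> ser W) v : f 0 = 0 -> lin_ext f (cst v) = f v.
Proof.
move=> f0; apply: serP => a b; rewrite /lin_ext !big_ord_recl /= /cst /= !subn0.
rewrite big1 ?addr0 => [|j _]; last by rewrite f0.
by rewrite big1 ?addr0 // => i _; rewrite big1 // => j _; rewrite f0.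
Qed.

(** The extension of maps to series is multiplicative, being the composition of
    maps that are linear over series. *)
Lemma lin_ext_comp V W U (f : V -> ser W) (g : W -> ser U) x : slin g ->
  lin_ext g (lin_ext f x) = lin_ext (fun v => lin_ext g (f v)) x.
Proof.
move=> gl; apply: serP => a b; rewrite /lin_ext.
transitivity (\sum_(i < a.+1) \sum_(i' < i.+1) \sum_(j < b.+1) \sum_(j' < j.+1)
   g (f (x i' j') (i - i')%N (j - j')%N) (a - i)%N (b - j)%N).
  apply: eq_bigr => i _; rewrite exchange_big /=; apply: eq_bigr => j _.
  rewrite (slin_sum _ _ _ gl) ser_sumE; apply: eq_bigr => i' _.
  by rewrite (slin_sum _ _ _ gl) ser_sumE.
rewrite (tri_assoc (fun i' m r => \sum_(j < b.+1) \sum_(j' < j.+1)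
   g (f (x i' j') m (j - j')%N) r (b - j)%N)).
apply: eq_bigr => i' _; rewrite [RHS]exchange_big; apply: eq_bigr => m _.
by rewrite (tri_assoc (fun j' l r => g (f (x i' j') m l) (a - i' - m)%N r)).
Qed.

Lemma lin_ext_exchange V W U (h : V -> W -> ser U) x y :
  lin_ext (fun v => lin_ext (h v) y) x
  = lin_ext (fun w => lin_ext (fun v => h v w) x) y.
Proof.
apply: serP => a b; rewrite /lin_ext.
transitivity (\sum_(i < a.+1) \sum_(i' < (a - i).+1) \sum_(j < b.+1)
   \sum_(j' < (b - j).+1) h (x i j) (y i' j') (a - i - i')%N (b - j - j')%N).
  by apply: eq_bigr => i _; rewrite exchange_big.
rewrite (tri_swap (fun i i' r => \sum_(j < b.+1) \sum_(j' < (b - j).+1)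
   h (x i j) (y i' j') r (b - j - j')%N)).
apply: eq_bigr => i' _; rewrite [RHS]exchange_big /=; apply: eq_bigr => i _.
by rewrite (tri_swap (fun j j' r => h (x i j) (y i' j') (a - i' - i)%N r)).
Qed.

Lemma lin_ext_scale V W (f : V -> ser W) c x :
  lin_ext (fun v => c *: f v) x = c *: lin_ext f x.
Proof.
apply: serP => a b; rewrite serZE /lin_ext scaler_sumr.
by apply: eq_bigr => i _; rewrite scaler_sumr.
Qed.

Lemma lin_ext_sgf V W (f : V -> ser W) (e : bool) x :
  lin_ext (fun v => sg e (f v)) x = sg e (lin_ext f x).
Proof.
by rewrite -sgE -lin_ext_scale; congr lin_ext; apply: funext => v; rewrite sgE.
Qed.

End Series.

(** * Degrees and powers of hbar *)

Section Homogeneous.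
Variable k : fieldType.
Implicit Types (V W : gradedType k).

Lemma homog0 V j : homog j (0 : V). Proof. exact: hpart0. Qed.
Lemma homogD V j (x y : V) : homog j x -> homog j y -> homog j (x + y).
Proof. by rewrite /homog hpartD => -> ->. Qed.
Lemma homogZ V j c (x : V) : homog j x -> homog j (c *: x).
Proof. by rewrite /homog hpartZ => ->. Qed.
Lemma homogN V j (x : V) : homog j x -> homog j (- x).
Proof. by rewrite -scaleN1r; exact: homogZ. Qed.
Lemma homog_sum V j (I : Type) (r : seq I) (P : pred I) (F : I -> V) :
  (forall i, P i -> homog j (F i)) -> homog j (\sum_(i <- r | P i) F i).
Proof. by move=> h; elim/big_ind: _ => //; [exact: homog0 | exact: homogD]. Qed.
Lemma homog_hpart V j (x : V) : homog j (hpart j x).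
Proof. by rewrite /homog hpart_hpart eqxx. Qed.
Lemma homog_neq V i j (x : V) : homog j x -> i != j -> hpart i x = 0.
Proof. by move=> <- ne; rewrite hpart_hpart (negbTE ne). Qed.

Definition shomog V j (x : ser V) : Prop := forall a b, homog j (x a b).

Definition shpart V j (x : ser V) : ser V := fun a b => hpart j (x a b).

Lemma shomogP V j (x : ser V) : shomog j x -> shpart j x = x.
Proof. by move=> h; apply: serP => a b; exact: h. Qed.
Lemma shomog0 V j : shomog j (0 : ser V).
Proof. by move=> a b; exact: homog0. Qed.
Lemma shomogD V j (x y : ser V) : shomog j x -> shomog j y -> shomog j (x + y).
Proof. by move=> hx hy a b; apply: homogD. Qed.
Lemma shomogN V j (x : ser V) : shomog j x -> shomog j (- x).
Proof. by move=> hx a b; apply: homogN. Qed.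
Lemma shomog_cst V j (v : V) : homog j v -> shomog j (cst v).
Proof. by move=> h a b; rewrite /cst; case: ifP => // _; exact: homog0. Qed.
Lemma shpart_cst V j (v : V) : shpart j (cst v) = cst (hpart j v).
Proof.
by apply: serP => a b; rewrite /shpart /cst; case: ifP => // _; exact: hpart0.
Qed.
Lemma shomog_lin_ext V W j (f : V -> ser W) (x : ser V) :
  (forall i l, shomog j (f (x i l))) -> shomog j (lin_ext f x).
Proof.
by move=> h a b; apply: homog_sum => i _; apply: homog_sum => l _; exact: h.
Qed.
Lemma shomog_mulNhbar V j m (x : ser V) : shomog j x -> shomog j (mulNhbar m x).
Proof.
move=> h a b; rewrite /mulNhbar; case: ifP => _; last exact: homog0.
exact: homogZ.
Qed.

Lemma eq_lin_ext V W (f g : V -> ser W) x :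
  (forall i j, f (x i j) = g (x i j)) -> lin_ext f x = lin_ext g x.
Proof.
move=> e; apply: serP => a b; rewrite /lin_ext.
by apply: eq_bigr => i _; apply: eq_bigr => j _; rewrite e.
Qed.

Lemma cst_linear V c (x y : V) : cst (c *: x + y) = c *: cst x + cst y.
Proof.
apply: serP => a b; rewrite serDE serZE /cst.
by case: ifP; rewrite ?scaler0 ?addr0.
Qed.

Lemma cst0 V : cst (0 : V) = 0.
Proof. by apply: serP => a b; rewrite /cst; case: ifP. Qed.

Lemma lin_ext_hbar_cst V W m (f : V -> ser W) v : slin f ->
  lin_ext f (mulNhbar m (cst v)) = mulNhbar m (f v).
Proof.
move=> fl; apply: serP => a b; rewrite /lin_ext /mulNhbar /cst.
have f0 c d : f 0 c d = 0 by rewrite (slin0 fl).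
case: (leqP m a) => ma; last first.
  rewrite big1 // => i _; rewrite big1 // => j _; case: leqP => //= mi.
  by move: (leq_trans ma mi); rewrite ltnNge -ltnS ltn_ord.
rewrite (bigD1 (Ordinal (leq_ltn_trans ma (ltnSn a)))) //= big_ord_recl /= leqnn subnn.
rewrite !subn0 (slinZ fl) serZE big1 ?addr0 => [|j _]; last by rewrite scaler0.
rewrite big1 ?addr0 // => i ne; rewrite big1 // => j _; case: leqP => // mi.
rewrite subn_eq0; case: leqP => [im|_] /=; last by rewrite scaler0.
by case/eqP: ne; apply: val_inj => /=; apply/eqP; rewrite eqn_leq im.
Qed.

Lemma lin_ext_cstK V (x : ser V) : lin_ext (@cst k V) x = x.
Proof.
apply: serP => a b; rewrite /lin_ext big_ord_recr big1 /= ?add0r => [|i _]; last first.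
  by rewrite big1 // => j _; rewrite /cst subn_eq0 leqNgt ltn_ord.
rewrite big_ord_recr big1 /= ?add0r => [|j _]; last first.
  by rewrite /cst [(b - _)%N == _]subn_eq0 [(b <= _)%N]leqNgt ltn_ord andbF.
by rewrite /cst !subnn.
Qed.

Lemma mulNhbar_lin_ext V W m (f : V -> ser W) x :
  mulNhbar m (lin_ext f x) = lin_ext (fun v => mulNhbar m (f v)) x.
Proof.
apply: serP => a b; rewrite /lin_ext /mulNhbar; case: (leqP m a) => ma; last first.
  rewrite big1 // => i _; rewrite big1 // => j _; case: leqP => // mi.
  by move: (leq_trans mi (leq_subr _ _)); rewrite leqNgt ma.
rewrite (big_ord_widen a.+1 (fun i => \sum_(j < b.+1) f (x i j) (a - m - i)%N (b - j)%N));
  last by rewrite ltnS leq_subr.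
rewrite big_mkcond scaler_sumr; apply: eq_bigr => i _ /=.
have -> : (i < (a - m).+1)%N = (m <= a - i)%N.
  by rewrite ltnS leq_subRL // leq_subRL -1?ltnS // addnC.
case: ifP => _; last by rewrite big1 ?scaler0.
by rewrite scaler_sumr; apply: eq_bigr => j _; rewrite subnAC.
Qed.

(** Multiplication by a power of [- hbar] as the extension of a map to series:
    its compatibility with other operations becomes a case of [lin_ext_comp]. *)
Lemma mulNhbarE V m (x : ser V) :
  mulNhbar m x = lin_ext (fun v => mulNhbar m (cst v)) x.
Proof. by rewrite -{1}[x]lin_ext_cstK mulNhbar_lin_ext. Qed.

Lemma mulNhbar_slin V m : slin (fun v : V => mulNhbar m (cst v)).
Proof.
move=> c x y; apply: serP => a b; rewrite cst_linear serDE serZE /mulNhbar.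
case: ifP => _; rewrite ?scaler0 ?addr0 // serDE serZE scalerDr !scalerA.
by rewrite mulrC.
Qed.

Lemma lin_ext_mulNhbar V W m (f : V -> ser W) x : slin f ->
  lin_ext f (mulNhbar m x) = mulNhbar m (lin_ext f x).
Proof.
move=> fl; rewrite mulNhbarE lin_ext_comp // mulNhbar_lin_ext; apply: eq_lin_ext => i j.
exact: lin_ext_hbar_cst.
Qed.

Lemma mulNhbarD V m (x y : ser V) : mulNhbar m (x + y) = mulNhbar m x + mulNhbar m y.
Proof. by rewrite !(mulNhbarE m) (lin_ext_add (@mulNhbar_slin _ _)). Qed.

Lemma mulNhbar_0 V m : mulNhbar m (0 : ser V) = 0.
Proof. by rewrite mulNhbarE (lin_ext0 (@mulNhbar_slin _ _)). Qed.

Lemma mulNhbar_sg V m (e : bool) (x : ser V) : mulNhbar m (sg e x) = sg e (mulNhbar m x).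
Proof. by rewrite !(mulNhbarE m) (lin_ext_sg _ _ (@mulNhbar_slin _ _)). Qed.

Lemma mulNhbar0n V (x : ser V) : mulNhbar 0 x = x.
Proof. by apply: serP => a b; rewrite /mulNhbar subn0 expr0 scale1r. Qed.

Lemma mulNhbar_add V m n (x : ser V) : mulNhbar m (mulNhbar n x) = mulNhbar (m + n) x.
Proof.
apply: serP => a b; rewrite /mulNhbar; case: (leqP m a) => ma; last first.
  by rewrite leqNgt (leq_trans ma (leq_addr _ _)).
rewrite leq_subRL // subnDA; case: ifP => _; last by rewrite scaler0.
by rewrite scalerA exprD.
Qed.

(** Dividing by powers of [hbar] is what makes the quantum descendants
    unique. *)
Lemma mulNhbar_coef V m (x : ser V) a b : x a b = (-1) ^+ m *: mulNhbar m x (a + m)%N b.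
Proof.
by rewrite /mulNhbar leq_addl addnK scalerA -exprD addnn -signr_odd odd_double expr0 scale1r.
Qed.

End Homogeneous.

(** * The product of series *)

Arguments ser_prod : simpl never.

Section Product.
Variables (k : fieldType) (C : gcAlgType k).
Implicit Types x y z : ser C.

Definition smul x y : ser C := lin_ext (fun v a b => v * y a b) x.

Lemma ser_prod_nil : ser_prod [::] = cst (1 : C).
Proof. by []. Qed.

Lemma ser_prod_cons x s : ser_prod (x :: s) = smul x (ser_prod s).
Proof. by []. Qed.

Lemma lmul_slin y : slin (fun v => (fun a b => v * y a b) : ser C).
Proof.
move=> c u v; apply: serP => a b.
by rewrite serDE serZE mulrDl scalerAl.
Qed.

Lemma smulDl x x' y : smul (x + x') y = smul x y + smul x' y.
Proof. exact: (lin_ext_add (@lmul_slin y)). Qed.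

Lemma smulDr x y y' : smul x (y + y') = smul x y + smul x y'.
Proof.
rewrite /smul -lin_extD; apply: eq_lin_ext => i j; apply: serP => a b.
by rewrite !serDE mulrDr.
Qed.

Lemma smul0l y : smul 0 y = 0.
Proof. exact: (lin_ext0 (@lmul_slin y)). Qed.

Lemma smul0r x : smul x 0 = 0.
Proof. by have := smulDr x 0 0; rewrite addr0 -{1}[smul x 0]addr0 => /addrI. Qed.

Lemma smulsgr (e : bool) x y : smul x (sg e y) = sg e (smul x y).
Proof.
case: e => //=; apply: (addrI (smul x y)).
by rewrite -smulDr !subrr smul0r.
Qed.

Lemma smul_lin_extl (V : gradedType k) (f : V -> ser C) (x : ser V) y :
  smul (lin_ext f x) y = lin_ext (fun v => smul (f v) y) x.
Proof. by rewrite /smul (lin_ext_comp _ _ (@lmul_slin y)). Qed.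

Lemma smul_lin_extr (V : gradedType k) (f : V -> ser C) (x : ser V) y :
  smul y (lin_ext f x) = lin_ext (fun v => smul y (f v)) x.
Proof.
rewrite /smul lin_ext_exchange; apply: eq_lin_ext => i j; apply: serP => a b.
rewrite /lin_ext mulr_sumr; apply: eq_bigr => l _.
by rewrite mulr_sumr.
Qed.

Lemma smulA x y z : smul x (smul y z) = smul (smul x y) z.
Proof.
rewrite [in RHS]/smul (lin_ext_comp _ _ (@lmul_slin z)) [LHS]/smul.
apply: eq_lin_ext => i j; apply: serP => a b; rewrite /smul /lin_ext mulr_sumr.
apply: eq_bigr => l _; rewrite mulr_sumr; apply: eq_bigr => m _.
by rewrite mulrA.
Qed.

Lemma smul1l x : smul (cst 1) x = x.
Proof.
rewrite /smul lin_ext_cst; last by rewrite (slin0 (@lmul_slin x)).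
by apply: serP => a b; rewrite mul1r.
Qed.

Lemma smul1r x : smul x (cst 1) = x.
Proof.
rewrite -[RHS]lin_ext_cstK; apply: eq_lin_ext => i j; apply: serP => a b.
by rewrite /cst; case: ifP; rewrite ?mulr1 ?mulr0.
Qed.

Lemma smul_cst u v : smul (cst u) (cst v) = cst (u * v).
Proof.
rewrite /smul lin_ext_cst; last by rewrite (slin0 (@lmul_slin _)).
by apply: serP => a b; rewrite /cst; case: ifP; rewrite ?mulr0.
Qed.

Lemma mulNhbar_smull m x y : smul (mulNhbar m x) y = mulNhbar m (smul x y).
Proof. exact: (lin_ext_mulNhbar _ _ (@lmul_slin y)). Qed.

Lemma mulNhbar_smulr m x y : smul x (mulNhbar m y) = mulNhbar m (smul x y).
Proof.
rewrite /smul mulNhbar_lin_ext; apply: eq_lin_ext => i j; apply: serP => a b.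
by rewrite /mulNhbar; case: ifP => _; rewrite ?mulr0 // scalerAr.
Qed.

Lemma smulC i j x y : shomog i x -> shomog j y ->
  smul x y = sg (parity i && parity j) (smul y x).
Proof.
move=> hx hy; apply: serP => a b; rewrite ser_sgE /smul /lin_ext.
rewrite (reindex_inj rev_ord_inj) /= sg_sum; apply: eq_bigr => l _.
rewrite (reindex_inj rev_ord_inj) /= sg_sum; apply: eq_bigr => m _.
rewrite !subSS !subKn -1?ltnS // (gcommutative _ _ _ _ (hx _ _) (hy _ _)).
by case: (_ && _); rewrite /= ?expr1 ?expr0 ?mulN1r ?mul1r.
Qed.

Lemma shomog_smul i j x y : shomog i x -> shomog j y -> shomog (i + j) (smul x y).
Proof. by move=> hx hy; apply: shomog_lin_ext => l m a b; apply: homogM. Qed.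

Lemma ser_prod_cat s t : ser_prod (s ++ t) = smul (ser_prod s) (ser_prod t).
Proof. by elim: s => [|x s IH]; rewrite ?ser_prod_nil ?smul1l //= !ser_prod_cons IH smulA. Qed.

Lemma ser_prod1 x : ser_prod [:: x] = x.
Proof. by rewrite ser_prod_cons ser_prod_nil smul1r. Qed.

Lemma ser_prod_rcons s x : ser_prod (rcons s x) = smul (ser_prod s) x.
Proof. by rewrite -cats1 ser_prod_cat ser_prod1. Qed.

Lemma ser_prod_cst (s : seq C) : ser_prod (map (@cst k C) s) = cst (\prod_(x <- s) x).
Proof.
elim: s => [|x s IH]; first by rewrite big_nil.
by rewrite /= ser_prod_cons IH smul_cst big_cons.
Qed.

Lemma ser_prod_mulNhbar (T : Type) (w : T -> nat) (F : T -> ser C) s :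
  ser_prod [seq mulNhbar (w t) (F t) | t <- s]
  = mulNhbar (sumn (map w s)) (ser_prod (map F s)).
Proof.
elim: s => [|t s IH]; first by rewrite /= mulNhbar0n.
by rewrite /= !ser_prod_cons IH mulNhbar_smull mulNhbar_smulr mulNhbar_add.
Qed.

End Product.

Arguments mul_ext : simpl never.

(** * Multilinear families of maps *)

Section Multilinear.
Variable k : fieldType.
Implicit Types (V W : gradedType k).

Definition mlin (T : lmodType k) (S : lmodType k) (g : seq T -> S) : Prop :=
  forall s1 s2 c x y,
    g (s1 ++ (c *: x + y) :: s2) = c *: g (s1 ++ x :: s2) + g (s1 ++ y :: s2).

Definition gsym V W (g : seq V -> ser W) : Prop :=
  forall s1 s2 x y p q, homog p x -> homog q y ->
    g (s1 ++ [:: x, y & s2]) = sg (parity p && parity q) (g (s1 ++ [:: y, x & s2])).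

Section Mlin.
Variables (T S : lmodType k) (g : seq T -> S).
Hypothesis gl : mlin g.

Lemma mlinD s1 s2 x y : g (s1 ++ (x + y) :: s2) = g (s1 ++ x :: s2) + g (s1 ++ y :: s2).
Proof. by rewrite -[x in LHS]scale1r gl scale1r. Qed.
Lemma mlin0 s1 s2 : g (s1 ++ 0 :: s2) = 0.
Proof. by have := mlinD s1 s2 0 0; rewrite addr0 -{1}[g _]addr0 => /addrI. Qed.
Lemma mlinsg (e : bool) s1 s2 x : g (s1 ++ sg e x :: s2) = sg e (g (s1 ++ x :: s2)).
Proof.
case: e => //=; apply: (addrI (g (s1 ++ x :: s2))).
by rewrite -mlinD !subrr mlin0.
Qed.
Lemma mlin_sum (I : Type) (r : seq I) (F : I -> T) s1 s2 :
  g (s1 ++ (\sum_(i <- r) F i) :: s2) = \sum_(i <- r) g (s1 ++ F i :: s2).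
Proof.
elim: r => [|i r IH]; first by rewrite !big_nil mlin0.
by rewrite !big_cons mlinD IH.
Qed.
End Mlin.

Lemma mlin_cons (T S : lmodType k) (g : seq T -> S) v : mlin g -> mlin (fun t => g (v :: t)).
Proof. by move=> gl s1 s2 c x y; rewrite -!cat_cons gl. Qed.

Lemma mlin_slin V W (g : seq V -> ser W) s : mlin g -> slin (fun v => g (v :: s)).
Proof. by move=> gl c x y; exact: (gl [::]). Qed.

Lemma mul_ext_cons V W (g : seq V -> ser W) x s :
  mul_ext g (x :: s) = lin_ext (fun v => mul_ext (fun t => g (v :: t)) s) x.
Proof. by []. Qed.

Lemma mul_ext_slinl V W (F : V -> seq V -> ser W) s :
  (forall t, slin (F ^~ t)) -> slin (fun v => mul_ext (F v) s).
Proof.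
elim: s F => [|x s IH] F Fl; first exact: Fl.
move=> c u v; rewrite !mul_ext_cons -lin_ext_scale -lin_extD.
apply: eq_lin_ext => i j.
by rewrite (IH (fun u t => F u (x i j :: t))).
Qed.

Lemma mul_ext_mlin V W (g : seq V -> ser W) : mlin g -> mlin (mul_ext g).
Proof.
move=> gl s1; elim: s1 g gl => [|z s1 IH] g gl s2 c x y.
  by rewrite /= !mul_ext_cons lin_ext_slin //; apply: mul_ext_slinl => t; exact: mlin_slin.
rewrite !cat_cons !mul_ext_cons -lin_ext_scale -lin_extD.
by apply: eq_lin_ext => i j; rewrite IH //; exact: mlin_cons.
Qed.

Lemma mul_ext_consts V W (g : seq V -> ser W) v s : mlin g ->
  mul_ext g (cst v :: s) = mul_ext (fun t => g (v :: t)) s.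
Proof.
move=> gl; rewrite mul_ext_cons lin_ext_cst //.
apply: (slin0 (f := fun u => mul_ext (fun t => g (u :: t)) s)).
by apply: mul_ext_slinl => t; exact: mlin_slin.
Qed.

(** [mul_ext] treats its arguments from left to right, but as the coefficients
    of [hbar] and [tau] are central any argument may be expanded first. *)
Lemma mul_ext_subst V W (g : seq V -> ser W) s1 y s2 : mlin g ->
  mul_ext g (s1 ++ y :: s2) = lin_ext (fun u => mul_ext g (s1 ++ cst u :: s2)) y.
Proof.
elim: s1 g => [|z s1 IH] g gl.
  by rewrite /= mul_ext_cons; apply: eq_lin_ext => i j; rewrite mul_ext_consts.
rewrite cat_cons mul_ext_cons.
rewrite -[RHS]/(lin_ext (fun u => lin_ext (fun v =>
  mul_ext (fun t => g (v :: t)) (s1 ++ cst u :: s2)) z) y) lin_ext_exchange.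
by apply: eq_lin_ext => i j; rewrite IH //; exact: mlin_cons.
Qed.

Lemma mul_ext_slin V W (g : seq V -> ser W) s1 s2 : mlin g ->
  slin (fun u => mul_ext g (s1 ++ cst u :: s2)).
Proof. by move=> gl c x y; rewrite cst_linear (mul_ext_mlin gl). Qed.

Lemma mul_ext_lin_ext V W (U : gradedType k) (g : seq V -> ser W) (f : U -> ser V) s1 x s2 : mlin g ->
  mul_ext g (s1 ++ lin_ext f x :: s2) = lin_ext (fun u => mul_ext g (s1 ++ f u :: s2)) x.
Proof.
move=> gl; rewrite mul_ext_subst // lin_ext_comp; last exact: mul_ext_slin.
by apply: eq_lin_ext => i j; rewrite -mul_ext_subst.
Qed.

Lemma mul_ext_mulNhbar V W (g : seq V -> ser W) m s1 x s2 : mlin g ->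
  mul_ext g (s1 ++ mulNhbar m x :: s2) = mulNhbar m (mul_ext g (s1 ++ x :: s2)).
Proof.
move=> gl; rewrite mul_ext_subst // lin_ext_mulNhbar; last exact: mul_ext_slin.
by rewrite -mul_ext_subst.
Qed.

Lemma mul_ext_mulNhbars V W (g : seq V -> ser W) (T : Type) (w : T -> nat)
    (F : T -> ser V) s : mlin g ->
  mul_ext g [seq mulNhbar (w t) (F t) | t <- s]
  = mulNhbar (sumn (map w s)) (mul_ext g (map F s)).
Proof.
move=> gl.
have H s0 : mul_ext g (s0 ++ [seq mulNhbar (w t) (F t) | t <- s])
  = mulNhbar (sumn (map w s)) (mul_ext g (s0 ++ map F s)).
  elim: s s0 => [|t s IH] s0; first by rewrite mulNhbar0n.
  by rewrite /= mul_ext_mulNhbar // -cat_rcons IH cat_rcons mulNhbar_add.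
exact: (H [::]).
Qed.

Lemma mul_ext_csts V W (g : seq V -> ser W) s : mlin g ->
  mul_ext g (map (@cst k V) s) = g s.
Proof.
elim: s g => [|v s IH] g gl //=.
by rewrite mul_ext_consts // IH //; exact: mlin_cons.
Qed.

Lemma mul_ext_sg V W (g : seq V -> ser W) (e : bool) s :
  mul_ext (fun t => sg e (g t)) s = sg e (mul_ext g s).
Proof.
elim: s g => [|x s IH] g //; rewrite !mul_ext_cons -lin_ext_sgf.
by apply: eq_lin_ext => i j; rewrite IH.
Qed.

(** Both arguments are expanded, in either order, by [lin_ext_exchange]. *)
Lemma mul_ext_swap V W (g : seq V -> ser W) s1 x y s2 p q : mlin g -> gsym g ->
  shomog p x -> shomog q y ->
  mul_ext g (s1 ++ [:: x, y & s2])
  = sg (parity p && parity q) (mul_ext g (s1 ++ [:: y, x & s2])).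
Proof.
elim: s1 g => [|z s1 IH] g gl gs hx hy; last first.
  rewrite !cat_cons !mul_ext_cons -lin_ext_sgf; apply: eq_lin_ext => i j.
  apply: IH => // [|t1 t2 u v p' q' hu hv]; first exact: mlin_cons.
  by rewrite -!cat_cons (gs _ _ _ _ _ _ hu hv).
rewrite /= !mul_ext_cons.
transitivity (lin_ext (fun u => lin_ext (fun v => sg (parity p && parity q)
   (mul_ext (fun t => g [:: v, u & t]) s2)) y) x).
  apply: eq_lin_ext => i j; rewrite mul_ext_cons; apply: eq_lin_ext => i' j'.
  rewrite -mul_ext_sg; congr mul_ext; apply: funext => t.
  exact: (gs [::]).
rewrite lin_ext_exchange -lin_ext_sgf; apply: eq_lin_ext => i j.
by rewrite lin_ext_sgf mul_ext_cons.
Qed.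

Lemma mul_ext_eq V W (g g' : seq V -> ser W) s :
  (forall t, size t = size s -> g t = g' t) -> mul_ext g s = mul_ext g' s.
Proof.
elim: s g g' => [|x s IH] g g' e; first exact: e.
rewrite !mul_ext_cons; apply: eq_lin_ext => i j; apply: IH => t st.
by apply: e; rewrite /= st.
Qed.

Lemma mul_ext_deg V W j (g : seq V -> ser W) (l : seq (int * ser V)) :
  (forall m : seq (int * V), map fst m = map fst l -> (forall t, t \in m -> homog t.1 t.2) ->
     shomog (\sum_(t <- m) t.1 + j) (g (map snd m))) ->
  (forall t, t \in l -> shomog t.1 t.2) ->
  shomog (\sum_(t <- l) t.1 + j) (mul_ext g (map snd l)).
Proof.
elim: l g j => [|[d x] l IH] g j gd hl; first by have := gd [::]; rewrite !big_nil; apply.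
rewrite /= mul_ext_cons big_cons /=; apply: shomog_lin_ext => a b.
rewrite -addrA addrCA; apply: IH => [m em hm|t tl]; last by apply: hl; rewrite inE tl orbT.
have := gd ((d, x a b) :: m); rewrite /= em big_cons /= -addrA addrCA.
apply=> // t; rewrite inE => /predU1P[->|] /=; last exact: hm.
exact: (hl (d, x) (mem_head _ _)).
Qed.

End Multilinear.

(** * The derivative with respect to time *)

Section Derivative.
Variable k : fieldType.
Implicit Types (V W : gradedType k).

Lemma dtauD V (x y : ser V) : dtau (x + y) = dtau x + dtau y.
Proof. by apply: serP => a b; rewrite /dtau !serDE mulrnDl. Qed.

Lemma dtau_mulNhbar V m (x : ser V) : dtau (mulNhbar m x) = mulNhbar m (dtau x).
Proof.
apply: serP => a b; rewrite /dtau /mulNhbar; case: ifP => _; last by rewrite mul0rn.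
by rewrite -scalerMnr.
Qed.

Lemma dtau_lin_ext V W (f : V -> ser W) x : slin f -> (forall v, tau_free (f v)) ->
  dtau (lin_ext f x) = lin_ext f (dtau x).
Proof.
move=> fl ft; apply: serP => a b; rewrite /dtau /lin_ext -sumrMnl; apply: eq_bigr => i _.
have e B (y : ser V) : \sum_(j < B.+1) f (y i j) (a - i)%N (B - j)%N = f (y i B) (a - i)%N 0%N.
  rewrite big_ord_recr /= subnn big1 ?add0r // => j _.
  by rewrite -[(B - j)%N]prednK ?ft // subn_gt0.
rewrite e (e b (fun a b => x a b.+1 *+ b.+1)).
by rewrite -!scaler_nat (slinZ fl) serZE.
Qed.

Lemma dtau_smul (C : gcAlgType k) (x y : ser C) :
  dtau (smul x y) = smul (dtau x) y + smul x (dtau y).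
Proof.
apply: serP => a b; rewrite serDE /dtau /smul /lin_ext -sumrMnl -big_split.
apply: eq_bigr => i _ /=.
have e (F G : nat -> C) : (\sum_(j < b.+2) F j * G (b.+1 - j)%N) *+ b.+1
   = \sum_(j < b.+1) (F j.+1 *+ j.+1) * G (b - j)%N
     + \sum_(j < b.+1) F j * (G (b - j).+1 *+ (b - j).+1).
  transitivity (\sum_(j < b.+2) (F j *+ j) * G (b.+1 - j)%N
    + \sum_(j < b.+2) F j * (G (b.+1 - j)%N *+ (b.+1 - j)%N)).
    rewrite -big_split -sumrMnl; apply: eq_bigr => j _ /=.
    rewrite mulrnAl mulrnAr -mulrnDr subnKC // -ltnS; exact: ltn_ord.
  congr (_ + _).
    by rewrite big_ord_recl /= mulr0n mul0r add0r; apply: eq_bigr => j _; rewrite /= subSS.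
  rewrite big_ord_recr /= subnn mulr0n mulr0 addr0; apply: eq_bigr => j _ /=.
  by rewrite subSn // -ltnS ltn_ord.
exact: (e (x i) (fun m => y (a - i)%N m)).
Qed.

End Derivative.

(** * Convolution, exponential and composition of families *)

Section Weights.
Variables (T : Type) (p : T -> bool) (D : nmodType) (w : T -> D).
Definition wt (s : seq T) : D := \sum_(t <- s) w t.

Lemma wt_cons x s : wt (x :: s) = w x + wt s. Proof. exact: big_cons. Qed.
Lemma wt_cat s t : wt (s ++ t) = wt s + wt t. Proof. exact: big_cat. Qed.
Lemma wt_rcons s x : wt (rcons s x) = wt s + w x.
Proof. by rewrite -cats1 wt_cat /wt big_seq1. Qed.

Variables (R : zmodType) (P : R -> Prop).
Hypotheses (PD : forall r r', P r -> P r' -> P (r + r'))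
  (PN : forall r, P r -> P (- r)).

(** Degrees are additive over the letters, so every term of the sum has the
    degree of the whole word. *)
Lemma ssum_closed_wt (H : seq T -> seq T -> R) s :
  (forall a b, (size a + size b)%N = size s -> wt a + wt b = wt s -> P (H a b)) ->
  P (ssum p H s).
Proof.
elim: s H => [|x s IH] H PH /=; first by apply: PH => //; rewrite /wt !big_nil addr0.
apply: PD; apply: IH => a b sz e.
  by apply: PH; rewrite /= ?addSn ?sz // !wt_cons -addrA e.
suff: P (H a (x :: b)) by case: (_ && _) => //=; apply: PN.
by apply: PH; rewrite /= ?addnS ?sz // !wt_cons -e addrCA.
Qed.

Lemma psum_closed_wt (G : seq (seq T) -> R) s :
  (forall bl, all (fun b => 0 < size b)%N bl -> wt (flatten bl) = wt s -> P (G bl)) ->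
  P (psum p G s).
Proof.
elim/size_ind: s G => [|s x IH] G PG; first exact: PG.
rewrite psum_rcons; apply: ssum_closed_wt => a b sz e; apply: IH.
  by rewrite -sz leq_addr.
move=> bl nbl ebl; apply: PG; first by rewrite all_rcons size_rcons.
by rewrite flatten_rcons wt_cat ebl !wt_rcons -e addrA.
Qed.
End Weights.

Section Families.
Variables (k : fieldType) (C : gcAlgType k) (T : Type) (p : T -> bool).
Implicit Types (F G phi lam : seq T -> ser C) (s a b c : seq T).

Definition conv F G s : ser C := ssum p (fun a b => smul (F a) (G b)) s.

(** The exponential for the convolution product: it turns the insertion of a
    family in one block into multiplication by that family
    ([fam_exp_insert]). *)
Definition fam_exp phi s : ser C := psum p (fun bl => ser_prod (map phi bl)) s.

Lemma fam_exp_nil phi : fam_exp phi [::] = cst 1. Proof. by []. Qed.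

Lemma fam_exp_rcons phi s x :
  fam_exp phi (rcons s x) = ssum p (fun a b => smul (fam_exp phi a) (phi (rcons b x))) s.
Proof.
rewrite /fam_exp psum_rcons; apply: eq_ssum => a b _ _.
rewrite -(psum_additive _ _ _ (f := fun r => smul r (phi (rcons b x)))); last first.
  by move=> r r'; exact: smulDl.
by apply: eq_psum => bl _ _ _; rewrite map_rcons ser_prod_rcons.
Qed.

Lemma eq_fam_exp phi phi' s :
  (forall b, (0 < size b)%N -> phi b = phi' b) -> fam_exp phi s = fam_exp phi' s.
Proof.
move=> e; apply: eq_psum => bl nbl _ _; congr ser_prod.
by elim: bl nbl => //= b bl IH /andP[/e-> /IH->].
Qed.

Lemma eq_conv F F' G G' s :
  (forall a, (size a <= size s)%N -> F a = F' a) ->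
  (forall a, (size a <= size s)%N -> G a = G' a) ->
  conv F G s = conv F' G' s.
Proof.
move=> eF eG; apply: eq_ssum => a b sz _.
by rewrite eF ?eG // -sz ?leq_addr ?leq_addl.
Qed.

(** [E'] is the exponential of [phi] with [lam], of parity [e], inserted in one
    block.  Moving that block to the front makes it a convolution factor: both
    sides satisfy the same recursion on the largest letter, which lies in the
    block of [lam] or not. *)
Lemma fam_exp_insert phi lam E' (e : bool) s :
  (forall a b, smul (lam a) (fam_exp phi b)
     = sg ((pars p a (+) e) && pars p b) (smul (fam_exp phi b) (lam a))) ->
  lam [::] = 0 -> E' [::] = 0 ->
  (forall s x, E' (rcons s x) = ssum p (fun a b =>
     smul (E' a) (phi (rcons b x))
     + sg (e && pars p a) (smul (fam_exp phi a) (lam (rcons b x)))) s) ->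
  E' s = conv lam (fam_exp phi) s.
Proof.
move=> comm lam0 E0 ES; elim/size_ind: s => [|s x IH].
  by rewrite E0 /conv /= lam0 smul0l.
rewrite ES ssumD /conv ssum_rcons; congr (_ + _).
  transitivity (ssum p (fun a1 c => ssum p (fun a2 b =>
      smul (lam a1) (smul (fam_exp phi a2) (phi (rcons b x)))) c) s).
    rewrite -ssumA; apply: eq_ssum => a b sz _.
    rewrite IH -?sz ?leq_addr // /conv.
    rewrite -(ssum_additive _ _ _ (f := fun r => smul r (phi (rcons b x)))).
      by apply: eq_ssum => a1 a2 _ _; rewrite smulA.
    by move=> r r'; exact: smulDl.
  apply: eq_ssum => a c _ _; rewrite fam_exp_rcons.
  rewrite -(ssum_additive _ _ _ (f := fun r => smul (lam a) r)) //.
  by move=> r r'; exact: smulDr.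
rewrite [RHS]ssumC; apply: eq_ssum => a b _ _.
rewrite comm pars_rcons !sgsg; congr sg.
by case: (p x) (pars p a) (pars p b) (e) => [] [] [] [].
Qed.

(** The case where the inserted block is the one containing a first letter
    [t]. *)
Lemma fam_exp_cons phi t s :
  (forall a b, smul (phi (t :: a)) (fam_exp phi b)
     = sg ((pars p a (+) p t) && pars p b) (smul (fam_exp phi b) (phi (t :: a)))) ->
  phi [:: t] = 0 ->
  fam_exp phi (t :: s) = conv (fun a => phi (t :: a)) (fam_exp phi) s.
Proof.
move=> comm phi0; apply: (fam_exp_insert (E' := fun s => fam_exp phi (t :: s)) (e := p t)) => //.
  by rewrite -[[:: t]]/(rcons [::] t) fam_exp_rcons /= phi0 smul0r.
by move=> s' x; rewrite -rcons_cons fam_exp_rcons /= -ssumD.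
Qed.

(** The case where the inserted block is the one that is differentiated by the
    Leibniz rule. *)
Lemma fam_exp_dtau phi s :
  (forall a b, (0 < size a)%N -> smul (dtau (phi a)) (fam_exp phi b)
     = sg (pars p a && pars p b) (smul (fam_exp phi b) (dtau (phi a)))) ->
  dtau (fam_exp phi s)
  = conv (fun a => if a is [::] then 0 else dtau (phi a)) (fam_exp phi) s.
Proof.
move=> comm; apply: (fam_exp_insert (E' := fun s => dtau (fam_exp phi s)) (e := false)) => //.
- by case=> [|x a] b; [rewrite smul0l smul0r sg0 | rewrite addbF comm].
- by apply: serP => a b; rewrite /dtau fam_exp_nil /cst andbF mul0rn.
move=> s' x; rewrite fam_exp_rcons -(ssum_additive _ _ _ (@dtauD _ _)).
apply: eq_ssum => a b _ _; rewrite dtau_smul; congr (_ + _).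
by case: b.
Qed.

End Families.

(** Words are composed with a map [h] that turns each block into a single
    letter. *)
Section Composition.
Variables (k : fieldType) (C : gcAlgType k).
Variables (T X : Type) (p : T -> bool) (q : X -> bool) (h : seq T -> X).
Hypothesis qh : forall b, (0 < size b)%N -> q (h b) = pars p b.
Implicit Types (F G psi : seq X -> ser C) (s a b c : seq T).

Definition comp (R : zmodType) (F : seq X -> R) s : R := psum p (fun bl => F (map h bl)) s.

Lemma pars_map_blocks bl : all (fun b => 0 < size b)%N bl ->
  pars q (map h bl) = pars p (flatten bl).
Proof.
by elim: bl => //= b bl IH /andP[nb nbl]; rewrite pars_cat IH // qh.
Qed.

Lemma comp_rcons (R : zmodType) (F : seq X -> R) s x :
  comp F (rcons s x)
  = ssum p (fun a b => comp (fun l => F (rcons l (h (rcons b x)))) a) s.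
Proof.
rewrite /comp psum_rcons; apply: eq_ssum => a b _ _.
by apply: eq_psum => bl _ _ _; rewrite map_rcons.
Qed.

Lemma compD (R : zmodType) (F G : seq X -> R) s :
  comp (fun l => F l + G l) s = comp F s + comp G s.
Proof. exact: psumD. Qed.

Lemma eq_comp (R : zmodType) (F G : seq X -> R) s : F =1 G -> comp F s = comp G s.
Proof. by move=> e; apply: eq_psum => bl _ _ _; exact: e. Qed.

Lemma comp_pars (R : zmodType) (F : seq X -> R) (e : bool) s :
  comp (fun l => sg (e && pars q l) (F l)) s = sg (e && pars p s) (comp F s).
Proof.
rewrite -psum_sg; apply: eq_psum => bl nbl _ <-.
by rewrite pars_map_blocks.
Qed.

(** Composition is a morphism for the convolution: distributing the blocks of
    a partition of [s] over two factors amounts to distributing the letters and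
    then partitioning each part. *)
Lemma comp_conv F G s : comp (conv q F G) s = conv p (comp F) (comp G) s.
Proof.
elim/size_ind: s F G => [|s x IH] F G //.
rewrite comp_rcons /conv ssum_rcons.
rewrite (eq_ssum (H' := fun a b =>
   ssum p (fun a1 a2 => smul (comp F a1)
      (comp (fun l => G (rcons l (h (rcons b x)))) a2)) a
   + ssum p (fun a1 a2 => sg ((pars p b (+) p x) && pars p a2)
      (smul (comp (fun l => F (rcons l (h (rcons b x)))) a1) (comp G a2))) a)); last first.
  move=> a b sz _.
  transitivity (comp (fun l => conv q F (fun l2 => G (rcons l2 (h (rcons b x)))) l
      + conv q (fun l1 => F (rcons l1 (h (rcons b x))))
               (fun l2 => sg ((pars p b (+) p x) && pars q l2) (G l2)) l) a).
    apply: eq_comp => l; rewrite ssum_rcons; congr (_ + _).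
    by apply: eq_ssum => l1 l2 _ _; rewrite smulsgr qh ?size_rcons // pars_rcons.
  rewrite compD !IH -?sz ?leq_addr //; congr (_ + _).
  by apply: eq_ssum => a1 a2 _ _; rewrite comp_pars smulsgr.
rewrite ssumD; congr (_ + _).
  rewrite ssumA; apply: eq_ssum => a c _ _; rewrite comp_rcons.
  rewrite -(ssum_additive _ _ _ (f := fun r => smul (comp F a) r)) //.
  by move=> r r'; exact: smulDr.
rewrite [RHS](eq_ssum (s := s) (H' := fun a b => ssum p (fun a1 a2 => sg (p x && pars p b)
   (smul (comp (fun l => F (rcons l (h (rcons a2 x)))) a1) (comp G b))) a)); last first.
  move=> a b _ _; rewrite comp_rcons ssum_sg; congr sg.
  rewrite -(ssum_additive _ _ _ (f := fun r => smul r (comp G b))) //.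
  by move=> r r'; exact: smulDl.
rewrite !ssumA; apply: eq_ssum => a1 c _ _; rewrite [RHS]ssumC.
apply: eq_ssum => a2 b _ _; rewrite sgsg; congr sg.
by case: (p x) (pars p a2) (pars p b) => [] [] [].
Qed.

(** A partition of the set of blocks of a partition is a coarser partition with
    a partition of each of its blocks. *)
Lemma comp_exp psi s : comp (fam_exp q psi) s = fam_exp p (comp psi) s.
Proof.
elim/size_ind: s => [|s x IH] //.
rewrite comp_rcons fam_exp_rcons.
rewrite (eq_ssum (H' := fun a b => ssum p (fun a1 a2 => smul (fam_exp p (comp psi) a1)
   (comp (fun l => psi (rcons l (h (rcons b x)))) a2)) a)); last first.
  move=> a b sz _.
  transitivity (comp (conv q (fam_exp q psi) (fun l2 => psi (rcons l2 (h (rcons b x))))) a).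
    by apply: eq_comp => l; rewrite fam_exp_rcons.
  rewrite comp_conv; apply: eq_conv => // c lec; apply: IH.
  by apply: (leq_trans lec); rewrite -sz leq_addr.
rewrite ssumA; apply: eq_ssum => a c _ _; rewrite comp_rcons.
rewrite -(ssum_additive _ _ _ (f := fun r => smul (fam_exp p (comp psi) a) r)) //.
by move=> r r'; exact: smulDr.
Qed.

End Composition.

(** * Insertion of a marked block *)

Section ProductMultilinear.
Variables (k : fieldType) (C : gcAlgType k).
Implicit Types (x y : ser C).

Lemma smulZl c x y : smul (c *: x) y = c *: smul x y.
Proof.
have := lin_ext_slin c x 0 (@lmul_slin _ _ y).
by rewrite (lin_ext0 (@lmul_slin _ _ y)) !addr0.
Qed.

Lemma smulZr c x y : smul x (c *: y) = c *: smul x y.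
Proof.
rewrite /smul -lin_ext_scale; apply: eq_lin_ext => i j; apply: serP => a b.
by rewrite !serZE -scalerAr.
Qed.

Lemma ser_prod_mlin : mlin (@ser_prod k C).
Proof.
move=> s1 s2 c x y; elim: s1 => [|z s1 IH].
  by rewrite /= !ser_prod_cons smulDl smulZl.
by rewrite !cat_cons !ser_prod_cons IH smulDr smulZr.
Qed.

Lemma ser_prod_zero s : 0 \in s -> ser_prod s = 0 :> ser C.
Proof.
elim: s => // x s IH; rewrite inE ser_prod_cons => /predU1P[<-|/IH->].
  by rewrite smul0l.
by rewrite smul0r.
Qed.

End ProductMultilinear.

Section Letters.
Variables (k : fieldType) (T : Type) (deg : T -> int).
Implicit Types (V W U : gradedType k).
Definition par (t : T) : bool := parity (deg t).

(** The marker [None] stands for an operation of odd degree waiting to be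
    inserted in a block. *)
Definition parO (t : option T) : bool := oapp par true t.

(** A family on words with at most one marker, which must come first: a block
    containing the marker is evaluated by [G], the others by [F].  The value is
    zero on ill-formed words and on the block made of the marker alone. *)
Definition marked (R : zmodType) (F G : seq T -> R) (l : seq (option T)) : R :=
  if l is None :: l' then
    if all isSome l' && (0 < size l')%N then G (pmap id l') else 0
  else if all isSome l then F (pmap id l) else 0.

Arguments marked : simpl never.

Lemma all_isSome_map (b : seq T) : all isSome (map Some b).
Proof. by elim: b. Qed.

Lemma pmap_id_Some (b : seq T) : pmap id (map Some b) = b.
Proof. by elim: b => //= x b ->. Qed.

Lemma marked_Some (R : zmodType) (F G : seq T -> R) b : marked F G (map Some b) = F b.
Proof.
rewrite /marked; case: b => [|x b] //=.
by rewrite all_isSome_map pmap_id_Some.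
Qed.

Lemma marked_None (R : zmodType) (F G : seq T -> R) b : (0 < size b)%N ->
  marked F G (None :: map Some b) = G b.
Proof. by move=> nb; rewrite /marked all_isSome_map size_map nb pmap_id_Some. Qed.

Variables V : gradedType k.
Variable ev : T -> V.

Lemma mlin_J (S : lmodType k) (f : seq V -> S) b : mlin f ->
  f [seq sg (par t) (ev t) | t <- b] = sg (pars par b) (f (map ev b)).
Proof.
move=> fl.
have H s0 : f (s0 ++ [seq sg (par t) (ev t) | t <- b])
    = sg (pars par b) (f (s0 ++ map ev b)).
  elim: b s0 => [|t b IH] s0 //=.
  by rewrite mlinsg // -cat_rcons IH cat_rcons sgsg.
exact: (H [::]).
Qed.

Lemma single_mlin : mlin (@single k V).
Proof.
by case=> [|z [|z' s1]] [|z'' s2] c x y; rewrite /= ?cst_linear ?cst0 ?scaler0 ?addr0.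
Qed.

Section Bridge.
Variables (W : gradedType k).
Variables (n : nat) (t : n.-tuple T).
Let d := map_tuple deg t.
Let x := map_tuple ev t.
Definition words (p : {set {set 'I_n}}) : seq (seq T) :=
  [seq map (tnth t) (enum B) | B : {set 'I_n} <- blocks p].

Lemma sum_words (R : lmodType k) (G : seq (seq T) -> R) :
  \sum_(p : {set {set 'I_n}} | partition p [set: 'I_n]) koszul k d p *: G (words p)
  = psum par G t.
Proof.
rewrite (sum_koszul_psum (p := par)) => [|i]; last by rewrite tnth_map.
by rewrite map_tnth_enum.
Qed.

Lemma size_words p : size (words p) = #|p|.
Proof. by rewrite size_map size_sort cardE. Qed.

Lemma block_argsE (B : {set 'I_n}) : block_args x B = map ev (map (tnth t) (enum B)).
Proof. by rewrite -map_comp; apply: eq_map => i; rewrite tnth_map. Qed.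

Lemma block_JargsE (B : {set 'I_n}) :
  block_Jargs d x B = [seq sg (par t) (ev t) | t <- map (tnth t) (enum B)].
Proof. by rewrite -map_comp; apply: eq_map => i; rewrite /= !tnth_map sgE. Qed.

Lemma sum_blocks_psum U (M : seq (ser W) -> ser U) (f : seq V -> ser W) w :
  sum_blocks w M f d x
  = psum par (fun bl => mulNhbar (w * (n - size bl)) (M [seq f (map ev b) | b <- bl])) t.
Proof.
rewrite -sum_words; apply: serP => a b; rewrite ser_sumE; apply: eq_bigr => p _.
rewrite serZE size_words; congr (_ *: mulNhbar _ (M _) a b).
by rewrite /words -map_comp; apply: eq_map => B; rewrite /= block_argsE.
Qed.

(** The values on the blocks, on the level of words: those before the
    distinguished block carry the involution [J]. *)
Definition values_at (f g : seq V -> ser W) (bl : seq (seq T)) i : seq (ser W) :=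
  [seq f [seq sg (par t) (ev t) | t <- b] | b <- take i bl]
  ++ g (map ev (nth [::] bl i)) :: [seq f (map ev b) | b <- drop i.+1 bl].

Lemma block_values_atE (f g : seq V -> ser W) (p : {set {set 'I_n}}) i : (i < #|p|)%N ->
  block_values_at f g d x p i = values_at f g (words p) i.
Proof.
move=> ip; have sb : size (blocks p) = #|p| by rewrite size_sort cardE.
have nthw j : (j < #|p|)%N ->
    nth [::] (words p) j = map (tnth t) (enum (nth set0 (blocks p) j)).
  by move=> jp; rewrite (nth_map set0) // sb.
apply: (@eq_from_nth _ 0).
  rewrite size_map size_iota size_cat /= !size_map size_take size_drop size_words ip.
  by rewrite subnSK // subnKC // ltnW.
move=> j; rewrite size_map size_iota => jp.
rewrite (nth_map 0%N) ?size_iota // nth_iota // add0n nth_cat size_map size_take.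
rewrite size_words ip; case: ltngtP => ji.
- rewrite (nth_map [::]) ?size_take ?size_words ?ip // nth_take // nthw //=.
  by rewrite block_JargsE.
- rewrite -(subnSK ji) /= (nth_map [::]); last first.
    by rewrite size_drop size_words ltn_sub2r // (leq_ltn_trans ji jp).
  by rewrite nth_drop subnKC // nthw // block_argsE.
- by rewrite ji subnn /= nthw // block_argsE.
Qed.

Lemma values_at_signs U (M : seq (ser W) -> ser U) (f g : seq V -> ser W) bl i :
  mlin f -> mlin M ->
  M (values_at f g bl i) = sg (pars par (flatten (take i bl)))
    (M ([seq f (map ev b) | b <- take i bl] ++ g (map ev (nth [::] bl i)) ::
        [seq f (map ev b) | b <- drop i.+1 bl])).
Proof.
move=> fl Ml; rewrite /values_at; move: (_ :: _) => r.
have H s0 : M (s0 ++ [seq f [seq sg (par t) (ev t) | t <- b] | b <- take i bl] ++ r)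
   = sg (pars par (flatten (take i bl))) (M (s0 ++ [seq f (map ev b) | b <- take i bl] ++ r)).
  elim: (take i bl) s0 => [|b l IH] s0 //=.
  by rewrite mlin_J // mlinsg // -cat_rcons IH cat_rcons sgsg pars_cat.
exact: (H [::]).
Qed.

(** The marker joins one of the blocks; alone it contributes nothing. *)
Lemma psum_marker U (M : seq (ser W) -> ser U) (Phi : seq (option T) -> ser W) (s : seq T) :
  mlin M -> Phi [:: None] = 0 ->
  psum parO (fun bl => M (map Phi bl)) (None :: map Some s)
  = psum par (fun bl => \sum_(i < size bl) sg (pars par (flatten (take i bl)))
      (M ([seq Phi (map Some b) | b <- take i bl] ++ Phi (None :: map Some (nth [::] bl i))
          :: [seq Phi (map Some b) | b <- drop i.+1 bl]))) s.
Proof.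
move=> Ml Phi0; rewrite psum_cons (psum_map (p := par)) //.
apply: eq_psum => bl nbl _ _ /=.
rewrite Phi0 [M (_ :: _)](mlin0 Ml [::]) add0r size_map.
apply: eq_bigr => i _; rewrite -!map_take -!map_drop.
have -> : flatten [seq [seq Some i0 | i0 <- i0] | i0 <- take i bl] = map Some (flatten (take i bl)).
  by rewrite map_flatten.
have pO (b : seq T) : pars parO (map Some b) = pars par b.
  by elim: b => //= y b ->.
by rewrite pO; congr (sg _ (M _)); rewrite map_cat /= -!map_comp (nth_map [::]).
Qed.

Lemma psum_marked U (M : seq (ser W) -> ser U) (F G : seq T -> ser W) (s : seq T) :
  mlin M ->
  psum parO (fun bl => M (map (marked F G) bl)) (None :: map Some s)
  = psum par (fun bl => \sum_(i < size bl) sg (pars par (flatten (take i bl)))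
      (M (map F (take i bl) ++ G (nth [::] bl i) :: map F (drop i.+1 bl)))) s.
Proof.
move=> Ml; rewrite psum_marker //; apply: eq_psum => bl nbl _ _.
apply: eq_bigr => i _; rewrite marked_None; last first.
  by move/(all_nthP [::]): nbl => /(_ i (ltn_ord i)).
by congr (sg _ (M (_ ++ _ :: _))); apply: eq_map => b /=; rewrite marked_Some.
Qed.

(** The involutions [J] in front of the distinguished block are the Koszul sign
    of moving the odd marker, the first letter, into that block. *)
Lemma sum_blocks_at_psum U (M : seq (ser W) -> ser U) (f g : seq V -> ser W) :
  mlin f -> mlin M ->
  sum_blocks_at M f g d x
  = psum parO
      (fun bl => M (map (marked (fun b => f (map ev b)) (fun b => g (map ev b))) bl))
      (None :: map Some t).
Proof.
move=> fl Ml; rewrite psum_marked // -sum_words; apply: serP => a b.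
rewrite ser_sumE; apply: eq_bigr => p _; rewrite serZE ser_sumE scaler_sumr size_words.
apply: eq_bigr => i _; rewrite block_values_atE // values_at_signs //.
Qed.

End Bridge.

Section Insert.
Variables (n : nat) (t : n.-tuple T).
Let d := map_tuple deg t.
Let x := map_tuple ev t.

Lemma sum_insert_zero U (M : seq (ser V) -> ser U) (g : seq V -> ser V) w :
  mlin M -> (forall s, g s = 0) -> sum_insert w M g d x = 0.
Proof.
move=> Ml g0; apply: serP => a b; rewrite /sum_insert big1 // => p _.
rewrite big1 // => i _; rewrite block_values_atE // /values_at g0 (mlin0 Ml).
by rewrite mulNhbar_0 scaler0.
Qed.

(** [single] vanishes on blocks that are not singletons, so the size condition
    in [sum_insert] only removes terms with a zero factor. *)
Lemma values_at_single_zero (bl : seq (seq T)) (i : nat) (y : ser V) :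
  all (fun b => 0 < size b)%N bl -> size (flatten bl) = n -> (i < size bl)%N ->
  size (nth [::] bl i) != (n - size bl).+1 ->
  0 \in [seq single (map ev b) | b <- take i bl] ++ y ::
       [seq single (map ev b) | b <- drop i.+1 bl].
Proof.
move=> nbl sz ib; apply: contraNT.
have z b : single (map ev b) != 0 -> size b = 1%N.
  by case: b => [|u [|v b]] //; rewrite /= cst0 eqxx.
have sz1 l : 0 \notin [seq single (map ev b) | b <- l] -> size (flatten l) = size l.
  elim: l => //= b l IH; rewrite inE negb_or eq_sym => /andP[/z sb /IH e].
  by rewrite size_cat sb e.
rewrite mem_cat inE !negb_or => /and3P[/sz1 e1 _ /sz1 e2].
have := sz; rewrite -{1}(cat_take_drop i bl) (drop_nth [::] ib) flatten_cat /= !size_cat.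
rewrite e1 e2 size_take ib size_drop => <-.
set m := size (nth _ _ _); have [c ->] : exists c, size bl = (i + c.+1)%N.
  by exists (size bl - i.+1)%N; rewrite subnSK // subnKC // ltnW.
have: (0 < m)%N by move/(all_nthP [::]): nbl; apply.
by lia.
Qed.

End Insert.
End Letters.

Section InsertProduct.
Variables (k : fieldType) (C : gcAlgType k) (T : Type) (deg : T -> int) (ev : T -> C).

(** Without its size condition the sum is an exponential in which the marked
    block takes the values of [g]; the weight of the block is then the power of
    [- hbar] of the partition, the other blocks being singletons. *)
Lemma sum_insert_prod n (t : n.-tuple T) (g : seq C -> ser C) :
  sum_insert 1 (@ser_prod k C) g (map_tuple deg t) (map_tuple ev t)
  = psum (parO deg)
      (fun bl => ser_prod (map (marked (fun b => single (map ev b))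
         (fun b => mulNhbar (size b).-1 (g (map ev b)))) bl))
      (None :: map Some t).
Proof.
rewrite psum_marked; last exact: ser_prod_mlin.
transitivity (psum (par deg)
   (fun bl => \sum_(i < size bl | size (nth [::] bl i) == (n - size bl).+1)
      mulNhbar (1 * (n - size bl)) (ser_prod (values_at deg ev (@single k C) g bl i))) t).
  rewrite -(sum_words deg); apply: serP => a b; rewrite ser_sumE; apply: eq_bigr => p _.
  rewrite serZE ser_sumE scaler_sumr size_words; apply: eq_big => [i|i _].
    by rewrite (nth_map set0) ?size_map -?cardE // size_sort -cardE.
  by rewrite block_values_atE.
apply: eq_psum => bl nbl szbl _; rewrite size_tuple in szbl.
rewrite big_mkcond; apply: eq_bigr => i _.
rewrite values_at_signs //; [|exact: single_mlin|exact: ser_prod_mlin].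
case: ifP => [/eqP e|/negbT ne]; last first.
  by rewrite ser_prod_zero ?sg0 // (values_at_single_zero ev _ nbl szbl).
rewrite !ser_prod_cat !ser_prod_cons mulNhbar_smull mulNhbar_smulr -mulNhbar_sg.
by rewrite e mul1n.
Qed.

End InsertProduct.

(** * Degrees of families *)

Lemma parityD i j : parity (i + j) = parity i (+) parity j.
Proof. rewrite /parity; lia. Qed.

Section FamilyDegrees.
Variables (k : fieldType) (C : gcAlgType k) (T : Type) (p : T -> bool) (D : T -> int).
Hypothesis pD : forall t, parity (D t) = p t.

Lemma parity_wt s : parity (wt D s) = pars p s.
Proof.
elim: s => [|t s IH]; first by rewrite /wt big_nil.
by rewrite wt_cons parityD IH pD.
Qed.

Lemma shomog_fam_exp (phi : seq T -> ser C) s :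
  (forall b, (0 < size b)%N -> shomog (wt D b) (phi b)) ->
  shomog (wt D s) (fam_exp p phi s).
Proof.
move=> hphi; apply: (@psum_closed_wt _ _ _ D _ (shomog (wt D s))).
- exact: shomogD.
- exact: shomogN.
move=> bl nbl <-; elim: bl nbl => [_|b bl IH /= /andP[nb nbl]].
  by rewrite /= /wt big_nil; apply: shomog_cst; exact: homog1.
by rewrite wt_cat ser_prod_cons; apply: shomog_smul; [exact: hphi | exact: IH].
Qed.

End FamilyDegrees.

Section MarkedDegree.
Variables (k : fieldType) (V : gradedType k) (T : Type) (deg : T -> int).
Variables (F G : seq T -> ser V) (m : int).
Hypotheses (hF : forall b, (0 < size b)%N -> shomog (wt deg b) (F b))
  (hG : forall b, (0 < size b)%N -> shomog (wt deg b + m) (G b)).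
Local Notation degO := (oapp deg m).

Lemma wt_pmap (l : seq (option T)) : all isSome l -> wt degO l = wt deg (pmap id l).
Proof.
elim: l => [|[t|] l IH] //=; first by rewrite /wt !big_nil.
by move=> /IH e; rewrite !wt_cons e.
Qed.

Lemma size_pmap_isSome (l : seq (option T)) : all isSome l -> size (pmap id l) = size l.
Proof. by elim: l => [|[t|] l IH] //= /IH->. Qed.

Lemma shomog_marked b : (0 < size b)%N -> shomog (wt degO b) (marked F G b).
Proof.
case: b => // -[t|] b _; rewrite /marked /=; case: ifP => [h|_]; try exact: shomog0.
  rewrite wt_cons wt_pmap // -[deg t + _]wt_cons; exact: hF.
case/andP: h => h nb; rewrite wt_cons wt_pmap // addrC; apply: hG.
by rewrite size_pmap_isSome.
Qed.

End MarkedDegree.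

Section Marked.
Variables (k : fieldType) (C : gcAlgType k) (T : Type) (deg : T -> int).
Variables (F G : seq T -> ser C) (m : int).
Hypotheses (hF : forall b, (0 < size b)%N -> shomog (wt deg b) (F b))
  (hG : forall b, (0 < size b)%N -> shomog (wt deg b + m) (G b)) (modd : parity m).
Local Notation degO := (oapp deg m).

Lemma parity_degO t : parity (degO t) = parO deg t.
Proof. by case: t => //=; rewrite modd. Qed.

Lemma fam_exp_marked_Some s :
  fam_exp (parO deg) (marked F G) (map Some s) = fam_exp (par deg) F s.
Proof.
rewrite /fam_exp (psum_map (p := par deg)) //; apply: eq_psum => bl _ _ _.
by rewrite -map_comp; congr ser_prod; apply: eq_map => b /=; rewrite marked_Some.
Qed.

Lemma fam_exp_marked s :
  fam_exp (parO deg) (marked F G) (None :: map Some s)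
  = conv (par deg) (fun a => if a is [::] then 0 else G a) (fam_exp (par deg) F) s.
Proof.
rewrite fam_exp_cons //; last first.
  move=> a b; rewrite -(parity_wt parity_degO) -(parity_wt parity_degO b).
  have hE := shomog_fam_exp (parO deg) b (shomog_marked hF hG).
  have hM := shomog_marked hF hG (b := None :: a) isT.
  by rewrite (smulC hM hE) wt_cons parityD /= modd addTb addbT.
rewrite /conv (ssum_map (p := par deg)) //; apply: eq_ssum => a b _ _.
rewrite fam_exp_marked_Some; congr smul.
by case: a => // t a; rewrite marked_None.
Qed.
End Marked.

Section SingleExp.
Variables (k : fieldType) (C : gcAlgType k) (T : Type) (p : T -> bool) (ev : T -> C).

(** The exponential of the identity, extended by zero: only the partition into
    singletons contributes. *)
Lemma fam_exp_single s :
  fam_exp p (fun b => single (map ev b)) s = cst (\prod_(v <- map ev s) v).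
Proof.
elim/last_ind: s => [|s x IH]; first by rewrite fam_exp_nil big_nil.
rewrite fam_exp_rcons ssum_left0 => [|a b sz lt]; last first.
  case: b sz => [|y b] sz; first by move: lt; rewrite -sz addn0 ltnn.
  by case: b {sz} => [|z b] /=; rewrite cst0 smul0r.
by rewrite /= IH smul_cst map_rcons -cats1 big_cat big_seq1.
Qed.
End SingleExp.

(** * From constants to series *)

Section SeriesLetters.
Variable k : fieldType.
Implicit Types (V W : gradedType k).

(** A letter is a series together with a degree; its value is the component of
    that degree, so that words of letters always have homogeneous values. *)
Definition lval V (t : int * ser V) : ser V := shpart t.1 t.2.

Definition multisl V W (F : seq (int * ser V) -> ser W) : Prop :=
  forall l1 j x l2, F (l1 ++ (j, x) :: l2) = lin_ext (fun v => F (l1 ++ (j, cst v) :: l2)) x.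

(** Functions of words of series that are linear over series in each letter are
    determined by their values on constant letters.  This extends the defining
    relations of the descendants, stated for constants, to series. *)
Lemma multisl_eq V W (F G : seq (int * ser V) -> ser W) :
  multisl F -> multisl G ->
  (forall l : seq (int * V), (0 < size l)%N ->
     F [seq (t.1, cst t.2) | t <- l] = G [seq (t.1, cst t.2) | t <- l]) ->
  forall l, (0 < size l)%N -> F l = G l.
Proof.
move=> Fl Gl e l nl; pose c (t : int * V) := (t.1, cst t.2).
have H l1 : (0 < size l1 + size l)%N -> F (map c l1 ++ l) = G (map c l1 ++ l).
  elim: l l1 {nl} => [|[j x] l IH] l1; first by rewrite addn0 !cats0; exact: e.
  move=> _; rewrite Fl Gl; apply: eq_lin_ext => a b.
  have := IH (rcons l1 (j, x a b)); rewrite map_rcons !cat_rcons; apply.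
  by rewrite size_rcons.
exact: (H [::]).
Qed.

Lemma shpart_lin_ext V j (x : ser V) : shpart j x = lin_ext (fun v => shpart j (cst v)) x.
Proof.
rewrite (_ : (fun v => _) = (fun v => cst (hpart j v))); last first.
  by apply: funext => v; rewrite shpart_cst.
apply: serP => a b; rewrite -[x in LHS]lin_ext_cstK /shpart /lin_ext.
have hs (I : Type) (r : seq I) (F : I -> V) :
    hpart j (\sum_(i <- r) F i) = \sum_(i <- r) hpart j (F i).
  by elim: r => [|i r IH]; rewrite ?big_nil ?hpart0 // !big_cons hpartD IH.
rewrite hs; apply: eq_bigr => i _; rewrite hs; apply: eq_bigr => l _.
by rewrite -[RHS]/(cst _ _ _) -shpart_cst.
Qed.

Lemma ser_prod_lin_ext V (C : gcAlgType k) (f : V -> ser C) s1 x s2 :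
  ser_prod (s1 ++ lin_ext f x :: s2) = lin_ext (fun v => ser_prod (s1 ++ f v :: s2)) x.
Proof.
rewrite ser_prod_cat ser_prod_cons smul_lin_extl smul_lin_extr.
by apply: eq_lin_ext => i j; rewrite -ser_prod_cons -ser_prod_cat.
Qed.

Lemma multisl_prod (C : gcAlgType k) : multisl (fun l => ser_prod (map (@lval C) l)).
Proof.
move=> l1 j x l2; rewrite map_cat /= [lval _]shpart_lin_ext ser_prod_lin_ext.
by apply: eq_lin_ext => a b; rewrite map_cat.
Qed.

Lemma multisl_lin_ext V W (U : gradedType k) (f : W -> ser U)
    (F : seq (int * ser V) -> ser W) :
  slin f -> multisl F -> multisl (fun l => lin_ext f (F l)).
Proof. by move=> fl Fl l1 j x l2; rewrite Fl lin_ext_comp. Qed.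

(** The weight of a block in a quantum exponential: a partition of [n] letters
    into [r] blocks gets (- hbar)^(n - r), as [sumn_size_pred] shows. *)
Definition wgt (T : Type) V (phi : seq T -> ser V) (s : seq T) : ser V :=
  if s is [::] then 0 else mulNhbar (size s).-1 (phi s).

Definition mul_lext V W (g : seq V -> ser W) (l : seq (int * ser V)) : ser W :=
  mul_ext g (map (@lval V) l).

Lemma multisl_mul V W (g : seq V -> ser W) : mlin g -> multisl (mul_lext g).
Proof.
move=> gl l1 j x l2; rewrite /mul_lext map_cat /= [lval _]shpart_lin_ext mul_ext_lin_ext //.
by apply: eq_lin_ext => a b; rewrite map_cat.
Qed.

Lemma multisl_wgt V W (F : seq (int * ser V) -> ser W) : multisl F -> multisl (wgt F).
Proof.
move=> Fl l1 j x l2.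
have nz y : wgt F (l1 ++ (j, y) :: l2)
    = mulNhbar (size l1 + size l2) (F (l1 ++ (j, y) :: l2)).
  by rewrite /wgt size_cat /= addnS; case: l1.
by rewrite nz Fl mulNhbar_lin_ext; apply: eq_lin_ext => a b; rewrite nz.
Qed.

Local Notation q := (par (fun t : int * ser _ => t.1)).

Lemma multisl_fam_exp V (C : gcAlgType k) (F : seq (int * ser V) -> ser C) :
  multisl F -> multisl (fam_exp q F).
Proof.
move=> Fl l1 j x l2.
apply: (psum_subst (Lop := fun g => lin_ext g x) _ _ _ (y := fun v => (j, cst v))) => //.
  by move=> g h; rewrite lin_extD.
move=> bl1 bl2 b1 b2; rewrite map_cat /= Fl ser_prod_lin_ext.
by apply: eq_lin_ext => a b; rewrite map_cat.
Qed.

Lemma multisl_conv V (C : gcAlgType k) (F G : seq (int * ser V) -> ser C) :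
  multisl F -> multisl G -> multisl (conv q F G).
Proof.
move=> Fl Gl l1 j x l2.
apply: (ssum_subst (Lop := fun g => lin_ext g x) _ _ (y := fun v => (j, cst v))) => //.
- by move=> g h; rewrite lin_extD.
- by move=> a1 a2 b _; rewrite Fl smul_lin_extl.
- by move=> a b1 b2; rewrite Gl smul_lin_extr.
Qed.

End SeriesLetters.

Lemma sumn_size_pred (T : Type) (bl : seq (seq T)) :
  all (fun b => 0 < size b)%N bl ->
  (sumn [seq (size b).-1 | b <- bl] + size bl)%N = size (flatten bl).
Proof.
elim: bl => //= b bl IH /andP[nb /IH e]; rewrite size_cat -e; lia.
Qed.

(** * Quantum descendants *)

Section WeightedExp.
Variables (k : fieldType) (C : gcAlgType k) (T : Type) (p : T -> bool).

Lemma fam_exp_map (T' : Type) (p' : T' -> bool) (h : T -> T') (phi : seq T' -> ser C) s :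
  (forall x, p' (h x) = p x) ->
  fam_exp p' phi (map h s) = fam_exp p (fun b => phi (map h b)) s.
Proof.
move=> ph; rewrite /fam_exp (psum_map (p := p)) //.
by apply: eq_psum => bl _ _ _; rewrite -map_comp.
Qed.

Lemma wgt_map (T' : Type) (h : T -> T') (phi : seq T' -> ser C) s :
  wgt phi (map h s) = wgt (fun b => phi (map h b)) s.
Proof. by case: s => //= x s; rewrite size_map. Qed.

Lemma wgtE (V : gradedType k) (phi : seq T -> ser V) s : (0 < size s)%N ->
  wgt phi s = mulNhbar (size s).-1 (phi s).
Proof. by case: s. Qed.

Lemma map_wgt (V : gradedType k) (phi : seq T -> ser V) bl :
  all (fun b => 0 < size b)%N bl ->
  map (wgt phi) bl = [seq mulNhbar (size b).-1 (phi b) | b <- bl].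
Proof. by elim: bl => //= b bl IH /andP[nb /IH ->]; rewrite wgtE. Qed.

Lemma fam_exp_wgt (phi : seq T -> ser C) s :
  fam_exp p (wgt phi) s
  = psum p (fun bl => mulNhbar (size s - size bl) (ser_prod (map phi bl))) s.
Proof.
apply: eq_psum => bl nbl <- _.
rewrite map_wgt // (ser_prod_mulNhbar (fun b => (size b).-1)); congr mulNhbar.
by rewrite -sumn_size_pred // addnK.
Qed.

End WeightedExp.

Section Base.
Variables (k : fieldType) (C C' : gcAlgType k).
Local Notation q := (par (fun t : int * ser _ => t.1)).
Local Notation ev := (fun t : int * C => hpart t.1 t.2).
Local Notation dg := (fun t : int * C => t.1).
Local Notation const := (fun t : int * C => (t.1, cst t.2)).

Lemma lval_const l : [seq lval t | t <- map const l] = map (@cst k C) (map ev l).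
Proof. by rewrite -!map_comp; apply: eq_map => t; rewrite /= /lval shpart_cst. Qed.

Lemma mul_lext_const (W : gradedType k) (g : seq C -> ser W) l : mlin g ->
  mul_lext g (map const l) = g (map ev l).
Proof. by move=> gl; rewrite /mul_lext lval_const mul_ext_csts. Qed.

Lemma homog_letters (l : seq (int * C)) :
  homog_tuple (map_tuple dg (in_tuple l)) (map_tuple ev (in_tuple l)).
Proof. by move=> i; rewrite !tnth_map; exact: homog_hpart. Qed.

(** The relation that determines the descendant of [f], for products of series
    of arbitrary degrees. *)
Lemma lin_ext_prod_exp (f : C -> ser C') (psi : seq C -> ser C') l :
  slin f -> mlin psi -> f 1 = cst 1 ->
  eq_homog (on_prod f) (sum_blocks 1 (@ser_prod k C') psi) ->
  lin_ext f (ser_prod (map (@lval k C) l)) = fam_exp q (wgt (mul_lext psi)) l.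
Proof.
move=> fl psil f1 e; case: (posnP (size l)) => [/size0nil ->|nl].
  by rewrite fam_exp_nil /= lin_ext_cst ?slin0.
move: l nl; apply: multisl_eq.
- by apply: multisl_lin_ext => //; exact: multisl_prod.
- by apply: multisl_fam_exp; apply: multisl_wgt; exact: multisl_mul.
move=> l nl; rewrite lval_const ser_prod_cst lin_ext_cst ?slin0 //.
rewrite (fam_exp_map (p := par dg)) //.
have := e _ _ _ nl (@homog_letters l); rewrite /on_prod.
rewrite (_ : \prod_(i < size l) _ = \prod_(v <- map ev l) v); last first.
  by rewrite (big_tuple _ _ (map_tuple ev (in_tuple l))).
move/serP => ->; rewrite sum_blocks_psum.
rewrite (eq_fam_exp _ _ (phi' := wgt (fun b => psi (map ev b)))); last first.
  by move=> b nb; rewrite wgt_map; case: b nb => //= t b _; rewrite -[_ :: map _ _]/(map const (t :: b)) mul_lext_const.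
by rewrite fam_exp_wgt; apply: eq_psum => bl _ _ _; rewrite mul1n.
Qed.

(** The relation that determines the descendant of [K]: the exponential of the
    singletons with the values of [ell] in one block, taken to the front, is a
    convolution product. *)
Lemma lin_ext_prod_conv (K : C -> ser C) (ell : seq C -> ser C) l :
  slin K -> mlin ell -> K 1 = 0 ->
  (forall (b : seq (int * C)), (0 < size b)%N ->
     shomog (wt dg b + 1) (ell (map ev b))) ->
  eq_homog (on_prod K) (sum_insert 1 (@ser_prod k C) ell) ->
  lin_ext K (ser_prod (map (@lval k C) l))
  = conv q (wgt (mul_lext ell)) (fun l => ser_prod (map (@lval k C) l)) l.
Proof.
move=> Kl elll K1 ellh e; case: (posnP (size l)) => [/size0nil ->|nl].
  by rewrite /conv /= smul0l lin_ext_cst ?slin0.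
move: l nl; apply: multisl_eq.
- by apply: multisl_lin_ext => //; exact: multisl_prod.
- by apply: multisl_conv; [apply: multisl_wgt; exact: multisl_mul | exact: multisl_prod].
move=> l nl; rewrite lval_const ser_prod_cst lin_ext_cst ?slin0 //.
have := e _ _ _ nl (@homog_letters l); rewrite /on_prod.
rewrite (_ : \prod_(i < size l) _ = \prod_(v <- map ev l) v); last first.
  by rewrite (big_tuple _ _ (map_tuple ev (in_tuple l))).
move/serP => ->; rewrite sum_insert_prod.
rewrite -/(fam_exp _ _ _) (@fam_exp_marked _ _ _ _ _ _ 1) //.
- rewrite /conv (ssum_map (p := par dg)) //; apply: eq_ssum => a b _ _.
  rewrite fam_exp_single lval_const ser_prod_cst; congr smul.
  by case: a => // t a; rewrite wgt_map /wgt mul_lext_const.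
- move=> [|t [|u b]] // _; last by rewrite /= cst0; exact: shomog0.
  by rewrite wt_cons /wt big_nil addr0 /=; apply: shomog_cst; exact: homog_hpart.
- by move=> b nb; apply: shomog_mulNhbar; exact: ellh.
Qed.

End Base.

Section Words.
Variables (k : fieldType) (T : Type) (deg : T -> int).
Implicit Types (C : gcAlgType k).
Local Notation p := (par deg).
Local Notation q := (par (fun t : int * ser _ => t.1)).

(** The composite of two families, the inner one [phi] being defined on
    arbitrary letters: homogeneous arguments, or these and the marker. *)
Definition ext_comp (V W : gradedType k) (g : seq V -> ser W) (phi : seq T -> ser V) s : ser W :=
  psum p (fun bl => mul_ext g (map phi bl)) s.

Definition hfam (V : gradedType k) (phi : seq T -> ser V) : Prop :=
  forall b, (0 < size b)%N -> shomog (wt deg b) (phi b).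

(** A block, turned into one letter whose value is that of [phi]. *)
Definition letter (V : gradedType k) (phi : seq T -> ser V) (b : seq T) : int * ser V :=
  (wt deg b, phi b).

Lemma hfam_wgt (V : gradedType k) (phi : seq T -> ser V) : hfam phi -> hfam (wgt phi).
Proof. by move=> h b nb; rewrite wgtE //; apply: shomog_mulNhbar; exact: h. Qed.

Lemma map_lval_letter (V : gradedType k) (phi : seq T -> ser V) bl : hfam phi ->
  all (fun b => 0 < size b)%N bl -> map (@lval k V) (map (letter phi) bl) = map phi bl.
Proof.
move=> h; elim: bl => //= b bl IH /andP[nb /IH->]; congr (_ :: _).
by apply: shomogP; exact: h.
Qed.

Lemma letter_par (V : gradedType k) (phi : seq T -> ser V) b : q (letter phi b) = pars p b.
Proof. exact: parity_wt. Qed.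

Lemma comp_wgt (V W : gradedType k) (g : seq V -> ser W) (phi : seq T -> ser V) s :
  mlin g -> hfam phi ->
  comp p (letter (wgt phi)) (wgt (mul_lext g)) s = wgt (ext_comp g phi) s.
Proof.
move=> gl hphi; case: (posnP (size s)) => [/size0nil->//|ns].
rewrite wgtE // /ext_comp -(psum_additive _ _ _ (f := mulNhbar (size s).-1)); last first.
  by move=> x y; exact: mulNhbarD.
apply: eq_psum => bl nbl sz _.
have nz : (0 < size bl)%N by case: bl nbl sz => // _ e; rewrite -e in ns.
rewrite wgtE ?size_map // /mul_lext map_lval_letter //; last exact: hfam_wgt.
rewrite map_wgt // mul_ext_mulNhbars // mulNhbar_add; congr mulNhbar.
by have := sumn_size_pred nbl; rewrite sz; lia.
Qed.

Lemma lin_ext_fam_exp (C C' : gcAlgType k) (f : C -> ser C') (phi : seq T -> ser C) s :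
  slin f -> hfam phi ->
  lin_ext f (fam_exp p phi s)
  = comp p (letter phi) (fun l => lin_ext f (ser_prod (map (@lval k C) l))) s.
Proof.
move=> fl h; rewrite /fam_exp -(psum_additive _ _ _ (lin_ext_add fl)).
by apply: eq_psum => bl nbl _ _; rewrite map_lval_letter.
Qed.

(** On each partition, [f] of the product of the values of [phi] is an
    exponential of [psi] over the set of blocks; [comp_exp] resums. *)
Lemma morphism_exp (C C' : gcAlgType k) (f : C -> ser C') (psi : seq C -> ser C')
    (phi : seq T -> ser C) s :
  slin f -> mlin psi -> f 1 = cst 1 ->
  eq_homog (on_prod f) (sum_blocks 1 (@ser_prod k C') psi) -> hfam phi ->
  lin_ext f (fam_exp p (wgt phi) s) = fam_exp p (wgt (ext_comp psi phi)) s.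
Proof.
move=> fl psil f1 e h; rewrite lin_ext_fam_exp //; last exact: hfam_wgt.
rewrite (eq_comp _ _ _ (G := fam_exp q (wgt (mul_lext psi)))); last first.
  by move=> l; exact: lin_ext_prod_exp.
rewrite comp_exp; last by move=> b _; exact: letter_par.
by apply: eq_fam_exp => b _; rewrite comp_wgt.
Qed.

(** As for morphisms, with [comp_conv] to resum: one factor collects the blocks
    to which [ell] is applied. *)
Lemma differential_exp C (K : C -> ser C) (ell : seq C -> ser C) (phi : seq T -> ser C) s :
  slin K -> mlin ell -> K 1 = 0 ->
  (forall (b : seq (int * C)), (0 < size b)%N ->
     shomog (wt (fun t => t.1) b + 1) (ell [seq hpart t.1 t.2 | t <- b])) ->
  eq_homog (on_prod K) (sum_insert 1 (@ser_prod k C) ell) -> hfam phi ->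
  lin_ext K (fam_exp p (wgt phi) s)
  = conv p (wgt (ext_comp ell phi)) (fam_exp p (wgt phi)) s.
Proof.
move=> Kl elll K1 ellh e h; rewrite lin_ext_fam_exp //; last exact: hfam_wgt.
rewrite (eq_comp _ _ _ (G := conv q (wgt (mul_lext ell))
   (fun l => ser_prod (map (@lval k C) l)))); last first.
  by move=> l; exact: lin_ext_prod_conv.
rewrite comp_conv; last by move=> b _; exact: letter_par.
apply: eq_conv => a _; first by rewrite comp_wgt.
by apply: eq_psum => bl nbl _ _; rewrite map_lval_letter //; exact: hfam_wgt.
Qed.

End Words.

(** * Division by exponentials and by time *)

Section Cancel.
Variables (k : fieldType) (C : gcAlgType k) (T : Type) (p : T -> bool).

(** As [E] is 1 on the empty word, convolution by [E] is unitriangular for the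
    length of words.  [N] is an ideal of series: zero, or the multiples of a
    power of [tau]. *)
Lemma conv_cancel (N : ser C -> Prop) (X E : seq T -> ser C) :
  N 0 -> (forall x y, N x -> N y -> N (x + y)) -> (forall x, N x -> N (- x)) ->
  (forall x y, N x -> N (smul x y)) ->
  E [::] = cst 1 -> (forall s, N (conv p X E s)) -> forall s, N (X s).
Proof.
move=> N0 ND NN NM E1 NXE; elim/size_ind => [|s x IH].
  by have := NXE [::]; rewrite /conv /= E1 smul1r.
have := @ssum_left _ p _ N (fun a b => smul (X a) (E b)) (rcons s x) N0 ND NN.
rewrite E1 smul1r -/(conv p X E _) => /(_ _)/NN; rewrite opprB => H.
rewrite -[X _](subrK (conv p X E (rcons s x))); apply: ND => //; apply: H => a b sz lt.
by apply: NM; apply: IH; rewrite -ltnS -[(size s).+1](size_rcons s x).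
Qed.

Lemma conv_cancel0 (X Y E : seq T -> ser C) :
  E [::] = cst 1 -> (forall s, conv p X E s = conv p Y E s) -> forall s, X s = Y s.
Proof.
move=> E1 e s; apply/eqP; rewrite -subr_eq0; apply/eqP.
apply: (@conv_cancel (fun x => x = 0) (fun s => X s - Y s) E) => //.
- by move=> x y -> ->; rewrite addr0.
- by move=> x ->; rewrite oppr0.
- by move=> x y ->; rewrite smul0l.
move=> t; apply/eqP; rewrite -(inj_eq (addIr (conv p Y E t))) add0r -{2}e; apply/eqP.
rewrite /conv -ssumD; apply: eq_ssum => a b _ _.
by rewrite -smulDl subrK.
Qed.

End Cancel.

Lemma mulNhbar_inj (k : fieldType) (V : gradedType k) m : injective (@mulNhbar k V m).
Proof.
move=> x y e; apply: serP => a b.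
by rewrite (mulNhbar_coef m x) (mulNhbar_coef m y) e.
Qed.

Lemma shomog_dtau (k : fieldType) (V : gradedType k) j (x : ser V) :
  shomog j x -> shomog j (dtau x).
Proof. by move=> h a b; rewrite /dtau -scaler_nat; apply: homogZ. Qed.

Section TauOrder.
Variables (k : fieldType).

Definition tau_ord (V : gradedType k) m (x : ser V) : Prop :=
  forall a b, (b < m)%N -> x a b = 0.

Lemma tau_ordD (V : gradedType k) m (x y : ser V) :
  tau_ord m x -> tau_ord m y -> tau_ord m (x + y).
Proof. by move=> hx hy a b lt; rewrite serDE hx ?hy ?addr0. Qed.
Lemma tau_ordN (V : gradedType k) m (x : ser V) : tau_ord m x -> tau_ord m (- x).
Proof. by move=> hx a b lt; rewrite serNE hx ?oppr0. Qed.
Lemma tau_ord_sg (V : gradedType k) m (e : bool) (x : ser V) :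
  tau_ord m x -> tau_ord m (sg e x).
Proof. by case: e => // hx; exact: tau_ordN. Qed.
Lemma tau_ord_lin_ext (V W : gradedType k) m (f : V -> ser W) x : slin f ->
  tau_ord m x -> tau_ord m (lin_ext f x).
Proof.
move=> fl hx a b lt; rewrite /lin_ext big1 // => i _; rewrite big1 // => j _.
by rewrite hx ?slin0 // (leq_ltn_trans _ lt) // -ltnS.
Qed.
Lemma tau_ord_smul (C : gcAlgType k) m (x y : ser C) : tau_ord m x -> tau_ord m (smul x y).
Proof. by apply: tau_ord_lin_ext; exact: lmul_slin. Qed.
Lemma tau_ord_mulNhbar (V : gradedType k) m n (x : ser V) :
  tau_ord m x <-> tau_ord m (mulNhbar n x).
Proof.
split=> hx a b lt; last by rewrite (mulNhbar_coef n x) hx ?scaler0.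
by rewrite /mulNhbar; case: ifP => // _; rewrite hx ?scaler0.
Qed.
Lemma tau_ord_wgt (V : gradedType k) (T : Type) m (phi : seq T -> ser V) s : (0 < size s)%N ->
  tau_ord m (phi s) <-> tau_ord m (wgt phi s).
Proof. by move=> ns; rewrite wgtE //; exact: tau_ord_mulNhbar. Qed.

(** The step of the solution of differential equations in powers of [tau]. *)
Lemma tau_ord_dtau (V : gradedType k) m (x : ser V) : [pchar k] =i pred0 ->
  tau_ord 1 x -> tau_ord m (dtau x) -> tau_ord m.+1 x.
Proof.
move=> char0 x0 hx a [|b] lt; first exact: x0.
have := hx a b lt; rewrite /dtau -scaler_nat => /eqP; rewrite scaler_eq0 => /orP[|/eqP//].
by rewrite ((pcharf0P k).1 char0).
Qed.
Lemma tau_ord_all (V : gradedType k) (x : ser V) : (forall m, tau_ord m x) -> x = 0.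
Proof. by move=> h; apply: serP => a b; exact: (h b.+1). Qed.
End TauOrder.

Section Marker.
Variables (k : fieldType) (C : gcAlgType k) (T : Type) (deg : T -> int) (m : int).
Hypothesis modd : parity m.
Local Notation p := (par deg).
Local Notation pO := (parO deg).
Local Notation degO := (oapp deg m).
Variable Phi : seq (option T) -> ser C.
Hypotheses (hPhi : hfam degO Phi) (Phi0 : Phi [:: None] = 0).
Let F b := Phi (map Some b).
Let G a := Phi (None :: map Some a).
Let E := fam_exp p (wgt F).

Lemma parO_par : pO = par degO.
Proof. by apply: funext => t; rewrite /par (@parity_degO T deg m modd). Qed.

Lemma fam_exp_Some s : fam_exp pO (wgt Phi) (map Some s) = E s.
Proof.
rewrite (fam_exp_map (p := p)) //; apply: eq_fam_exp => b _.
by rewrite wgt_map.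
Qed.

Lemma wgt_None a : wgt Phi (None :: map Some a) = mulNhbar 1 (wgt G a).
Proof.
case: a => [|t a]; first by rewrite /= Phi0 mulNhbar_0 mulNhbar_0.
by rewrite /wgt /= size_map mulNhbar_add.
Qed.

(** The exponential of a family on marked words, the marker being moved to the
    front of its block.  The marker counts as a letter, whence the extra factor
    [- hbar]. *)
Lemma fam_exp_None s :
  fam_exp pO (wgt Phi) (None :: map Some s) = mulNhbar 1 (conv p (wgt G) E s).
Proof.
rewrite fam_exp_cons; first last.
- by rewrite (wgt_None [::]) mulNhbar_0.
- move=> a b; rewrite -[in LHS](map_id a).
  have hE : shomog (wt degO b) (fam_exp pO (wgt Phi) b).
    by apply: shomog_fam_exp; exact: hfam_wgt.
  have hM : shomog (wt degO (None :: a)) (wgt Phi (None :: map id a)).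
    by rewrite map_id; exact: hfam_wgt.
  rewrite (smulC hM hE) map_id !(parity_wt (@parity_degO T deg m modd)).
  by rewrite /= addbT.
rewrite /conv (ssum_map (p := p)) //.
rewrite -(ssum_additive _ _ _ (f := mulNhbar 1)); last by move=> x y; exact: mulNhbarD.
apply: eq_ssum => a b _ _; rewrite fam_exp_Some wgt_None.
by rewrite mulNhbar_smull.
Qed.

Variables (K : C -> ser C) (ell : seq C -> ser C).
Hypotheses (Kl : slin K) (elll : mlin ell) (K1 : K 1 = 0).
Hypothesis ellh : forall (b : seq (int * C)), (0 < size b)%N ->
  shomog (wt (fun t => t.1) b + 1) (ell [seq hpart t.1 t.2 | t <- b]).
Hypothesis ellE : eq_homog (on_prod K) (sum_insert 1 (@ser_prod k C) ell).
Let X := ext_comp deg ell F.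
Let Y a := ext_comp degO ell Phi (None :: map Some a).

Lemma ext_comp_Some (W : gradedType k) (g : seq C -> ser W) a :
  ext_comp degO g Phi (map Some a) = ext_comp deg g F a.
Proof.
rewrite /ext_comp (psum_map (p := p)) //; apply: eq_psum => bl _ _ _.
by rewrite -map_comp.
Qed.

Lemma ext_comp_None0 (W : gradedType k) (g : seq C -> ser W) : mlin g ->
  ext_comp degO g Phi [:: None] = 0.
Proof.
move=> gl; rewrite /ext_comp -[[:: None]]/(rcons [::] None) psum_rcons /= psum0 /=.
by rewrite Phi0; exact: (mlin0 (mul_ext_mlin gl) [::]).
Qed.

Lemma hfam_F : hfam deg F.
Proof.
move=> b nb; have := hPhi (b := map Some b); rewrite size_map => /(_ nb).
by rewrite wt_pmap ?all_isSome_map // pmap_id_Some.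
Qed.

(** The identity [differential_exp] on marked words, divided by the factor
    [- hbar] of the marker.  Its terms are sorted by whether the marker is in
    the block to which [ell] is applied. *)
Lemma differential_insert s :
  lin_ext K (conv p (wgt G) E s)
  = conv p (wgt Y) E s
    + ssum p (fun a b => sg (pars p a) (smul (wgt X a) (conv p (wgt G) E b))) s.
Proof.
apply: (@mulNhbar_inj _ _ 1).
rewrite -lin_ext_mulNhbar // -fam_exp_None parO_par.
rewrite (differential_exp _ Kl elll K1 ellh ellE hPhi) -parO_par /conv /=.
rewrite (ssum_map (p := p)) // (ssum_map (p := p)) // -!ssumD.
rewrite -(ssum_additive _ _ _ (f := mulNhbar 1)); last by move=> x y; exact: mulNhbarD.
apply: eq_ssum => a b _ _; rewrite mulNhbarD fam_exp_Some fam_exp_None.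
congr (_ + _); last first.
  rewrite wgt_map (_ : (fun b => _) = X); last by apply: funext => c; exact: ext_comp_Some.
  rewrite mulNhbar_smulr mulNhbar_sg; congr (sg _ _).
  by elim: a => //= t a ->.
rewrite -mulNhbar_smull; congr smul.
case: a => [|t a]; first by rewrite /= ext_comp_None0 // !mulNhbar_0.
by rewrite /wgt /= size_map mulNhbar_add.
Qed.

End Marker.

(** * Symmetric families of maps *)

Section Arities.
Variables (k : fieldType) (V W : gradedType k).

Lemma hom_hbar_slin j (f : V -> ser W) : hom_hbar j f -> slin f.
Proof.
by case=> h _ c x y; apply: serP => a b; rewrite serDE serZE; case: (h a b) => ->.
Qed.

(** The conditions on all positive arities together; no condition on the value
    of [g] on the empty word. *)
Definition sym_fam j (g : seq V -> ser W) : Prop :=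
  forall n, (0 < n)%N -> forall a b, sym_hom n j (fun s => g s a b).

Variables (j : int) (g : seq V -> ser W).

Lemma sym_fam_mlin : sym_fam j g -> mlin g.
Proof.
move=> gh s1 s2 c x y; apply: serP => a b; rewrite serDE serZE.
have [-> //] := gh (size s1 + size s2).+1 isT a b.
Qed.

Lemma sym_fam_gsym : sym_fam j g -> gsym g.
Proof.
move=> gh s1 s2 x y p q hx hy; apply: serP => a b; rewrite ser_sgE -sgE.
by have [_ e _] := gh (size s1 + size s2).+2 isT a b; apply: e.
Qed.

Lemma sym_fam_deg (T : Type) (deg : T -> int) (ev : T -> V) b : sym_fam j g ->
  (forall t, homog (deg t) (ev t)) -> (0 < size b)%N ->
  shomog (wt deg b + j) (g (map ev b)).
Proof.
move=> gh hev nb c d; have [_ _ h] := gh _ nb c d.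
have := h (map_tuple ev (in_tuple b)) (map_tuple deg (in_tuple b)).
rewrite -(big_tuple _ _ (map_tuple deg (in_tuple b)) xpredT id) /= big_map; apply => i.
by rewrite !tnth_map.
Qed.

Lemma sym_fam_of : mlin g -> gsym g ->
  (forall l : seq (int * V), (0 < size l)%N ->
     shomog (wt (fun t => t.1) l + j) (g [seq hpart t.1 t.2 | t <- l])) ->
  sym_fam j g.
Proof.
move=> gl gs gd n n0 a b; split=> [s1 s2 c x y _|s1 s2 x y p q _ hx hy|x d hx].
- by rewrite gl serDE serZE.
- by rewrite (gs _ _ _ _ _ _ hx hy) ser_sgE sgE.
have := gd (zip d x); rewrite size_zip !size_tuple minnn => /(_ n0 a b).
rewrite /wt -(big_map (fun t : int * V => t.1) xpredT id) -[map _ _]/(unzip1 _).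
rewrite unzip1_zip ?size_tuple // big_tuple.
suff -> : [seq hpart t.1 t.2 | t <- zip d x] = x by [].
apply: (@eq_from_nth _ 0) => [|i]; rewrite size_map size_zip !size_tuple minnn // => lt.
rewrite (nth_map (0, 0)) ?size_zip ?size_tuple ?minnn // nth_zip ?size_tuple //=.
by have := hx (Ordinal lt); rewrite !(tnth_nth 0).
Qed.

Lemma shom_hbar_sym : (forall n, (0 < n)%N -> shom_hbar n j g) -> sym_fam j g.
Proof. by move=> h n n0; case: (h n n0). Qed.

Lemma shom_hbar_tau_sym : (forall n, (0 < n)%N -> shom_hbar_tau n j g) -> sym_fam j g.
Proof. by move=> h n n0; case: (h n n0). Qed.

Lemma shom_hbar_tau_free : (forall n, (0 < n)%N -> shom_hbar n j g) ->
  forall s, (0 < size s)%N -> tau_free (g s).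
Proof. by move=> h s ns; case: (h _ ns) => _; apply. Qed.

End Arities.

Section ExtCompDegree.
Variables (k : fieldType) (T : Type) (deg : T -> int) (V W : gradedType k).

(** The weight used in the induction pairs the degree with the length, so that
    non-empty words are seen to have only non-empty partitions. *)
Lemma ext_comp_deg j (g : seq V -> ser W) (phi : seq T -> ser V) s :
  sym_fam j g -> hfam deg phi -> (0 < size s)%N ->
  shomog (wt deg s + j) (ext_comp deg g phi s).
Proof.
move=> gh hphi ns.
have HG : forall bl, all (fun b => 0 < size b)%N bl ->
   size (flatten bl) = size s -> wt deg (flatten bl) = wt deg s ->
   shomog (wt deg s + j) (mul_ext g (map phi bl)).
  move=> bl nbl sz <-.
  have nb : (0 < size bl)%N by case: bl sz {nbl} => // e; rewrite -e in ns.
  have -> : wt deg (flatten bl) = \sum_(t <- map (letter deg phi) bl) t.1.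
    elim: bl {nbl sz nb} => [|b bl IH]; first by rewrite /wt !big_nil.
    by rewrite wt_cat big_cons -IH.
  have -> : map phi bl = map snd (map (letter deg phi) bl) by rewrite -map_comp.
  apply: mul_ext_deg => [m em hm|t].
    have nm : (0 < size m)%N by rewrite -(size_map fst) em !size_map.
    have := sym_fam_deg (T := int * V) (deg := fun t => t.1) (ev := fun t => hpart t.1 t.2)
      gh (fun t => homog_hpart _ _) nm.
    suff -> : [seq hpart t.1 t.2 | t <- m] = map snd m by [].
    by apply/eq_in_map => t /hm.
  elim: bl nbl {sz nb} => //= b bl IH /andP[nb nbl]; rewrite inE => /predU1P[->|].
    exact: hphi.
  exact: IH.
pose P (x : ser W) := shomog (wt deg s + j) x.
have := @psum_closed_wt T (par deg) (int * nat)%type (fun t => (deg t, 1%N)) _ P.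
have w2 t : wt (fun t => (deg t, 1%N)) t = (wt deg t, size t).
  elim: t => [|x t IH]; first by rewrite /wt !big_nil.
  by rewrite !wt_cons IH.
apply; [exact: shomogD|exact: shomogN|].
move=> bl nbl; rewrite !w2 => -[e1 e2]; exact: HG.
Qed.

End ExtCompDegree.

(** * Exponentials in a binary QFT algebra *)

Section BinaryQFT.
Variables (k : fieldType) (A : binaryQFT k).
Local Notation K := (bq_K A).
Local Notation ell := (bq_ell A).

Lemma bq_K_slin : slin K. Proof. exact: hom_hbar_slin (bq_K_hom A). Qed.
Lemma bq_K_tau v : tau_free (K v). Proof. by case: (bq_K_hom A). Qed.
Lemma bq_K_one : K 1 = 0. Proof. by apply: serP => a b; rewrite bq_K1. Qed.
Lemma bq_K_sq x : lin_ext K (lin_ext K x) = 0.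
Proof.
rewrite lin_ext_comp; last exact: bq_K_slin.
rewrite -[RHS](@lin_ext_zero k A A x); apply: eq_lin_ext => i j.
by apply: serP => a b; rewrite bq_KK.
Qed.
Lemma bq_ell_sym : sym_fam 1 ell.
Proof. by apply: shom_hbar_sym => n; exact: bq_ell_hom. Qed.
Lemma bq_ell_mlin : mlin ell. Proof. exact: sym_fam_mlin bq_ell_sym. Qed.
Lemma bq_ell_deg (b : seq (int * A)) : (0 < size b)%N ->
  shomog (wt (fun t => t.1) b + 1) (ell [seq hpart t.1 t.2 | t <- b]).
Proof. by apply: sym_fam_deg; [exact: bq_ell_sym | move=> t; exact: homog_hpart]. Qed.

Section Flat.
Variables (T : Type) (deg : T -> int) (phi : seq T -> ser A).
Hypothesis hphi : hfam deg phi.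
Local Notation E := (fam_exp (par deg) (wgt phi)).

Lemma bq_K_exp s :
  lin_ext K (E s) = conv (par deg) (wgt (ext_comp deg ell phi)) E s.
Proof.
apply: differential_exp => //; [exact: bq_K_slin|exact: bq_ell_mlin|exact: bq_K_one|..].
  exact: bq_ell_deg.
exact: bq_ellE.
Qed.

(** With [closed_flat], which divides [bq_K_exp] by the exponential: flat
    families are those with closed exponentials. *)
Lemma flat_closed : (forall s, (0 < size s)%N -> ext_comp deg ell phi s = 0) ->
  forall s, lin_ext K (E s) = 0.
Proof.
move=> X0 s; rewrite bq_K_exp -[RHS](ssum0 (par deg) _ s); apply: eq_ssum => a b _ _.
by case: a => [|t a]; rewrite /wgt ?X0 ?mulNhbar_0 ?smul0l.
Qed.

Lemma closed_flat : (forall s, lin_ext K (E s) = 0) ->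
  forall s, (0 < size s)%N -> ext_comp deg ell phi s = 0.
Proof.
move=> KE s ns; apply: (@mulNhbar_inj _ _ (size s).-1); rewrite mulNhbar_0 -wgtE //.
apply: (@conv_cancel0 _ _ _ (par deg) _ (fun=> 0) E) => // t.
rewrite -bq_K_exp KE -[LHS](ssum0 (par deg) _ t); apply: eq_ssum => a b _ _.
by rewrite smul0l.
Qed.

End Flat.

Section Homotopy.
Hypothesis char0 : [pchar k] =i pred0.
Variables (T : Type) (deg : T -> int) (m : int).
Hypothesis modd : parity m.
Local Notation p := (par deg).
Local Notation degO := (oapp deg m).
Variable Phi : seq (option T) -> ser A.
Hypotheses (hPhi : hfam degO Phi) (Phi0 : Phi [:: None] = 0).
Let F b := Phi (map Some b).
Let G a := Phi (None :: map Some a).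
Let E := fam_exp p (wgt F).
Let X := ext_comp deg ell F.
Let Y a := ext_comp degO ell Phi (None :: map Some a).
Hypothesis dF : forall a, (0 < size a)%N -> dtau (F a) = Y a.
Hypothesis X0 : forall a, (0 < size a)%N -> tau_ord 1 (X a).

(** The homotopy equation [dF], in exponential form. *)
Lemma dtau_exp s : dtau (E s) = conv p (wgt Y) E s.
Proof.
rewrite /E fam_exp_dtau.
  apply: eq_conv => // a _; case: a => // t a.
  by rewrite /wgt dtau_mulNhbar dF.
move=> a b na; have hF := hfam_wgt (hfam_F hPhi).
have hE : shomog (wt deg b) (E b) by exact: shomog_fam_exp.
have hd : shomog (wt deg a) (dtau (wgt F a)) by apply: shomog_dtau; exact: hF.
by rewrite (smulC hd hE) !(parity_wt (p := p) (D := deg)).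
Qed.

Lemma K_insert s : lin_ext K (conv p (wgt G) E s) = dtau (E s)
  + ssum p (fun a b => sg (pars p a) (smul (wgt X a) (conv p (wgt G) E b))) s.
Proof.
rewrite dtau_exp; apply: (differential_insert modd hPhi Phi0) => //.
- exact: bq_K_slin.
- exact: bq_ell_mlin.
- exact: bq_K_one.
- exact: bq_ell_deg.
- exact: bq_ellE.
Qed.

(** The obstruction [X] vanishes at time 0 and solves a linear differential
    equation: K E = X * E by [bq_K_exp], and applying [K] to [K_insert] bounds
    the time derivative of K E by multiples of [X].  So [X] is divisible by
    every power of [tau]. *)
Lemma flat_homotopy a : (0 < size a)%N -> X a = 0.
Proof.
move=> na; apply: tau_ord_all => n; elim: n a na => // n IH a na.
have wX b : tau_ord n (wgt X b).
  by case: b => [|t b] //; apply: (iffLR (tau_ord_wgt n X _)) => //; exact: IH.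
have KE s : lin_ext K (E s) = conv p (wgt X) E s.
  by apply: bq_K_exp; exact: hfam_F hPhi.
apply: (iffRL (tau_ord_wgt n.+1 X na)); move: a {na}.
apply: (@conv_cancel _ _ _ p (@tau_ord k A n.+1) _ E) => //.
- exact: tau_ordD.
- exact: tau_ordN.
- by move=> x y; exact: tau_ord_smul.
move=> s; apply: tau_ord_dtau => //.
  apply: (@ssum_closed _ p _ (@tau_ord k A 1)) => //.
  - exact: tau_ordD.
  - exact: tau_ordN.
  move=> a b _; apply: tau_ord_smul; case: a => // t a.
  by apply: (iffLR (tau_ord_wgt 1 X _)) => //; exact: X0.
rewrite -KE dtau_lin_ext; [|exact: bq_K_slin|exact: bq_K_tau].
have /(canRL (addrK _)) -> := esym (K_insert s).
rewrite -[_ - _]addrC (lin_ext_add bq_K_slin) bq_K_sq addr0.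
apply: tau_ord_lin_ext; first exact: bq_K_slin.
apply: tau_ordN; apply: (@ssum_closed _ p _ (@tau_ord k A n)) => //.
- exact: tau_ordD.
- exact: tau_ordN.
by move=> a b _; apply: tau_ord_sg; exact: tau_ord_smul.
Qed.

(** [K_insert], where the terms containing [X] are now known to vanish. *)
Lemma dtau_exp_exact s : dtau (E s) = lin_ext K (conv p (wgt G) E s).
Proof.
rewrite K_insert -[LHS]addr0; congr (_ + _); rewrite -[LHS](ssum0 p _ s).
apply: eq_ssum => a b _ _; case: a => [|t a]; rewrite /= ?smul0l //.
by rewrite flat_homotopy // mulNhbar_0 smul0l sg0.
Qed.

End Homotopy.
End BinaryQFT.

Section Transport.
Variables (k : fieldType) (A B : binaryQFT k) (f : A -> ser B) (psi : seq A -> ser B).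
Hypotheses (mf : is_morphism f) (df : is_descendant f psi).

Lemma morph_slin : slin f. Proof. by case: mf => /hom_hbar_slin. Qed.
Lemma morph_tau v : tau_free (f v). Proof. by case: mf => -[]. Qed.
Lemma morph_one : f 1 = cst 1.
Proof. by case: mf => _ h _ _; apply: serP. Qed.
Lemma morph_K x : lin_ext (bq_K B) (lin_ext f x) = lin_ext f (lin_ext (bq_K A) x).
Proof.
rewrite !lin_ext_comp; [|exact: morph_slin|exact: bq_K_slin].
by apply: eq_lin_ext => i j; apply: serP => a b; case: mf => _ _ ->.
Qed.
Lemma desc_sym : sym_fam 0 psi.
Proof. by apply: shom_hbar_sym; case: df. Qed.
Lemma desc_mlin : mlin psi. Proof. exact: sym_fam_mlin desc_sym. Qed.

Section Words.
Variables (T : Type) (deg : T -> int) (phi : seq T -> ser A).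
Hypothesis hphi : hfam deg phi.

Lemma hfam_ext_comp : hfam deg (ext_comp deg psi phi).
Proof. by move=> b nb; rewrite -[wt _ _]addr0; exact: (ext_comp_deg desc_sym). Qed.

Lemma morph_exp s :
  lin_ext f (fam_exp (par deg) (wgt phi) s)
  = fam_exp (par deg) (wgt (ext_comp deg psi phi)) s.
Proof.
apply: morphism_exp => //; [exact: morph_slin|exact: desc_mlin|exact: morph_one|].
by case: df.
Qed.

(** A chain map sends closed exponentials to closed exponentials. *)
Lemma flat_transport :
  (forall s, (0 < size s)%N -> ext_comp deg (bq_ell A) phi s = 0) ->
  forall s, (0 < size s)%N -> ext_comp deg (bq_ell B) (ext_comp deg psi phi) s = 0.
Proof.
move=> X0; apply: closed_flat; first exact: hfam_ext_comp.
by move=> s; rewrite -morph_exp morph_K flat_closed // lin_ext0 //; exact: morph_slin.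
Qed.
End Words.

Section Homotopy.
Hypothesis char0 : [pchar k] =i pred0.
Variables (T : Type) (deg : T -> int) (m : int).
Hypothesis modd : parity m.
Local Notation p := (par deg).
Local Notation degO := (oapp deg m).
Variable Phi : seq (option T) -> ser A.
Hypotheses (hPhi : hfam degO Phi) (Phi0 : Phi [:: None] = 0).
Let F b := Phi (map Some b).
Hypothesis dF : forall a, (0 < size a)%N ->
  dtau (F a) = ext_comp degO (bq_ell A) Phi (None :: map Some a).
Hypothesis X0 : forall a, (0 < size a)%N -> tau_ord 1 (ext_comp deg (bq_ell A) F a).
Let Phi' := ext_comp degO psi Phi.
Let F' := ext_comp deg psi F.

(** The exponential of the composite is the image of E, and the marked one the
    image of the marked one.  Applying [f] to [dtau_exp_exact] and comparing
    with [differential_insert] for the composite, where the flatness of the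
    composite removes the unwanted terms, gives the homotopy equation times the
    exponential. *)
Lemma homotopy_transport a : (0 < size a)%N ->
  dtau (F' a) = ext_comp degO (bq_ell B) Phi' (None :: map Some a).
Proof.
move=> na.
have hPhi' : hfam degO Phi' by exact: hfam_ext_comp.
have Phi0' : Phi' [:: None] = 0 by apply: ext_comp_None0 => //; exact: desc_mlin.
have eF' : (fun b => Phi' (map Some b)) = F'.
  by apply: funext => b; exact: (ext_comp_Some deg m Phi psi b).
have hF := hfam_F hPhi; have hF' : hfam deg F' by exact: hfam_ext_comp.
have E'E s : fam_exp p (wgt F') s = lin_ext f (fam_exp p (wgt F) s).
  by rewrite morph_exp.
have G'G s : conv p (wgt (fun a => Phi' (None :: map Some a))) (fam_exp p (wgt F')) s
   = lin_ext f (conv p (wgt (fun a => Phi (None :: map Some a))) (fam_exp p (wgt F)) s).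
  apply: (@mulNhbar_inj _ _ 1).
  rewrite -lin_ext_mulNhbar; last exact: morph_slin.
  rewrite -(fam_exp_None modd hPhi Phi0) -eF' -(fam_exp_None modd hPhi' Phi0').
  by rewrite (parO_par deg modd) morph_exp.
have flat s : (0 < size s)%N -> ext_comp deg (bq_ell B) F' s = 0.
  apply: flat_transport => // b nb.
  exact: (flat_homotopy char0 modd hPhi Phi0 dF X0).
have := @differential_insert _ _ _ deg m modd Phi' hPhi' Phi0' (bq_K B) (bq_ell B)
  (@bq_K_slin _ B) (@bq_ell_mlin _ B) (bq_K_one B) (@bq_ell_deg _ B) (@bq_ellE _ B).
rewrite eF' => key.
apply: (@mulNhbar_inj _ _ (size a).-1); rewrite -(wgtE (fun a => dtau (F' a))) //.
rewrite -(wgtE (fun a => ext_comp degO (bq_ell B) Phi' (None :: map Some a))) //.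
apply: (@conv_cancel0 _ _ _ p _ _ (fam_exp p (wgt F'))) => // s.
transitivity (dtau (fam_exp p (wgt F') s)).
  rewrite fam_exp_dtau.
    by apply: eq_conv => // -[|t b] // _; rewrite /wgt dtau_mulNhbar.
  move=> b c nb; have hE : shomog (wt deg c) (fam_exp p (wgt F') c).
    by apply: shomog_fam_exp; exact: hfam_wgt.
  have hd : shomog (wt deg b) (dtau (wgt F' b)).
    by apply: shomog_dtau; exact: hfam_wgt.
  by rewrite (smulC hd hE) !(parity_wt (p := p) (D := deg)).
rewrite E'E dtau_lin_ext; [|exact: morph_slin|exact: morph_tau].
rewrite (dtau_exp_exact char0 modd hPhi Phi0 dF X0) -morph_K -G'G key.
rewrite -[RHS]addr0; congr (_ + _); rewrite -[RHS](ssum0 p _ s).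
apply: eq_ssum => b c _ _; case: b => [|t b]; rewrite /= ?smul0l //.
by rewrite flat // mulNhbar_0 smul0l sg0.
Qed.

End Homotopy.
End Transport.

(** * Multilinear extension from homogeneous arguments *)

Section Support.
Variables (k : fieldType) (V : gradedType k).
Implicit Types (x y : V).

(** A chosen finite set of degrees, which may contain degrees of vanishing
    components. *)
Definition supp x : seq int := projT1 (cid2 (hpart_sum x)).

Lemma supp_uniq x : uniq (supp x).
Proof. by rewrite /supp; case: cid2. Qed.

Lemma supp_sum x : x = \sum_(j <- supp x) hpart j x.
Proof. by rewrite /supp; case: cid2. Qed.

Lemma hpart_bigsum (I : Type) (r : seq I) j (F : I -> V) :
  hpart j (\sum_(i <- r) F i) = \sum_(i <- r) hpart j (F i).
Proof.
by elim: r => [|i r IH]; rewrite ?big_nil ?hpart0 // !big_cons hpartD IH.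
Qed.

Lemma notin_supp x j : j \notin supp x -> hpart j x = 0.
Proof.
move=> jx; rewrite [x in LHS]supp_sum hpart_bigsum big_seq big1 // => i ix.
by rewrite hpart_hpart; case: eqP => // e; rewrite e ix in jx.
Qed.

Lemma big_supp (R : zmodType) (h : int -> R) x (u : seq int) :
  uniq u -> (forall j, j \notin u -> hpart j x = 0) ->
  (forall j, hpart j x = 0 -> h j = 0) ->
  \sum_(j <- supp x) h j = \sum_(j <- u) h j.
Proof.
move=> uu hu h0.
have e (s : seq int) : \sum_(j <- s) h j = \sum_(j <- [seq j <- s | hpart j x != 0]) h j.
  rewrite big_filter [RHS]big_mkcond /=; apply: eq_bigr => j _.
  by case: eqP => // /h0.
rewrite e [RHS]e; apply: perm_big; apply: uniq_perm.
- by rewrite filter_uniq // supp_uniq.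
- by rewrite filter_uniq.
move=> j; rewrite !mem_filter; case: (boolP (hpart j x != 0)) => //= ne.
have -> : j \in u by apply: contraR ne => /hu->.
by apply: contraR ne => /notin_supp->.
Qed.

End Support.

Section MultilinearExtension.
Variables (k : fieldType) (V W : gradedType k).
Implicit Types (G : seq (int * V) -> ser W).

(** Formulas with Koszul signs make sense on homogeneous arguments; [mlext]
    extends such a formula [G] to all arguments by multilinearity. *)
Fixpoint mlext G (s : seq V) : ser W :=
  if s is x :: s' then \sum_(j <- supp x) mlext (fun l => G ((j, x) :: l)) s' else G [::].

(** What makes the extension multilinear and independent of the choice of the
    sets of degrees. *)
Definition letter_lin G : Prop :=
  (forall l1 l2 j c x y, G (l1 ++ (j, c *: x + y) :: l2)
     = c *: G (l1 ++ (j, x) :: l2) + G (l1 ++ (j, y) :: l2)) /\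
  (forall l1 l2 j x, hpart j x = 0 -> G (l1 ++ (j, x) :: l2) = 0).

Lemma letter_lin_cons G t : letter_lin G -> letter_lin (fun l => G (t :: l)).
Proof.
case=> Gl G0; split=> [l1 l2 j c x y|l1 l2 j x hx]; first exact: (Gl (t :: l1)).
exact: (G0 (t :: l1)).
Qed.

Lemma mlext_lin G1 G2 G3 c s : (forall l, G1 l = c *: G2 l + G3 l) ->
  mlext G1 s = c *: mlext G2 s + mlext G3 s.
Proof.
elim: s G1 G2 G3 => [|x s IH] G1 G2 G3 e /=; first exact: e.
rewrite scaler_sumr -big_split; apply: eq_bigr => j _ /=.
by apply: IH => l; exact: e.
Qed.

Lemma mlext_eq0 G s : (forall l, G l = 0) -> mlext G s = 0.
Proof.
move=> G0; have := @mlext_lin G G G (-1) s; rewrite scaleN1r addNr; apply => l.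
by rewrite G0 scaler0 addr0.
Qed.

Lemma eq_mlext G G' s : G =1 G' -> mlext G s = mlext G' s.
Proof. by move=> /funext->. Qed.

Lemma mlext_sg (e : bool) G s : mlext (fun l => sg e (G l)) s = sg e (mlext G s).
Proof.
rewrite (@mlext_lin _ G (fun=> 0) ((-1) ^+ e)) => [|l]; last by rewrite addr0 sgE.
by rewrite (@mlext_eq0 (fun=> 0)) // addr0 sgE.
Qed.

Lemma mlext_supp G x s u : letter_lin G -> uniq u ->
  (forall j, j \notin u -> hpart j x = 0) ->
  mlext G (x :: s) = \sum_(j <- u) mlext (fun l => G ((j, x) :: l)) s.
Proof.
move=> [_ G0] uu hu; apply: big_supp => // j hx.
by apply: mlext_eq0 => l; exact: (G0 [::]).
Qed.

Lemma mlext_homog1 G j x s : letter_lin G -> homog j x ->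
  mlext G (x :: s) = mlext (fun l => G ((j, x) :: l)) s.
Proof.
move=> Gl hx; rewrite (mlext_supp _ (u := [:: j])) ?big_seq1 // => i.
by rewrite inE => /(homog_neq hx).
Qed.

Lemma mlext_mlin G : letter_lin G -> mlin (mlext G).
Proof.
move=> Gl s1; elim: s1 G Gl => [|z s1 IH] G Gl s2 c x y; last first.
  rewrite /= scaler_sumr -big_split; apply: eq_bigr => j _ /=.
  by apply: IH; exact: letter_lin_cons.
pose u := undup (supp (c *: x + y) ++ supp x ++ supp y).
have hu z : {subset supp z <= u} -> forall j, j \notin u -> hpart j z = 0.
  by move=> sub j ju; apply: notin_supp; apply: contra ju; exact: sub.
rewrite !cat0s !(mlext_supp _ (u := u)) ?undup_uniq //;
  try (by apply: hu => j jz; rewrite mem_undup !mem_cat jz ?orbT).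
rewrite scaler_sumr -big_split; apply: eq_bigr => j _ /=.
by apply: mlext_lin => l; case: Gl => Gl _; exact: (Gl [::]).
Qed.

Lemma mlext_homog (T : Type) (deg : T -> int) (ev : T -> V) G b : letter_lin G ->
  (forall t, homog (deg t) (ev t)) ->
  mlext G (map ev b) = G [seq (deg t, ev t) | t <- b].
Proof.
elim: b G => [|t b IH] G Gl hev //.
by rewrite map_cons (mlext_homog1 _ Gl (hev t)) IH //; exact: letter_lin_cons.
Qed.

Lemma mlext_gsym G : letter_lin G ->
  (forall l1 l2 x y p q, homog p x -> homog q y -> G (l1 ++ [:: (p, x), (q, y) & l2])
     = sg (parity p && parity q) (G (l1 ++ [:: (q, y), (p, x) & l2]))) ->
  gsym (mlext G).
Proof.
move=> Gl Gs s1; elim: s1 G Gl Gs => [|z s1 IH] G Gl Gs s2 x y p q hx hy.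
  rewrite !cat0s (mlext_homog1 _ Gl hx) (mlext_homog1 _ (letter_lin_cons _ Gl) hy).
  rewrite (mlext_homog1 _ Gl hy) (mlext_homog1 _ (letter_lin_cons _ Gl) hx).
  by rewrite -mlext_sg; apply: eq_mlext => l; exact: (Gs [::]).
rewrite !cat_cons /= sg_sum; apply: eq_bigr => j _; apply: IH => //.
  exact: letter_lin_cons.
by move=> l1 l2 x' y' p' q' hx' hy'; rewrite -!cat_cons Gs.
Qed.

End MultilinearExtension.

Lemma mlin_homog0 (k : fieldType) (V : gradedType k) (S : lmodType k) (g : seq V -> S) n :
  mlin g ->
  (forall l : seq (int * V), size l = n -> g [seq hpart t.1 t.2 | t <- l] = 0) ->
  forall s, size s = n -> g s = 0.
Proof.
move=> gl g0 s.
have H (l : seq (int * V)) : (size l + size s)%N = n ->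
    g ([seq hpart t.1 t.2 | t <- l] ++ s) = 0.
  elim: s l => [|x s IH] l; first by rewrite addn0 cats0; exact: g0.
  move=> sz; rewrite [x]supp_sum (mlin_sum gl) big1 // => j _.
  have := IH (rcons l (j, x)); rewrite map_rcons cat_rcons; apply.
  by rewrite size_rcons -sz /= addnS.
exact: (H [::]).
Qed.

Lemma mlin_homog_eq (k : fieldType) (V : gradedType k) (S : lmodType k) (g g' : seq V -> S) n :
  mlin g -> mlin g' ->
  (forall l : seq (int * V), size l = n ->
     g [seq hpart t.1 t.2 | t <- l] = g' [seq hpart t.1 t.2 | t <- l]) ->
  forall s, size s = n -> g s = g' s.
Proof.
move=> gl gl' e s sz; apply/eqP; rewrite -subr_eq0; apply/eqP.
apply: (@mlin_homog0 _ _ _ (fun s => g s - g' s) n) => // [s1 s2 c x y|l sl].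
  by rewrite gl gl' scalerBr opprD addrACA.
by rewrite e // subrr.
Qed.

(** * Evaluation at a time *)

(** A relation between series and their values, compatible with all the
    operations from which composites and exponentials are built.  It serves
    for independence of [tau], for boundedness of the degree in [tau], and for
    evaluation at times 0 and 1, where [N] bounds the degree in [tau]; the
    bounds for products add up. *)
Record tau_rel (k : fieldType) (R : nat -> forall W : gradedType k, ser W -> ser W -> Prop)
    : Prop := TauRel {
  tr_0 : forall N W, R N W 0 0;
  tr_D : forall N W x y x' y', R N W x x' -> R N W y y' -> R N W (x + y) (x' + y');
  tr_N : forall N W x x', R N W x x' -> R N W (- x) (- x');
  tr_mono : forall M N W x x', (M <= N)%N -> R M W x x' -> R N W x x';
  tr_free : forall W x, tau_free x -> R 1%N W x x;
  tr_lin : forall M N (V W : gradedType k) (F F' : V -> ser W) x x', slin F ->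
    (forall v, R M W (F v) (F' v)) -> R N V x x' ->
    R (N + M)%N W (lin_ext F x) (lin_ext F' x');
  tr_lmul : forall N (C : gcAlgType k) (v : C) (y y' : ser C), R N C y y' ->
    R N C (fun a b => v * y a b) (fun a b => v * y' a b)
}.

Section TauRelTheory.
Variables (k : fieldType) (R : nat -> forall W : gradedType k, ser W -> ser W -> Prop).
Hypothesis HR : tau_rel R.
Implicit Types (V W : gradedType k).
Local Notation Rel N x y := (@R N _ x y).

Lemma tr_mul_ext (V W : gradedType k) (g : seq V -> ser W) (T : Type) (w : T -> nat) (F F' : T -> ser V) l :
  mlin g -> (forall s, size s = size l -> tau_free (g s)) ->
  (forall t, Rel (w t) (F t) (F' t)) ->
  Rel (sumn (map w l) + 1)%N (mul_ext g (map F l)) (mul_ext g (map F' l)).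
Proof.
move=> gl gf hF; elim: l g gl gf => [|t l IH] g gl gf.
  by apply: (tr_free HR); exact: gf.
rewrite /= !mul_ext_cons -addnA.
apply: (tr_lin HR) => [|v|]; last exact: hF.
  by apply: mul_ext_slinl => s; exact: mlin_slin.
by apply: IH; [exact: mlin_cons | move=> s sl; apply: gf; rewrite /= sl].
Qed.

Lemma tr_ser_prod (C : gcAlgType k) (T : Type) (w : T -> nat) (F F' : T -> ser C) l :
  (forall t, Rel (w t) (F t) (F' t)) ->
  Rel (sumn (map w l) + 1)%N (ser_prod (map F l)) (ser_prod (map F' l)).
Proof.
move=> hF; elim: l => [|t l IH].
  apply: (tr_free HR) => a b.
  by rewrite ser_prod_nil /cst andbF.
rewrite /= !ser_prod_cons -addnA /smul.
apply: (tr_lin HR) => [|v|]; [exact: lmul_slin|exact: tr_lmul|exact: hF].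
Qed.

Lemma tr_mulNhbar (V : gradedType k) m N (x x' : ser V) : Rel N x x' -> Rel (N + 1)%N (mulNhbar m x) (mulNhbar m x').
Proof.
move=> h; rewrite (mulNhbarE m x) (mulNhbarE m x'); apply: (tr_lin HR) => // [|v].
  exact: mulNhbar_slin.
by apply: (tr_free HR) => a b; rewrite /mulNhbar /cst andbF; case: ifP; rewrite ?scaler0.
Qed.

Section Words.
Variables (T : Type) (p : T -> bool).

Lemma tr_psum (W : gradedType k) N (G G' : seq (seq T) -> ser W) s :
  (forall bl, all (fun b => 0 < size b)%N bl -> size (flatten bl) = size s ->
     Rel N (G bl) (G' bl)) ->
  Rel N (psum p G s) (psum p G' s).
Proof.
move=> h; apply: (@psum_rel T p _ _ (fun x y : ser W => Rel N x y)).
- exact: (tr_0 HR).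
- by move=> *; apply: (tr_D HR).
- by move=> *; apply: (tr_N HR).
by move=> bl nbl sz _; exact: h.
Qed.

Lemma sumn_size (bl : seq (seq T)) N :
  sumn [seq (N * size b)%N | b <- bl] = (N * size (flatten bl))%N.
Proof.
elim: bl => [|b bl IH]; first by rewrite muln0.
by rewrite /= IH size_cat mulnDr.
Qed.

Variables (V W : gradedType k) (phi phi' : seq T -> ser V).

(** The degree in [tau] of a family may grow with the arity, so it is only
    bounded on blocks of bounded size. *)
Definition tr_fam n N : Prop :=
  forall b, (0 < size b <= n)%N -> Rel N (phi b) (phi' b).

Let cut n (f : seq T -> ser V) b := if (0 < size b <= n)%N then f b else 0.

Lemma tr_cut n N b : tr_fam n N -> Rel (N * size b)%N (cut n phi b) (cut n phi' b).
Proof.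
move=> h; rewrite /cut; case: ifP => [hb|_]; last exact: (tr_0 HR).
apply: (tr_mono HR) (h _ hb).
by case/andP: hb => hb _; rewrite -[X in (X <= _)%N]muln1 leq_mul2l hb orbT.
Qed.

Lemma map_cut (f : seq T -> ser V) bl n : all (fun b => 0 < size b)%N bl ->
  (size (flatten bl) <= n)%N -> map f bl = map (cut n f) bl.
Proof.
elim: bl => //= b bl IH /andP[nb nbl]; rewrite size_cat => le.
rewrite IH //; last by apply: leq_trans le; rewrite leq_addl.
by rewrite /cut nb (leq_trans (leq_addr _ _) le).
Qed.

Lemma tr_ext_comp (g : seq V -> ser W) n N s :
  mlin g -> (forall s, (0 < size s)%N -> tau_free (g s)) -> tr_fam n N ->
  (0 < size s <= n)%N ->
  Rel (N * size s + 1)%N (psum p (fun bl => mul_ext g (map phi bl)) s)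
                     (psum p (fun bl => mul_ext g (map phi' bl)) s).
Proof.
move=> gl gf h /andP[ns le]; apply: tr_psum => bl nbl sz.
have nb : (0 < size bl)%N by case: bl sz {nbl} => // e; rewrite -e in ns.
rewrite (@map_cut phi _ n) ?(@map_cut phi' _ n) ?sz // -sz -sumn_size.
apply: tr_mul_ext => // [s' ss|b]; first by apply: gf; rewrite ss.
exact: tr_cut.
Qed.

End Words.

Lemma tr_fam_exp (C : gcAlgType k) (T : Type) (p : T -> bool) (phi phi' : seq T -> ser C) n N s :
  tr_fam phi phi' n N -> (size s <= n)%N ->
  Rel (N * size s + 1)%N (fam_exp p phi s) (fam_exp p phi' s).
Proof.
move=> h le; apply: tr_psum => bl nbl sz.
rewrite (@map_cut _ _ phi _ n) ?(@map_cut _ _ phi' _ n) ?sz // -sz -sumn_size.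
by apply: tr_ser_prod => b; exact: tr_cut.
Qed.

Lemma tr_mlext (V W : gradedType k) (G G' : seq (int * V) -> ser W) N s :
  (forall l, size l = size s -> Rel N (G l) (G' l)) ->
  Rel N (mlext G s) (mlext G' s).
Proof.
elim: s G G' => [|x s IH] G G' h /=; first exact: h.
elim/big_rec2: _ => [|j y y' _ hy]; first exact: (tr_0 HR).
apply: (tr_D HR) => //; apply: IH => l sl; apply: h.
by rewrite /= sl.
Qed.

End TauRelTheory.

Section Instances.
Variable k : fieldType.

Definition rel_free (N : nat) (W : gradedType k) (x y : ser W) : Prop := tau_free x.

Definition rel_bound (N : nat) (W : gradedType k) (x y : ser W) : Prop :=
  forall a b, (N <= b)%N -> x a b = 0.

Definition rel_at0 (N : nat) (W : gradedType k) (x y : ser W) : Prop :=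
  forall a, y a 0%N = x a 0%N.

(** Evaluation at time 1 is the sum of the coefficients, which requires a bound
    on the degree. *)
Definition rel_at1 (N : nat) (W : gradedType k) (x y : ser W) : Prop :=
  rel_bound N x x /\ forall a, y a 0%N = \sum_(b < N) x a b.

Lemma lin_ext_b0 (V W : gradedType k) (F : V -> ser W) x a :
  lin_ext F x a 0%N = \sum_(i < a.+1) F (x i 0%N) (a - i)%N 0%N.
Proof. by rewrite /lin_ext; apply: eq_bigr => i _; rewrite big_ord1. Qed.

Lemma rel_freeP : tau_rel rel_free.
Proof.
split=> // [N W x y x' y' hx hy a b|N W x x' hx a b|M N V W F F' x x' Fl hF hx a b|N C v y y' hy a b].
- by rewrite serDE hx hy addr0.
- by rewrite serNE hx oppr0.
- rewrite /lin_ext big1 // => i _; rewrite big1 // => j _.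
  case: (val j) => [|l]; last by rewrite hx slin0.
  by rewrite subn0 hF.
- by rewrite hy mulr0.
Qed.

Lemma rel_boundP : tau_rel rel_bound.
Proof.
split=> // [N W x y x' y' hx hy a b le|N W x x' hx a b le|M N W x x' le hx a b le'|W x hx a [|b] //|M N V W F F' x x' Fl hF hx a b le|N C v y y' hy a b le].
- by rewrite serDE hx ?hy ?addr0.
- by rewrite serNE hx ?oppr0.
- by apply: hx; exact: leq_trans le'.
- rewrite /lin_ext big1 // => i _; rewrite big1 // => j _.
  case: (leqP N j) => jN; first by rewrite hx ?slin0.
  by rewrite hF //; lia.
- by rewrite hy ?mulr0.
Qed.

Lemma rel_at0P : tau_rel rel_at0.
Proof.
split=> // [N W x y x' y' hx hy a|N W x x' hx a|M N V W F F' x x' Fl hF hx a|N C v y y' hy a].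
- by rewrite !serDE hx hy.
- by rewrite !serNE hx.
- by rewrite !lin_ext_b0; apply: eq_bigr => i _; rewrite hx hF.
- by rewrite hy.
Qed.

Lemma sum_extend (R : zmodType) (F : nat -> R) M N : (M <= N)%N ->
  (forall b, (M <= b)%N -> F b = 0) -> \sum_(b < N) F b = \sum_(b < M) F b.
Proof.
move=> le h; rewrite -!(big_mkord xpredT F) (@big_cat_nat _ _ _ M) //=.
have -> : \sum_(M <= b < N) F b = 0 by rewrite big_nat big1 // => b /andP[/h].
by rewrite addr0.
Qed.

(** The essential case is a product: the product of the sums of coefficients is
    the sum of the coefficients of the product. *)
Lemma rel_at1P : tau_rel rel_at1.
Proof.
split.
- by move=> N W; split=> // a; rewrite big1.
- move=> N W x y x' y' [hx ex] [hy ey]; split.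
    exact: (tr_D rel_boundP hx hy).
  move=> a; rewrite serDE ex ey -big_split; by apply: eq_bigr => b _.
- move=> N W x x' [hx ex]; split; first exact: (tr_N rel_boundP hx).
  by move=> a; rewrite serNE ex -sumrN.
- move=> M N W x x' le [hx ex]; split; first exact: (tr_mono rel_boundP le hx).
  by move=> a; rewrite ex (sum_extend le (fun b => hx a b)).
- move=> W x hx; split; first exact: (tr_free rel_boundP hx).
  by move=> a; rewrite big_ord1.
- move=> M N V W F F' x x' Fl hF [hx ex]; split.
    by apply: (tr_lin rel_boundP) => // v; case: (hF v).
  move=> a; rewrite lin_ext_b0 /lin_ext exchange_big /=; apply: eq_bigr => i _.
  rewrite (hF _).2 ex.
  rewrite (eq_bigr (fun m : 'I_M => \sum_(j < N) F (x i j) (a - i)%N m)); last first.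
    move=> m _; have e := slin_sum (index_enum 'I_N) xpredT (fun j : 'I_N => x i j) Fl.
    by have := congr1 (fun y : ser W => y (a - i)%N m) e; rewrite ser_sumE; apply.
  rewrite exchange_big /=.
  have key (G : nat -> nat -> W) : (forall j m, (N <= j)%N || (M <= m)%N -> G j m = 0) ->
      \sum_(j < N) \sum_(m < M) G j m
      = \sum_(b < N + M) \sum_(j < b.+1) G j (b - j)%N.
    move=> G0; case eB: (N + M)%N => [|B].
      by move/eqP: eB; rewrite addn_eq0 => /andP[/eqP-> _]; rewrite !big_ord0.
    rewrite (tri_assoc (fun j m _ => G j m)).
    rewrite (@sum_extend _ (fun j => \sum_(m < (B - j).+1) G j m) N) //.
    - apply: eq_bigr => j _; rewrite [RHS](@sum_extend _ (G j) M) // => [|m le].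
        by have jN : (j < N)%N := ltn_ord j; lia.
      by apply: G0; rewrite le orbT.
    - by lia.
    - by move=> j le; rewrite big1 // => m _; apply: G0; rewrite le.
  rewrite (key (fun j m => F (x i j) (a - i)%N m)) // => j m /orP[le|le].
    by rewrite hx // slin0.
  by case: (hF (x i j)) => hb _; exact: hb.
- move=> N C v y y' [hy ey]; split; first exact: (tr_lmul rel_boundP v hy).
  by move=> a; rewrite ey mulr_sumr.
Qed.
End Instances.

(** * Composition of multilinear families *)

(** The letters of the composite are prefixed by [pre], empty or the marker,
    and embedded in the letters of [Phi] by [iota]; this treats a composite and
    its first-order variation together. *)
Section Extend.
Variables (k : fieldType) (V1 V W : gradedType k) (psi : seq V -> ser W).
Hypothesis psiS : sym_fam 0 psi.
Variables (X : Type) (D : X -> int) (iota : int * V1 -> X) (pre : seq X).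
Variable Phi : seq X -> ser V.
Hypothesis Diota : forall t, D (iota t) = t.1.
Hypothesis Phi_lin : forall b1 b2 j c x y,
  Phi (b1 ++ iota (j, c *: x + y) :: b2)
  = c *: Phi (b1 ++ iota (j, x) :: b2) + Phi (b1 ++ iota (j, y) :: b2).
Hypothesis Phi_zero : forall b1 b2 j x, hpart j x = 0 -> Phi (b1 ++ iota (j, x) :: b2) = 0.
Hypothesis Phi_sym : forall b1 b2 x y p q, homog p x -> homog q y ->
  Phi (b1 ++ [:: iota (p, x), iota (q, y) & b2])
  = sg (parity p && parity q) (Phi (b1 ++ [:: iota (q, y), iota (p, x) & b2])).
Hypothesis Phi_deg : forall b, shomog (wt D b) (Phi b).

Let psil : mlin psi. Proof. exact: sym_fam_mlin psiS. Qed.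
Let mpsil := mul_ext_mlin psil.

Definition pre_comp (l : seq (int * V1)) : ser W := ext_comp D psi Phi (pre ++ map iota l).

Definition extend : seq V1 -> ser W := mlext pre_comp.

Lemma pre_comp_lin : letter_lin pre_comp.
Proof.
split=> [l1 l2 j c x y|l1 l2 j x hx]; rewrite /pre_comp !map_cat /= !catA.
  apply: (psum_subst (Lop := fun g : bool -> ser W => c *: g true + g false) _ _ _
     (y := fun b => iota (j, if b then x else y))) => [g h|b|bl1 bl2 b1 b2].
  - by rewrite scalerDr addrACA.
  - by rewrite /par !Diota.
  - by rewrite !map_cat /= Phi_lin mpsil.
apply: (psum_subst (Lop := fun g : unit -> ser W => 0) _ _ _
     (y := fun b => iota (j, x))) => [g h|b|bl1 bl2 b1 b2] //.
- by rewrite addr0.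
- by rewrite map_cat /= Phi_zero // (mlin0 mpsil).
Qed.

Lemma pre_comp_sym l1 l2 x y p q : homog p x -> homog q y ->
  pre_comp (l1 ++ [:: (p, x), (q, y) & l2])
  = sg (parity p && parity q) (pre_comp (l1 ++ [:: (q, y), (p, x) & l2])).
Proof.
move=> hx hy; rewrite /pre_comp !map_cat /= !catA /ext_comp.
have pD t : par D (iota t) = parity t.1 by rewrite /par Diota.
rewrite psum_swap ?pD // => [bl1 bl2 b1 b2|bl1 bl2 b c].
  by rewrite !map_cat /= (Phi_sym _ _ hx hy) (mlinsg mpsil).
rewrite !map_cat /= (mul_ext_swap _ _ psil (sym_fam_gsym psiS) (Phi_deg b) (Phi_deg c)).
by rewrite !(parity_wt (p := par D) (D := D)).
Qed.

Lemma wt_iota l : wt D (map iota l) = wt (fun t => t.1) l.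
Proof.
elim: l => [|t l IH]; first by rewrite /wt !big_nil.
by rewrite /= !wt_cons IH Diota.
Qed.

Lemma extend_mlin : mlin extend. Proof. exact: mlext_mlin pre_comp_lin. Qed.

Lemma extend_homog (T : Type) (deg : T -> int) (ev : T -> V1) b :
  (forall t, homog (deg t) (ev t)) ->
  extend (map ev b) = pre_comp [seq (deg t, ev t) | t <- b].
Proof. by apply: mlext_homog; exact: pre_comp_lin. Qed.

Lemma extend_sym : sym_fam (wt D pre) extend.
Proof.
apply: sym_fam_of; [exact: extend_mlin| |move=> l nl].
  by apply: mlext_gsym; [exact: pre_comp_lin | exact: pre_comp_sym].
rewrite (extend_homog _ (fun t => homog_hpart t.1 t.2)) /pre_comp.
have hPhi : hfam D Phi by move=> b _; exact: Phi_deg.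
have := @ext_comp_deg _ _ D _ _ 0 psi Phi (pre ++ map iota [seq (t.1, hpart t.1 t.2) | t <- l]) psiS hPhi.
rewrite size_cat !size_map (leq_trans nl (leq_addl _ _)) addr0 wt_cat wt_iota.
move=> /(_ isT); rewrite addrC; congr (shomog (_ + _) _).
by rewrite /wt big_map.
Qed.

End Extend.

Section EvalFamilies.
Variables (k : fieldType) (V1 V0 V : gradedType k) (J : V1 -> V0).
Hypotheses (Jlin : linear J) (Jdeg : forall i x, homog i x -> homog i (J x)).
Implicit Types (phi lam : seq V0 -> ser V).

(** The letter (j, x) stands for the component of degree [j] of [x], transported
    by [J]. *)
Definition ev (t : int * V1) : V0 := J (hpart t.1 t.2).

Lemma homog_ev t : homog t.1 (ev t). Proof. by apply: Jdeg; exact: homog_hpart. Qed.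

(** The arity zero part of a family is unconstrained; it is set to zero. *)
Definition nz (T : Type) (R : zmodType) (F : seq T -> R) (b : seq T) : R :=
  if b is [::] then 0 else F b.

Lemma nzE (T : Type) (R : zmodType) (F : seq T -> R) b : (0 < size b)%N -> nz F b = F b.
Proof. by case: b. Qed.

Definition evf phi : seq (int * V1) -> ser V := nz (fun b => phi (map ev b)).

Lemma evf_mid phi b1 t b2 : evf phi (b1 ++ t :: b2) = phi (map ev b1 ++ ev t :: map ev b2).
Proof. by rewrite /evf nzE ?map_cat // size_cat addnS. Qed.

Lemma ev_lin j c x y : ev (j, c *: x + y) = c *: ev (j, x) + ev (j, y).
Proof. by rewrite /ev /= hpart_linear Jlin. Qed.

Lemma ev_zero j x : hpart j x = 0 -> ev (j, x) = 0.
Proof.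
move=> hx; rewrite /ev /= hx; have := Jlin (-1) 0 0.
by rewrite scaler0 addr0 scaleN1r addNr.
Qed.

Lemma evf_lin phi b1 b2 j c x y : mlin phi ->
  evf phi (b1 ++ (j, c *: x + y) :: b2)
  = c *: evf phi (b1 ++ (j, x) :: b2) + evf phi (b1 ++ (j, y) :: b2).
Proof. by move=> pl; rewrite !evf_mid ev_lin pl. Qed.

Lemma evf_zero phi b1 b2 j x : mlin phi -> hpart j x = 0 -> evf phi (b1 ++ (j, x) :: b2) = 0.
Proof. by move=> pl hx; rewrite evf_mid ev_zero // mlin0. Qed.

Lemma evf_sym phi b1 b2 x y p q : gsym phi -> homog p x -> homog q y ->
  evf phi (b1 ++ [:: (p, x), (q, y) & b2])
  = sg (parity p && parity q) (evf phi (b1 ++ [:: (q, y), (p, x) & b2])).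
Proof.
move=> ps hx hy; rewrite !evf_mid /=.
by rewrite (ps _ _ _ _ _ _ (homog_ev (p, x)) (homog_ev (q, y))).
Qed.

Lemma evf_deg m phi b : sym_fam m phi -> (0 < size b)%N ->
  shomog (wt (fun t => t.1) b + m) (evf phi b).
Proof. by move=> ps nb; rewrite /evf nzE //; apply: sym_fam_deg => // t; exact: homog_ev. Qed.

Lemma evf_hpart phi b : evf phi [seq (t.1, hpart t.1 t.2) | t <- b] = evf phi b.
Proof.
case: b => // t b; rewrite /evf /nz /= /ev /= hpart_hpart eqxx; congr (phi (_ :: _)).
by rewrite -map_comp; apply: eq_map => u; rewrite /= hpart_hpart eqxx.
Qed.

(** The value of [marked] on a word with a given stretch of unmarked letters is
    a value of [F], of [G] or of zero with that stretch as consecutive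
    arguments: this reduces linearity and symmetry of [marked] to those of [F]
    and [G]. *)
Lemma marked_mid (F G : seq (int * V1) -> ser V) l1 l2 : exists (H : seq (int * V1) -> ser V) m1 m2,
  (H = F \/ H = G \/ H = fun=> 0) /\
  forall t w, marked F G (l1 ++ Some t :: map Some w ++ l2) = H (m1 ++ t :: w ++ m2).
Proof.
have zz : exists (H : seq (int * V1) -> ser V) m1 m2,
    (H = F \/ H = G \/ H = fun=> 0) /\
    forall (t : int * V1) w, 0 = H (m1 ++ t :: w ++ m2).
  by exists (fun=> 0), [::], [::]; split; [right; right|].
have cat_pmap l (t : int * V1) w : pmap id (l ++ Some t :: map Some w ++ l2)
    = pmap id l ++ t :: w ++ pmap id l2.
  by elim: l => [|[u|] l IH] /=; rewrite ?IH // pmap_cat pmap_id_Some.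
have all_cat' l (t : int * V1) w : all isSome (l ++ Some t :: map Some w ++ l2)
    = all isSome l && all isSome l2.
  by rewrite all_cat /= all_cat all_isSome_map.
rewrite /marked; case: l1 => [|[u|] l1] /=.
- case h: (all isSome l2); last first.
    have [H [m1 [m2 [HH e]]]] := zz; exists H, m1, m2; split=> // t w.
    by rewrite all_cat h andbF; exact: e.
  exists F, [::], (pmap id l2); split; first by left.
  by move=> t w; rewrite all_cat h all_isSome_map /= pmap_cat pmap_id_Some.
- case h: (all isSome l1 && all isSome l2).
    exists F, (u :: pmap id l1), (pmap id l2); split; first by left.
    by move=> t w; rewrite all_cat' h cat_pmap.
  have [H [m1 [m2 [HH e]]]] := zz; exists H, m1, m2; split=> // t w.
  by rewrite all_cat' h; exact: e.
- case h: (all isSome l1 && all isSome l2).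
    exists G, (pmap id l1), (pmap id l2); split; first by right; left.
    by move=> t w; rewrite all_cat' h size_cat addnS /= cat_pmap.
  have [H [m1 [m2 [HH e]]]] := zz; exists H, m1, m2; split=> // t w.
  by rewrite all_cat' h; exact: e.
Qed.

Section Composite.
Variables (W : gradedType k) (psi : seq V -> ser W).
Hypothesis psiS : sym_fam 0 psi.

(** The composite of [psi], [phi] and the map [J] in each argument.  Unlike the
    sum over partitions with Koszul signs, it is defined and multilinear on all
    arguments. *)
Definition composite phi : seq V1 -> ser W :=
  extend psi (fun t => t.1) id [::] (evf phi).

(** The derivative of the composite in the direction [lam]: one block is filled
    by [lam], the others by [phi]. *)
Definition composite_at phi lam : seq V1 -> ser W :=
  extend psi (oapp (fun t => t.1) (-1)) Some [:: None] (marked (evf phi) (evf lam)).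

Variable phi : seq V0 -> ser V.
Hypothesis phiS : sym_fam 0 phi.
Let phil : mlin phi. Proof. exact: sym_fam_mlin phiS. Qed.
Let phis : gsym phi. Proof. exact: sym_fam_gsym phiS. Qed.

Lemma hfam_evf : hfam (fun t => t.1) (evf phi).
Proof. by move=> b nb; rewrite -[wt _ _]addr0; exact: evf_deg. Qed.

Lemma shomog_evf b : shomog (wt (fun t => t.1) b) (evf phi b).
Proof. by case: b => [|t b]; [exact: shomog0 | exact: hfam_evf]. Qed.

Lemma composite_letter_lin : letter_lin (pre_comp psi (fun t => t.1) id [::] (evf phi)).
Proof.
apply: pre_comp_lin => // [b1 b2 j c x y|b1 b2 j x hx]; first exact: evf_lin.
exact: evf_zero.
Qed.

Lemma composite_sym : sym_fam 0 (composite phi).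
Proof.
have e0 : wt (fun t : int * V1 => t.1) [::] = 0 by rewrite /wt big_nil.
rewrite -e0.
apply: extend_sym => // [b1 b2 j c x y|b1 b2 j x hx|b1 b2 x y p q hx hy|b].
- exact: evf_lin.
- exact: evf_zero.
- exact: evf_sym.
- exact: shomog_evf.
Qed.

Lemma composite_letters s : composite phi [seq hpart t.1 t.2 | t <- s]
  = ext_comp (fun t => t.1) psi (evf phi) s.
Proof.
rewrite /composite /extend (mlext_homog (deg := fun t => t.1)); [|exact: composite_letter_lin|move=> t; exact: homog_hpart].
rewrite /pre_comp /= map_id /ext_comp (psum_map (p := par (fun t : int * V1 => t.1))) //.
apply: eq_psum => bl _ _ _; rewrite -map_comp; congr mul_ext.
by apply: eq_map => b /=; rewrite evf_hpart.
Qed.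

Variable lam : seq V0 -> ser V.
Hypothesis lamS : sym_fam (-1) lam.
Let laml : mlin lam. Proof. exact: sym_fam_mlin lamS. Qed.
Let lams : gsym lam. Proof. exact: sym_fam_gsym lamS. Qed.
Local Notation degO := (oapp (fun t : int * V1 => t.1) (-1)).
Local Notation Phi := (marked (evf phi) (evf lam)).

Lemma shomog_Phi b : shomog (wt degO b) (Phi b).
Proof.
case: b => [|t b]; first exact: shomog0.
apply: shomog_marked => // [c nc|c nc]; first exact: hfam_evf.
exact: evf_deg.
Qed.

Lemma composite_at_letter_lin : letter_lin (pre_comp psi degO Some [:: None] Phi).
Proof.
apply: pre_comp_lin => // [b1 b2 j c x y|b1 b2 j x hx].
  have [H [m1 [m2 [HH e]]]] := marked_mid (evf phi) (evf lam) b1 b2; rewrite !(e _ [::]).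
  case: HH => [->|[->|->]]; [exact: evf_lin|exact: evf_lin|by rewrite scaler0 addr0].
have [H [m1 [m2 [HH e]]]] := marked_mid (evf phi) (evf lam) b1 b2; rewrite !(e _ [::]).
by case: HH => [->|[->|->]] //; apply: evf_zero.
Qed.

Lemma composite_at_sym : sym_fam (-1) (composite_at phi lam).
Proof.
have -> : (-1 : int) = wt degO [:: None] by rewrite /wt big_seq1.
apply: extend_sym => // [b1 b2 j c x y|b1 b2 j x hx|b1 b2 x y p q hx hy|b].
- have [H [m1 [m2 [HH e]]]] := marked_mid (evf phi) (evf lam) b1 b2; rewrite !(e _ [::]).
  by case: HH => [->|[->|->]]; [exact: evf_lin|exact: evf_lin|rewrite scaler0 addr0].
- have [H [m1 [m2 [HH e]]]] := marked_mid (evf phi) (evf lam) b1 b2; rewrite !(e _ [::]).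
  by case: HH => [->|[->|->]] //; apply: evf_zero.
- have [H [m1 [m2 [HH e]]]] := marked_mid (evf phi) (evf lam) b1 b2.
  rewrite !(e _ [:: _]).
  by case: HH => [->|[->|->]]; [exact: evf_sym|exact: evf_sym|rewrite sg0].
- exact: shomog_Phi.
Qed.

Lemma composite_at_letters s : composite_at phi lam [seq hpart t.1 t.2 | t <- s]
  = ext_comp degO psi Phi (None :: map Some s).
Proof.
rewrite /composite_at /extend (mlext_homog (deg := fun t => t.1)); [|exact: composite_at_letter_lin|move=> t; exact: homog_hpart].
rewrite /pre_comp cat1s; pose r (t : option (int * V1)) :=
  if t is Some t then Some (t.1, hpart t.1 t.2) else None.
have -> : None :: map Some [seq (t.1, hpart t.1 t.2) | t <- s] = map r (None :: map Some s).
  by rewrite /= -!map_comp.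
rewrite /ext_comp (psum_map (p := par degO)) => [|[]//].
apply: eq_psum => bl _ _ _; rewrite -map_comp; congr mul_ext; apply: eq_map => b /=.
have allr l : all isSome (map r l) = all isSome l by elim: l => [|[t|] l IH] //=.
have pmapr l : pmap id (map r l) = [seq (t.1, hpart t.1 t.2) | t <- pmap id l].
  by elim: l => [|[t|] l IH] //=; rewrite IH.
rewrite /marked; case: b => [|[t|] b] //=; rewrite !allr pmapr.
  by case: ifP => // _; exact: (evf_hpart phi (t :: pmap id b)).
by rewrite size_map; case: ifP => // _; rewrite evf_hpart.
Qed.

End Composite.
End EvalFamilies.

(** * Units *)

Lemma mul_ext_rcons_cst (k : fieldType) (V W : gradedType k) (g : seq V -> ser W) l v :
  mlin g -> mul_ext g (rcons l (cst v)) = mul_ext (fun t => g (rcons t v)) l.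
Proof.
elim: l g => [|x l IH] g gl; first by rewrite /= mul_ext_consts.
rewrite rcons_cons !mul_ext_cons; apply: eq_lin_ext => i j.
by rewrite IH //; exact: mlin_cons.
Qed.

Lemma mul_ext_fun0 (k : fieldType) (V W : gradedType k) (l : seq (ser V)) :
  mul_ext (fun=> 0 : ser W) l = 0.
Proof.
elim: l => // x l IH; rewrite mul_ext_cons (_ : (fun v => _) = fun=> 0).
  exact: lin_ext_zero.
by apply: funext.
Qed.

(** The largest letter is the unit: either its block has other letters and
    [phi] vanishes, or [psi] gets the unit as its last argument. *)
Lemma ext_comp_unit (k : fieldType) (V W : gradedType k) (T : Type) (deg : T -> int)
    (psi : seq V -> ser W) (one : V) (phi : seq T -> ser V) (u : T) s :
  mlin psi -> (forall l, (0 < size l)%N -> psi (rcons l one) = 0) ->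
  phi [:: u] = cst one -> (forall b, (0 < size b)%N -> phi (rcons b u) = 0) ->
  (0 < size s)%N -> ext_comp deg psi phi (rcons s u) = 0.
Proof.
move=> psil psi1 phi1 phi0 ns; rewrite /ext_comp psum_rcons.
rewrite -[RHS](ssum0 (par deg) _ s); apply: eq_ssum => a b sz _.
rewrite -[RHS](psum_zero (par deg) _ a); apply: eq_psum => bl nbl szbl _.
rewrite map_rcons; case: (posnP (size b)) => [/size0nil eb|nb]; last first.
  by rewrite phi0 // -cats1; exact: (mlin0 (mul_ext_mlin psil)).
rewrite eb phi1 mul_ext_rcons_cst // -[RHS](mul_ext_fun0 W (map phi bl)).
apply: mul_ext_eq => t; rewrite size_map => st; apply: psi1.
rewrite st; case: (bl) szbl => //= e.
by rewrite -sz eb addn0 -e in ns.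
Qed.

Lemma slin_mlin_sum (k : fieldType) (V W : gradedType k) (f g : V -> ser W) :
  slin f -> slin g -> (forall j v, f (hpart j v) = g (hpart j v)) -> f =1 g.
Proof.
move=> fl gl e v; rewrite [v]supp_sum (slin_sum _ _ _ fl) (slin_sum _ _ _ gl).
by apply: eq_bigr => j _; exact: e.
Qed.

Section DescendantUnit.
Variables (k : fieldType) (A B : binaryQFT k) (f : A -> ser B) (psi : seq A -> ser B).
Hypotheses (mf : is_morphism f) (df : is_descendant f psi).
Local Notation hp := (fun t : int * A => hpart t.1 t.2).
Local Notation dg := (fun t : int * A => t.1).
Let phi : seq (int * A) -> ser A := fun b => single (map hp b).
Let psih : seq (int * A) -> ser B := fun b => psi (map hp b).

Lemma descendant_letters s :
  fam_exp (par dg) (wgt psih) s = f (\prod_(v <- map hp s) v).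
Proof.
have psil := desc_mlin df; have fl := morph_slin mf.
have := lin_ext_prod_exp [seq (t.1, cst t.2) | t <- s] fl psil (morph_one mf) df.1.
rewrite lval_const ser_prod_cst lin_ext_cst ?slin0 // => ->.
rewrite (fam_exp_map (p := par dg)) //; apply: eq_fam_exp => b nb.
by rewrite wgt_map !wgtE // mul_lext_const.
Qed.

Lemma descendant1 v : psi [:: v] = f v.
Proof.
have psil := desc_mlin df; have fl := morph_slin mf.
move: v; apply: slin_mlin_sum => // [|j v]; first exact: mlin_slin.
have := descendant_letters [:: (j, v)].
rewrite -[[:: (j, v)]]/(rcons [::] (j, v)) fam_exp_rcons /= fam_exp_nil smul1l.
by rewrite /wgt mulNhbar0n /psih /= big_seq1.
Qed.

(** As f (x_1 ... x_n 1) = f (x_1 ... x_n), the exponential of [psi] does not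
    change when the unit is appended to a word.  The partitions where the unit
    is alone already give this value, so the others, with leading term
    [psi (x_1, ..., x_n, 1)], contribute zero. *)
Lemma descendant_unit l : (0 < size l)%N -> psi (rcons l 1) = 0.
Proof.
have psil := desc_mlin df.
have h1 : hpart 0 (1 : A) = 1 by exact: homog1.
pose u := (0 : int, 1 : A); pose E := fam_exp (par dg) (wgt psih).
have Eu s : E (rcons s u) = E s.
  rewrite /E !descendant_letters; congr f.
  by rewrite map_rcons -cats1 big_cat big_seq1 /= h1 mulr1.
(* [Y0] is the value when the unit is a block by itself. *)
pose Y b := wgt psih (rcons b u); pose Y0 (b : seq (int * A)) := if b is [::] then cst 1 else 0 : ser B.
have eY b : Y b = Y0 b + nz Y b.
  case: b => [|t b]; last by rewrite add0r.
  rewrite addr0 /Y /wgt /= mulNhbar0n /psih /= h1 descendant1.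
  exact: morph_one mf.
have Ynz b : nz Y b = 0.
  have [n] := ubnP (size b); elim: n b => // n IH b; rewrite ltnS => le.
  have := Eu b; rewrite {1}/E fam_exp_rcons -/(E).
  rewrite (eq_ssum (H' := fun a b => smul (E a) (Y0 b) + smul (E a) (nz Y b))); last first.
    by move=> a c _ _; rewrite -smulDr -eY.
  rewrite ssumD ssum_left0 /= => [|a [|t c] sz lt]; last 2 first.
  - by rewrite -sz addn0 ltnn in lt.
  - by rewrite smul0r.
  rewrite smul1r ssum_right0 => [|a c sz lt]; last first.
    by rewrite IH ?smul0r // (leq_trans lt).
  have -> : E [::] = cst 1 by [].
  by rewrite smul1l => e; apply: (addrI (E b)); rewrite addr0.
move=> nl; apply: (@mlin_homog0 _ _ _ (fun l => psi (rcons l 1)) (size l)) => //.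
  by move=> s1 s2 c x y; rewrite !rcons_cat !rcons_cons psil.
move=> s ss; apply: (@mulNhbar_inj _ _ (size s)); rewrite mulNhbar_0 -[RHS](Ynz s).
rewrite nzE; last by rewrite ss.
rewrite /Y wgtE ?size_rcons //=.
by rewrite /psih /u map_rcons /= h1.
Qed.
End DescendantUnit.

Lemma bq_ell1 (k : fieldType) (A : binaryQFT k) v : bq_ell A [:: v] = bq_K A v.
Proof.
move: v; apply: slin_mlin_sum => [||j v].
- exact: mlin_slin (@bq_ell_mlin _ A).
- exact: bq_K_slin.
have := lin_ext_prod_conv [seq (t.1, cst t.2) | t <- [:: (j, v)]] (@bq_K_slin _ A)
  (@bq_ell_mlin _ A) (bq_K_one A) (@bq_ell_deg _ A) (@bq_ellE _ A).
rewrite lval_const ser_prod_cst lin_ext_cst ?slin0 //=; last exact: bq_K_slin.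
rewrite big_seq1 => ->; rewrite /conv /= smul0l ?sg0 ?addr0 smul1r.
by rewrite /wgt /= mulNhbar0n /mul_lext /= /lval /= shpart_cst mul_ext_consts //; exact: bq_ell_mlin.
Qed.

(** * Transport of morphisms and homotopies *)

Lemma eq_homog_letters (k : fieldType) (V W : gradedType k)
    (F G : forall n, n.-tuple int -> n.-tuple V -> ser W) :
  (forall n (t : n.-tuple (int * V)), (0 < n)%N ->
     F n (map_tuple (fun t => t.1) t) (map_tuple (fun t => hpart t.1 t.2) t)
     = G n (map_tuple (fun t => t.1) t) (map_tuple (fun t => hpart t.1 t.2) t)) ->
  eq_homog F G.
Proof.
move=> e n d x n0 hx a b; pose t := [tuple (tnth d i, tnth x i) | i < n].
have -> : d = map_tuple (fun t => t.1) t.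
  by apply: eq_from_tnth => i; rewrite tnth_map tnth_mktuple.
have -> : x = map_tuple (fun t => hpart t.1 t.2) t.
  by apply: eq_from_tnth => i; rewrite tnth_map tnth_mktuple /= hx.
by rewrite e.
Qed.

Section Letters.
Variables (k : fieldType) (V1 V0 V W : gradedType k) (J : V1 -> V0).
Implicit Types (phi : seq V0 -> ser V).

Lemma sum_blocks_letters (g : seq V -> ser W) phi n (t : n.-tuple (int * V1)) :
  sum_blocks 0 (mul_ext g) phi (map_tuple (fun t => t.1) t) (map_tuple (ev J) t)
  = ext_comp (fun t => t.1) g (evf J phi) t.
Proof.
rewrite sum_blocks_psum; apply: eq_psum => bl nbl _ _; rewrite mul0n mulNhbar0n.
congr mul_ext; elim: bl nbl => //= b bl IH /andP[nb /IH->].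
by rewrite /evf nzE.
Qed.

Lemma marked_nz (T : Type) (F G : seq T -> ser V) b : (0 < size b)%N ->
  marked (nz F) (nz G) b = marked F G b.
Proof.
case: b => // -[t|] b _; rewrite /marked //=.
case: ifP => // /andP[h nb]; rewrite nzE //.
by rewrite size_pmap_isSome.
Qed.

Lemma sum_blocks_at_letters (g : seq V -> ser W) phi lam n (t : n.-tuple (int * V1)) :
  mlin phi -> mlin g ->
  sum_blocks_at (mul_ext g) phi lam (map_tuple (fun t => t.1) t) (map_tuple (ev J) t)
  = ext_comp (oapp (fun t => t.1) (-1)) g (marked (evf J phi) (evf J lam)) (None :: map Some t).
Proof.
move=> pl gl; rewrite sum_blocks_at_psum //; last exact: mul_ext_mlin.
rewrite (parO_par (fun t : int * V1 => t.1) (m := -1)) //; apply: eq_psum => bl nbl _ _.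
congr mul_ext; elim: bl nbl => //= b bl IH /andP[nb /IH->].
by rewrite marked_nz.
Qed.
End Letters.

Section CompositeValues.
Variables (k : fieldType) (R : nat -> forall W : gradedType k, ser W -> ser W -> Prop).
Hypothesis HR : tau_rel R.
Variables (V1 V0 V W : gradedType k) (J : V1 -> V0) (psi : seq V -> ser W).
Hypotheses (psil : mlin psi) (psif : forall s, (0 < size s)%N -> tau_free (psi s)).

Lemma composite_rel (phi phi' : seq V0 -> ser V) n N s :
  (forall s, (0 < size s <= n)%N -> @R N _ (phi s) (phi' s)) -> (0 < size s <= n)%N ->
  @R (N * size s + 1)%N _ (composite J psi phi s) (composite J psi phi' s).
Proof.
move=> h ns; apply: tr_mlext => // l sl; rewrite /pre_comp /ext_comp /= map_id -sl.
apply: (tr_ext_comp HR _ (n := n)); rewrite ?sl // => b nb.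
have nb1 : (0 < size b)%N by case/andP: nb.
by rewrite /evf !nzE //; apply: h; rewrite size_map.
Qed.

Lemma composite_at_rel (phi phi' lam lam' : seq V0 -> ser V) n N s :
  (forall s, (0 < size s <= n.+1)%N -> @R N _ (phi s) (phi' s)) ->
  (forall s, (0 < size s <= n.+1)%N -> @R N _ (lam s) (lam' s)) -> (size s <= n)%N ->
  @R (N * (size s).+1 + 1)%N _ (composite_at J psi phi lam s) (composite_at J psi phi' lam' s).
Proof.
move=> hp hl ns; apply: tr_mlext => // l sl; rewrite /pre_comp /ext_comp.
have := @tr_ext_comp _ _ HR _ (par (oapp (fun t : int * V1 => t.1) (-1))) _ _
  (marked (evf J phi) (evf J lam)) (marked (evf J phi') (evf J lam')) psi n.+1 N
  ([:: None] ++ map Some l) psil psif.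
rewrite /= size_map sl; apply => //.
move=> b /andP[nb le].
have szp c : (size (pmap id c : seq (int * V1)) <= size c)%N.
  by elim: c => [|[t|] c IH] //=; apply: leqW.
case: b nb le => [|[t|] b] // _ le; rewrite /marked /=.
  case: ifP => h; last exact: (tr_0 HR).
  apply: hp => /=; rewrite size_map; apply: leq_trans le.
  by rewrite ltnS; exact: szp.
case: ifP => h; last exact: (tr_0 HR).
case/andP: h => h nb; rewrite /evf !nzE ?size_pmap_isSome //; apply: hl.
rewrite size_map size_pmap_isSome // nb /=; apply: leq_trans le; exact: leqnSn.
Qed.

End CompositeValues.

Lemma bound_upto (P : nat -> nat -> Prop) :
  (forall n M N, (M <= N)%N -> P n M -> P n N) ->
  (forall n, (0 < n)%N -> exists N, P n N) ->
  forall n, exists N, forall m, (0 < m <= n)%N -> P m N.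
Proof.
move=> mono ex; elim=> [|n [N hN]]; first by exists 0%N; case.
have [M hM] := ex n.+1 isT; exists (M + N)%N => m /andP[m0].
rewrite leq_eqVlt => /predU1P[->|]; first by apply: mono hM; rewrite leq_addr.
by rewrite ltnS => le; apply: mono (hN m _); rewrite ?leq_addl // m0.
Qed.

Section Transport.
Variables (k : fieldType) (A B : binaryQFT k).
Variables (f : A -> ser B) (psi : seq A -> ser B).
Hypotheses (mf : is_morphism f) (df : is_descendant f psi).
Variables (V1 V0 : gradedType k) (J : V1 -> V0) (one1 : V1) (one0 : V0).
Variables (l1 : seq V1 -> ser V1) (l0 : seq V0 -> ser V0).
Hypotheses (Jlin : linear J) (Jdeg : forall i x, homog i x -> homog i (J x)).
Hypotheses (J1 : J one1 = one0) (h1 : homog 0 one1).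
Hypotheses (l1z : forall s, l1 s = 0) (l0z : forall s, l0 s = 0).
Local Notation dg := (fun t : int * V1 => t.1).
Local Notation hp := (fun t : int * V1 => hpart t.1 t.2).
Local Notation degO := (oapp dg (-1)).
Local Notation comp := (composite J psi).

Let psiS := desc_sym df.
Let psil := desc_mlin df.
Lemma psi_free s : (0 < size s)%N -> tau_free (psi s).
Proof. exact: (shom_hbar_tau_free df.2). Qed.

Lemma homog_tuple_ev n (t : n.-tuple (int * V1)) :
  homog_tuple (map_tuple dg t) (map_tuple (ev J) t).
Proof. by move=> i; rewrite !tnth_map; exact: homog_ev. Qed.

Lemma sL_flat phi : is_sLmorphism one0 1 l0 (bq_ell A) phi ->
  forall s, (0 < size s)%N -> ext_comp dg (bq_ell A) (evf J phi) s = 0.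
Proof.
case=> hphi _ _ e s ns; rewrite -[s]/(tval (in_tuple s)) -sum_blocks_letters.
apply: serP => a b; rewrite (e _ _ _ ns (homog_tuple_ev (in_tuple s))).
rewrite sum_insert_zero //; apply: mul_ext_mlin.
exact: sym_fam_mlin (shom_hbar_sym hphi).
Qed.

Lemma flat_composite phi : sym_fam 0 phi ->
  (forall s, (0 < size s)%N -> ext_comp dg (bq_ell A) (evf J phi) s = 0) ->
  eq_homog (sum_blocks 0 (mul_ext (bq_ell B)) (comp phi))
           (sum_insert 0 (mul_ext (comp phi)) l1).
Proof.
move=> hphi flat; apply: eq_homog_letters => n t n0.
have hcomp := composite_sym Jlin Jdeg psiS hphi.
rewrite sum_insert_zero //; last by apply: mul_ext_mlin; exact: sym_fam_mlin hcomp.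
rewrite -[map_tuple hp t]/(map_tuple (ev id) t) sum_blocks_letters.
rewrite -(flat_transport mf df (hfam_evf Jdeg hphi) flat (s := t)) ?size_tuple //.
apply: eq_psum => bl nbl _ _; congr mul_ext; elim: bl nbl => //= b bl IH /andP[nb /IH->].
by rewrite {1}/evf nzE // composite_letters.
Qed.

Lemma composite_rcons1 phi s : sym_fam 0 phi -> phi [:: one0] = cst 1 ->
  (forall s, (0 < size s)%N -> phi (rcons s one0) = 0) -> (0 < size s)%N ->
  comp phi (rcons s one1) = 0.
Proof.
move=> hphi p1 p0 ns.
have cl := sym_fam_mlin (composite_sym Jlin Jdeg psiS hphi).
apply: (@mlin_homog0 _ _ _ (fun s => comp phi (rcons s one1)) (size s)) => //.
  by move=> s1 s2 c x y; rewrite !rcons_cat !rcons_cons cl.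
move=> l sl; rewrite -[one1]h1 -[hpart 0 _]/(hp (0, one1)) -map_rcons composite_letters //.
apply: (ext_comp_unit _ (one := 1)) => //; rewrite ?sl //.
- by move=> l'; exact: descendant_unit mf df l'.
- by rewrite /evf /= /ev /= h1 J1.
move=> b nb; rewrite /evf nzE ?size_rcons // map_rcons /ev /= h1 J1 p0 //.
by rewrite size_map.
Qed.

Lemma composite_at_rcons1 phi lam s : sym_fam 0 phi -> sym_fam (-1) lam ->
  phi [:: one0] = cst 1 -> (forall s, (0 < size s)%N -> phi (rcons s one0) = 0) ->
  (forall s, lam (rcons s one0) = 0) ->
  composite_at J psi phi lam (rcons s one1) = 0.
Proof.
move=> hphi hlam p1 p0 lam0.
have cl := sym_fam_mlin (composite_at_sym Jlin Jdeg psiS hphi hlam).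
apply: (@mlin_homog0 _ _ _ (fun s => composite_at J psi phi lam (rcons s one1)) (size s)) => //.
  by move=> s1 s2 c x y; rewrite !rcons_cat !rcons_cons cl.
move=> l sl; rewrite -[one1]h1 -[hpart 0 _]/(hp (0, one1)) -map_rcons composite_at_letters //.
rewrite map_rcons -rcons_cons.
have pmap_rc (c : seq (option (int * V1))) u : pmap id (rcons c (Some u)) = rcons (pmap id c) u.
  by elim: c => [|[t|] c IH] //=; rewrite IH.
have ev1 : ev J (0, one1) = one0 by rewrite /ev /= h1.
apply: (ext_comp_unit _ (one := 1)) => //.
- by move=> l'; exact: descendant_unit mf df l'.
- by rewrite /marked /= ev1.
move=> [|[t|] b] // _; rewrite /marked /= all_rcons /= pmap_rc.
  case: ifP => // h; rewrite map_rcons ev1 -rcons_cons p0 //.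
case: ifP => // h; rewrite /evf nzE ?size_rcons // map_rcons ev1; exact: lam0.
Qed.

Lemma composite1 phi v : sym_fam 0 phi -> comp phi [:: v] = lin_ext f (phi [:: J v]).
Proof.
move=> hphi; have pl := sym_fam_mlin hphi.
have cl := sym_fam_mlin (composite_sym Jlin Jdeg psiS hphi).
move: v; apply: slin_mlin_sum => [||j v].
- exact: mlin_slin.
- move=> c x y; rewrite Jlin -[phi _]/(phi ([::] ++ (c *: J x + J y) :: [::])) pl /=.
  by rewrite lin_ext_slin //; exact: morph_slin mf.
rewrite -[in LHS](_ : map hp [:: (j, v)] = [:: hpart j v]) // composite_letters //.
rewrite /ext_comp -[[:: (j, v)]]/(rcons [::] (j, v)) psum_rcons /= psum0 /=.
rewrite mul_ext_cons; apply: eq_lin_ext => a b.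
exact: descendant1 mf df _.
Qed.

(** The [sL]-infinity equation is flatness, which [flat_transport] transports;
    the unit conditions come from those of [psi]. *)
Lemma composite_sL phi : is_sLmorphism one0 1 l0 (bq_ell A) phi ->
  is_sLmorphism one1 1 l1 (bq_ell B) (comp phi).
Proof.
move=> hsL; case: (hsL) => hphi p1 p0 _; have phiS := shom_hbar_sym hphi.
have p1' : phi [:: one0] = cst 1 by apply: serP.
have p0' s : (0 < size s)%N -> phi (rcons s one0) = 0.
  by move=> ns; apply: serP => a b; exact: p0.
split.
- move=> n n0; split; first exact: composite_sym.
  move=> s ss; have := @composite_rel _ _ (rel_freeP k) _ _ _ _ J psi psil psi_free
    phi phi n 0 s; apply; rewrite ?ss ?n0 ?leqnn // => s' /andP[ns' _].
  exact: shom_hbar_tau_free hphi _ ns'.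
- move=> a b; rewrite composite1 // J1 p1' lin_ext_cst ?(morph_one mf) //.
  exact: slin0 (morph_slin mf).
- by move=> s a b ns; rewrite composite_rcons1.
apply: flat_composite => //; exact: sL_flat.
Qed.

End Transport.

(** * Homotopies of morphisms *)

(** K (x_1 ... x_n 1) = K (x_1 ... x_n) and K 1 = 0, and both sides are
    convolutions of the same exponential with the descendant: the terms with the
    unit in the block of [ell] must vanish, by division. *)
Lemma bq_ell_unit (k : fieldType) (A : binaryQFT k) l : bq_ell A (rcons l 1) = 0.
Proof.
pose hp := fun t : int * A => hpart t.1 t.2; pose c := fun t : int * A => (t.1, cst t.2).
have h1 : hpart 0 (1 : A) = 1 by exact: homog1.
pose u := (0 : int, cst (1 : A)); pose q := par (fun t : int * ser A => t.1).
pose P (l : seq (int * ser A)) := ser_prod (map (@lval k A) l).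
pose X (l : seq (int * ser A)) := wgt (mul_lext (bq_ell A)) l.
have KP l0 : lin_ext (bq_K A) (P l0) = conv q X P l0.
  apply: lin_ext_prod_conv; [exact: bq_K_slin|exact: bq_ell_mlin|exact: bq_K_one| |].
    exact: bq_ell_deg.
  exact: bq_ellE.
have Pu l0 : P (rcons l0 u) = P l0.
  by rewrite /P map_rcons ser_prod_rcons /lval /u /= shpart_cst h1 smul1r.
have Xu l0 : X (rcons l0 u) = 0.
  apply: (@conv_cancel0 _ _ _ q (fun l => X (rcons l u)) (fun=> 0) P) => // s.
  have := KP (rcons s u); rewrite Pu KP /conv ssum_rcons.
  rewrite [X in _ = X + _](eq_ssum (H' := fun a b => smul (X a) (P b))) => [|a b _ _];
    last by rewrite Pu.
  rewrite -[X in X = _ -> _]addr0 => /addrI e; transitivity (0 : ser A).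
    by rewrite [RHS]e; apply: eq_ssum.
  by rewrite -[LHS](ssum0 q _ s); apply: eq_ssum => a b _ _; rewrite smul0l.
have el := @bq_ell_mlin _ A.
apply: (@mlin_homog0 _ _ _ (fun l => bq_ell A (rcons l 1)) (size l)) => //.
  by move=> s1 s2 d x y; rewrite !rcons_cat !rcons_cons el.
move=> s _; apply: (@mulNhbar_inj _ _ (size s)); rewrite mulNhbar_0 -[RHS](Xu (map c s)).
rewrite /X wgtE ?size_rcons //= size_map /mul_lext map_rcons lval_const /lval /u /=.
rewrite shpart_cst h1 -map_rcons mul_ext_csts //.
Qed.

Section HomotopyOfMorphisms.
Variables (k : fieldType) (char0 : [pchar k] =i pred0) (A : binaryQFT k).
Variables (V1 V0 : gradedType k) (J : V1 -> V0) (one1 : V1) (one0 : V0).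
Variables (l0 : seq V0 -> ser V0).
Hypothesis Jdeg : forall i x, homog i x -> homog i (J x).
Hypothesis l0z : forall s, l0 s = 0.
Local Notation dg := (fun t : int * V1 => t.1).
Local Notation hp := (fun t : int * V1 => hpart t.1 t.2).
Local Notation degO := (oapp dg (-1)).
Local Notation ell := (bq_ell A).
Variables (phi0 phi1 Phi lam : seq V0 -> ser A).
Hypothesis s0 : is_sLmorphism one0 1 l0 ell phi0.
Hypothesis hb : forall n, (0 < n)%N -> shom_hbar_tau n 0 Phi /\ shom_hbar_tau n (-1) lam.
Hypothesis lam0 : forall s a b, lam (rcons s one0) a b = 0.
Hypothesis ode : eq_homog (fun n d x => dtau (Phi x))
  (fun n d x a b => sum_insert 0 (mul_ext lam) l0 d x a b
     + sum_blocks_at (mul_ext ell) Phi lam d x a b).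
Hypothesis v0 : forall s a, (0 < size s)%N -> phi0 s a 0%N = Phi s a 0%N.
Hypothesis v1 : forall n, (0 < n)%N -> exists N,
  (forall s a b, size s = n -> (N <= b)%N -> Phi s a b = 0) /\ forall s a, size s = n -> phi1 s a 0%N = \sum_(b < N) Phi s a b.

Lemma htpy_sym : sym_fam 0 Phi. Proof. by apply: shom_hbar_tau_sym => n /hb[]. Qed.
Lemma htpy_lam_sym : sym_fam (-1) lam. Proof. by apply: shom_hbar_tau_sym => n /hb[]. Qed.
Let Phil := sym_fam_mlin htpy_sym.
Let laml := sym_fam_mlin htpy_lam_sym.
Local Notation M := (marked (evf J Phi) (evf J lam)).

Lemma ell_tau_free s : (0 < size s)%N -> tau_free (ell s).
Proof. by apply: shom_hbar_tau_free => n; exact: bq_ell_hom. Qed.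

Lemma htpy_ode s : (0 < size s)%N ->
  dtau (evf J Phi s) = ext_comp degO ell M (None :: map Some s).
Proof.
move=> ns; rewrite -[in RHS](_ : tval (in_tuple s) = s) //.
rewrite -sum_blocks_at_letters //; last exact: bq_ell_mlin.
apply: serP => a b; rewrite /evf nzE //.
rewrite (ode ns (homog_tuple_ev Jdeg (in_tuple s))) sum_insert_zero ?add0r //.
exact: mul_ext_mlin.
Qed.

Lemma htpy_flat0 s : (0 < size s)%N -> tau_ord 1 (ext_comp dg ell (evf J Phi) s).
Proof.
move=> ns a [|b] // _.
have h : tr_fam (@rel_at0 k) (evf J Phi) (evf J phi0) (size s) 0.
  move=> b nb; have nb1 : (0 < size b)%N by case/andP: nb.
  by rewrite /evf !nzE // => a'; rewrite v0 // size_map.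
have := tr_ext_comp (rel_at0P k) (par dg) (@bq_ell_mlin _ A) ell_tau_free h (s := s).
rewrite ns leqnn /ext_comp => /(_ isT a) <-.
by rewrite -/(ext_comp dg ell (evf J phi0) s) (sL_flat Jdeg l0z s0).
Qed.

Lemma htpy_marked : (fun b => M (map Some b)) = evf J Phi.
Proof. by apply: funext => b; exact: marked_Some. Qed.

Lemma htpy_M_deg : hfam degO M.
Proof. by move=> b _; apply: shomog_Phi; [exact: Jdeg|exact: htpy_sym|exact: htpy_lam_sym]. Qed.

Lemma htpy_dM a : (0 < size a)%N ->
  dtau (M (map Some a)) = ext_comp degO ell M (None :: map Some a).
Proof. by move=> na; rewrite marked_Some htpy_ode. Qed.

Lemma htpy_M_flat0 a : (0 < size a)%N ->
  tau_ord 1 (ext_comp dg ell (fun b => M (map Some b)) a).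
Proof. by rewrite htpy_marked; exact: htpy_flat0. Qed.

Lemma htpy_at1 n : exists N, forall s, (0 < size s <= n)%N -> rel_at1 N (Phi s) (phi1 s).
Proof.
pose P m N := forall s, size s = m -> rel_at1 N (Phi s) (phi1 s).
have [|m m0|N hN] := @bound_upto P _ _ n.
- by move=> m N N' le h s ss; apply: (tr_mono (rel_at1P k) le); exact: h.
- have [N [hN e]] := v1 m0; exists N => s ss; split; last by move=> a; exact: e.
  by move=> a b le; exact: hN.
by exists N => s hs; exact: (hN (size s)).
Qed.

(** The integral over time of [dtau_exp_exact]; [w] is the integral of the
    primitive from time 0 to time 1. *)
Lemma htpy_cobound s : exists w : ser A, forall a,
  fam_exp (par dg) (wgt (evf J phi1)) s a 0%N - fam_exp (par dg) (wgt (evf J phi0)) s a 0%N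
  = lin_ext (bq_K A) w a 0%N.
Proof.
have M0 : M [:: None] = 0 by [].
have := dtau_exp_exact char0 (isT : parity (-1)) htpy_M_deg M0 htpy_dM htpy_M_flat0 s.
rewrite htpy_marked; set E := fam_exp _ _ s; set Z := conv _ _ _ s => eE.
have r0 : rel_at0 0 E (fam_exp (par dg) (wgt (evf J phi0)) s).
  have h : tr_fam (@rel_at0 k) (wgt (evf J Phi)) (wgt (evf J phi0)) (size s) 0.
    move=> b nb; have nb1 : (0 < size b)%N by case/andP: nb.
    rewrite !wgtE // /evf !nzE //; apply: (tr_mulNhbar (rel_at0P k) _ (N := 0)) => a.
    by rewrite v0 ?size_map.
  exact: (tr_fam_exp (rel_at0P k) (par dg) h (leqnn _)).
have [N r1] : exists N, rel_at1 N E (fam_exp (par dg) (wgt (evf J phi1)) s).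
  have [N hN] := htpy_at1 (size s).
  have h : tr_fam (@rel_at1 k) (wgt (evf J Phi)) (wgt (evf J phi1)) (size s) (N + 1).
    move=> b nb; have nb1 : (0 < size b)%N by case/andP: nb.
    rewrite !wgtE // /evf !nzE //; apply: (tr_mulNhbar (rel_at1P k)).
    by apply: hN; rewrite size_map.
  eexists; exact: (tr_fam_exp (rel_at1P k) (par dg) h (leqnn _)).
have [bE r1'] := tr_mono (rel_at1P k) (leqnSn N) r1.
(* The integral of tau^c over [0, 1] is 1 / (c + 1). *)
pose w : ser A := fun a b => if b == 0%N then \sum_(c < N) (c.+1%:R)^-1 *: Z a c else 0.
exists w => a; rewrite r1' r0 lin_ext_b0 big_ord_recl /= addrC addKr.
have Kl := @bq_K_slin _ A; have Kf := @bq_K_tau _ A.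
have e (c : nat) : E a c.+1 = \sum_(i < a.+1) bq_K A ((c.+1%:R)^-1 *: Z i c) (a - i)%N 0%N.
  have n0 : (c.+1%:R : k) != 0 by rewrite ((pcharf0P k).1 char0).
  apply: (scalerI n0); rewrite scaler_sumr; transitivity (dtau E a c).
    by rewrite /dtau scaler_nat.
  rewrite eE /lin_ext; apply: eq_bigr => i _; rewrite (slinZ Kl) serZE scalerA divff // scale1r.
  rewrite big_ord_recr /= subnn big1 ?add0r // => j _.
  by rewrite -[(c - j)%N]prednK ?Kf // subn_gt0.
under eq_bigr => c _ do rewrite /bump /= add1n e.
rewrite exchange_big /=; apply: eq_bigr => i _; rewrite /w /=.
by have h := slin_sum (index_enum 'I_N) xpredT (fun c : 'I_N => (c.+1%:R)^-1 *: Z i c) Kl;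
   have := congr1 (fun y : ser A => y (a - i)%N 0%N) h; rewrite ser_sumE => ->.
Qed.

Lemma dtau_eq0 (W : gradedType k) (x : ser W) : dtau x = 0 -> tau_free x.
Proof.
move=> e a b; have n0 : (b.+1%:R : k) != 0 by rewrite ((pcharf0P k).1 char0).
by apply: (scalerI n0); rewrite scaler0 scaler_nat -[RHS](congr1 (fun y : ser W => y a b) e).
Qed.

(** Unitality at time 0 propagates to all times: inductively, every term of the
    time derivative of [Phi (x_1, ..., x_n, 1)] vanishes, because [ell] and
    [lam] vanish on the unit. *)
Lemma htpy_unit_letters s : homog 0 one1 -> J one1 = one0 ->
  evf J Phi (rcons s (0, one1)) = if s is [::] then cst 1 else 0.
Proof.
move=> h1 J1; set u := (0, one1); have ev1 : ev J u = one0 by rewrite /ev /= h1.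
have [n] := ubnP (size s); elim: n s => // n IH s; rewrite ltnS => les.
have el := @bq_ell_mlin _ A; have mel := mul_ext_mlin el.
have dF0 : dtau (evf J Phi (rcons s u)) = 0.
  rewrite htpy_ode ?size_rcons // map_rcons -rcons_cons /ext_comp psum_rcons /=.
  rewrite !(ssum_map (p := par dg)) // -[RHS]addr0; congr (_ + _);
    rewrite -[RHS](ssum0 (par dg) _ s); apply: eq_ssum => a b sz _.
    have eb : rcons (map Some b) (Some u) = map Some (rcons b u) by rewrite map_rcons.
    case: a sz => [|y a] sz.
      rewrite -[None :: _]/(rcons [::] None) psum_rcons /= psum0 /=.
      exact: (mlin0 mel [::]).
    rewrite -[RHS](psum_zero (par degO) _ (None :: map Some (y :: a))).
    apply: eq_psum => bl _ _ _; rewrite map_rcons eb marked_Some IH; last first.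
      by apply: leq_trans les; rewrite -sz addSn ltnS leq_addl.
    case: b sz {eb} => [|z b] _; last by rewrite -cats1; exact: (mlin0 mel).
    rewrite mul_ext_rcons_cst // -[RHS](mul_ext_fun0 A (map M bl)).
    by apply: mul_ext_eq => t _; exact: bq_ell_unit.
  have eb : rcons (map Some b) (Some u) = map Some (rcons b u) by rewrite map_rcons.
  rewrite [X in sg _ X](_ : _ = 0) ?sg0 //.
  rewrite -[RHS](psum_zero (par degO) _ (map Some a)).
  apply: eq_psum => bl _ _ _; rewrite map_rcons eb marked_None ?size_rcons //.
  have -> : evf J lam (rcons b u) = 0.
    by rewrite /evf nzE ?size_rcons // map_rcons ev1; apply: serP => c d; exact: lam0.
  by rewrite -cats1; exact: (mlin0 mel).
apply: serP => a [|b]; last first.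
  by rewrite (dtau_eq0 dF0); case: (s) => //; rewrite /cst andbF.
rewrite {1}/evf nzE ?size_rcons // -v0 ?size_map ?size_rcons // map_rcons ev1.
case: s0 => _ p1 p0 _; case: (s) => [|y t]; first exact: p1.
by rewrite p0 // size_map.
Qed.

End HomotopyOfMorphisms.

Section TransportHomotopy.
Variables (k : fieldType) (char0 : [pchar k] =i pred0) (A B : binaryQFT k).
Variables (f : A -> ser B) (psi : seq A -> ser B).
Hypotheses (mf : is_morphism f) (df : is_descendant f psi).
Variables (V1 V0 : gradedType k) (J : V1 -> V0) (one1 : V1) (one0 : V0).
Variables (l1 : seq V1 -> ser V1) (l0 : seq V0 -> ser V0).
Hypotheses (Jlin : linear J) (Jdeg : forall i x, homog i x -> homog i (J x)).
Hypotheses (J1 : J one1 = one0) (h1 : homog 0 one1).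
Hypotheses (l1z : forall s, l1 s = 0) (l0z : forall s, l0 s = 0).
Local Notation dg := (fun t : int * V1 => t.1).
Local Notation hp := (fun t : int * V1 => hpart t.1 t.2).
Local Notation degO := (oapp dg (-1)).
Local Notation comp := (composite J psi).

(** The homotopy is the composite with [Phi] together with its derivative in the
    direction [lam].  Its equation is [homotopy_transport]; the boundary values
    and bounds in [tau] are those of sums of products of values of [psi],
    [Phi] and [lam]. *)
Lemma composite_homotopic phi0 phi1 :
  sL_homotopic one0 1 l0 (bq_ell A) phi0 phi1 ->
  sL_homotopic one1 1 l1 (bq_ell B) (comp phi0) (comp phi1).
Proof.
case=> s0 s1 [Phi [lam [hb lam0 ode v0 v1]]].
have PhiS := htpy_sym hb; have lamS := htpy_lam_sym hb.
have psiS := desc_sym df; have psil := desc_mlin df; have psif := psi_free df.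
split; [exact: (composite_sL mf df Jlin Jdeg J1 h1)|exact: (composite_sL mf df Jlin Jdeg J1 h1)|].
have hone0 : homog 0 one0 by rewrite -J1; exact: Jdeg.
have unit0 s : Phi (rcons s one0) = if s is [::] then cst 1 else 0.
  have idl : linear (@idfun V0) by [].
  pose c : ser A := if s is [::] then cst 1 else 0.
  apply/eqP; rewrite -subr_eq0 -/c; apply/eqP.
  have Phil := sym_fam_mlin PhiS.
  case: s @c => [|z s] c.
    have := htpy_unit_letters char0 (J := idfun) (fun _ _ => id) l0z s0 hb lam0 ode v0 [::] hone0 erefl.
    by rewrite /evf /= /ev /= hone0 => ->; rewrite subrr.
  rewrite /c subr0; apply: (@mlin_homog0 _ _ _ (fun s => Phi (rcons s one0)) (size (z :: s))) => //.
    by move=> t1 t2 d x y; rewrite !rcons_cat !rcons_cons Phil.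
  move=> l sl.
  have := htpy_unit_letters char0 (J := idfun) (fun _ _ => id) l0z s0 hb lam0 ode v0 l hone0 erefl.
  rewrite /evf nzE ?size_rcons // map_rcons /ev /= hone0 => ->.
  by case: l sl.
have bnd : forall n, exists N, forall s, (0 < size s <= n)%N ->
    rel_bound N (Phi s) (Phi s) /\ rel_bound N (lam s) (lam s).
  move=> n; pose P m N := forall s, size s = m ->
    rel_bound N (Phi s) (Phi s) /\ rel_bound N (lam s) (lam s).
  have [m M N le h s ss|m m0|N hN] := @bound_upto P _ _ n.
  - have [hP hL] := h s ss; split; [exact: (tr_mono (rel_boundP k) le hP)|].
    exact: (tr_mono (rel_boundP k) le hL).
  - have [[_ [N1 h1']] [_ [N2 h2']]] := hb m m0; exists (N1 + N2)%N => s ss.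
    split=> a b le; [apply: h1' | apply: h2'] => //; apply: leq_trans le.
      exact: leq_addr.
    exact: leq_addl.
  by exists N => s hs; exact: (hN (size s)).
exists (comp Phi), (composite_at J psi Phi lam); split.
- move=> n n0; have [N hN] := bnd n.+1; split; split.
  + exact: composite_sym.
  + exists (N * n + 1)%N => s a b ss le.
    have := @composite_rel _ _ (rel_boundP k) _ _ _ _ J psi psil psif Phi Phi n N s.
    rewrite ss n0 leqnn => /(_ _ isT); apply => // s' /andP[ns' les'].
    by case: (hN s'); rewrite ?ns' ?leqW.
  + exact: composite_at_sym.
  + exists (N * n.+1 + 1)%N => s a b ss le.
    have := @composite_at_rel _ _ (rel_boundP k) _ _ _ _ J psi psil psif Phi Phi lam lam n N s.
    by rewrite ss; apply => // s' hs; case: (hN s' hs).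
- move=> s a b; rewrite (composite_at_rcons1 mf df Jlin Jdeg J1 h1 s PhiS lamS) //.
  + exact: (unit0 [::]).
  + by move=> s' ns'; rewrite unit0; case: s' ns'.
  + by move=> s'; apply: serP => c d; exact: lam0.
- apply: eq_homog_letters => n t n0; apply: serP => a b.
  have cS := composite_sym Jlin Jdeg psiS PhiS.
  have caS := composite_at_sym Jlin Jdeg psiS PhiS lamS.
  rewrite sum_insert_zero // ?add0r; last by apply: mul_ext_mlin; exact: sym_fam_mlin caS.
  have nt : (0 < size t)%N by rewrite size_tuple.
  have M0 : marked (evf J Phi) (evf J lam) [:: None] = 0 by [].
  have MD := htpy_M_deg Jdeg hb.
  have dM := htpy_dM Jdeg l0z hb ode.
  have F0 := htpy_M_flat0 Jdeg l0z lam s0 v0.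
  have key := homotopy_transport mf df char0 (isT : parity (-1)) MD M0 dM F0 nt.
  move: key; rewrite (htpy_marked J Phi lam) composite_letters // => ->.
  rewrite -[map_tuple hp t]/(map_tuple (ev id) t) sum_blocks_at_letters; first last.
  + exact: bq_ell_mlin.
  + exact: sym_fam_mlin cS.
  set M := marked (evf J Phi) (evf J lam).
  pose Phi' := ext_comp degO psi M; rewrite -/Phi'.
  have mel := mul_ext_mlin (@bq_ell_mlin _ B).
  have M0' : Phi' [:: None] = 0 by apply: ext_comp_None0.
  rewrite [LHS](_ : _ = psum (parO dg) (fun bl => mul_ext (bq_ell B) (map Phi' bl))
    (None :: map Some t) a b); last by rewrite /ext_comp (parO_par dg (m := -1)).
  have e1 c : (0 < size c)%N -> Phi' (map Some c)
      = marked (evf id (comp Phi)) (evf id (composite_at J psi Phi lam)) (map Some c).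
    move=> nc; rewrite marked_Some /evf nzE // -[map (ev id) c]/(map hp c) composite_letters //.
    rewrite /Phi' ext_comp_Some; congr (ext_comp _ _ _ _).
    by apply/funext => s; rewrite /M marked_Some.
  have e2 c : (0 < size c)%N -> Phi' (None :: map Some c)
      = marked (evf id (comp Phi)) (evf id (composite_at J psi Phi lam)) (None :: map Some c).
    move=> nc; rewrite marked_None // /evf nzE // -[map (ev id) c]/(map hp c).
    by rewrite composite_at_letters.
  have mapE l : all (fun b => 0 < size b)%N l ->
      map (fun c => Phi' (map Some c)) l = map (fun c => marked (evf id (comp Phi))
        (evf id (composite_at J psi Phi lam)) (map Some c)) l.
    by elim: l => //= c l IH /andP[/e1-> /IH->].
  congr (_ a b); rewrite (psum_marker dg _ mel M0') /ext_comp -(parO_par dg (m := -1)) //.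
  rewrite (psum_marker dg _ mel) //.
  apply: eq_psum => bl nbl _ _; apply: eq_bigr => i _.
  have := nbl; rewrite -{1}(cat_take_drop i bl) (drop_nth [::]) // all_cat /=.
  case/and3P => ntk ni nd.
  by rewrite (mapE _ ntk) (mapE _ nd) e2.
- move=> s a ns.
  have := @composite_rel _ _ (rel_at0P k) _ _ _ _ J psi psil psif Phi phi0 (size s) 0 s.
  by rewrite ns leqnn => /(_ _ isT); apply => // s' /andP[ns' _] a'; exact: v0.
- move=> n n0; have [N hN] := htpy_at1 v1 n; exists (N * n + 1)%N.
  have r s : size s = n -> rel_at1 (N * n + 1) (comp Phi s) (comp phi1 s).
    move=> ss; have := @composite_rel _ _ (rel_at1P k) _ _ _ _ J psi psil psif Phi phi1 n N s.
    by rewrite ss n0 leqnn => /(_ _ isT); apply.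
  split=> [s a b ss le|s a ss]; first by case: (r s ss) => hb' _; exact: hb'.
  by case: (r s ss).
Qed.

End TransportHomotopy.

(** * Homotopy equivalences and classical cohomology *)

Section TauFree.
Variable k : fieldType.
Implicit Types V W : gradedType k.

Lemma lin_ext_freel V W (F : V -> ser W) (x : ser V) a b : (forall v, tau_free (F v)) ->
  lin_ext F x a b = \sum_(i < a.+1) F (x i b) (a - i)%N 0%N.
Proof.
move=> Ff; apply: eq_bigr => i _; rewrite big_ord_recr /= subnn big1 ?add0r // => j _.
by rewrite -[(b - j)%N]prednK ?Ff // subn_gt0.
Qed.

Lemma lin_ext_freer V W (F : V -> ser W) (x : ser V) a b : F 0 = 0 -> tau_free x ->
  lin_ext F x a b = \sum_(i < a.+1) F (x i 0%N) (a - i)%N b.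
Proof.
move=> F0 xf; apply: eq_bigr => i _; rewrite big_ord_recl /= subn0 big1 ?addr0 // => j _.
by rewrite xf F0.
Qed.

Lemma tau_free_lin_ext V W (F : V -> ser W) (x : ser V) : F 0 = 0 ->
  (forall v, tau_free (F v)) -> tau_free x -> tau_free (lin_ext F x).
Proof. by move=> F0 Ff xf a b; rewrite lin_ext_freer // big1 // => i _; exact: Ff. Qed.

Lemma tau_free_eq V (x y : ser V) : tau_free x -> tau_free y ->
  (forall a, x a 0%N = y a 0%N) -> x = y.
Proof. by move=> xf yf e; apply: serP => a [|b] //; rewrite xf yf. Qed.

End TauFree.

Section ChainHomotopy.
Variables (k : fieldType) (char0 : [pchar k] =i pred0) (A B : binaryQFT k).

(** Integrating a homotopy pair from 0 to 1 yields an ordinary chain homotopy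
    between the two ends. *)
Lemma homotopic_chain (g0 g1 : A -> ser B) :
  (forall v, tau_free (g0 v)) -> (forall v, tau_free (g1 v)) -> homotopic g0 g1 ->
  exists2 X : A -> ser B, hom_hbar (-1) X & forall x,
    lin_ext g1 x - lin_ext g0 x
    = lin_ext (bq_K B) (lin_ext X x) + lin_ext X (lin_ext (bq_K A) x).
Proof.
move=> g0f g1f [F [xi [[[hF [hxi [N1 hN1]]] xi1 ode _] v0 [N2 [hN2 v1]]]]].
pose N := (N1 + N2)%N.
pose X : A -> ser B := fun v a b =>
  if b == 0%N then \sum_(c < N) (c.+1%:R)^-1 *: xi v a c else 0.
have Xh : hom_hbar (-1) X.
  split=> // a [|b]; rewrite /X /=; last first.
    by split=> [c x y|i x _]; [rewrite scaler0 addr0|exact: homog0].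
  split=> [c x y|i x hx].
    rewrite scaler_sumr -big_split; apply: eq_bigr => l _ /=.
    by rewrite (hxi a l).1 scalerDr !scalerA mulrC.
  by apply: homog_sum => l _; apply: homogZ; exact: (hxi a l).2.
exists X => //; have Xl := hom_hbar_slin Xh; have Xf := Xh.2.
have Kl := @bq_K_slin _ B; have KlA := @bq_K_slin _ A.
have Kf := @bq_K_tau _ B; have KfA := @bq_K_tau _ A.
have xil : slin xi.
  by move=> c x y; apply: serP => a b; rewrite (hxi a b).1.
suff key v : g1 v = g0 v + (lin_ext (bq_K B) (X v) + lin_ext X (bq_K A v)).
  move=> x; rewrite !lin_ext_comp // -lin_extD; apply/eqP; rewrite subr_eq addrC -lin_extD.
  by apply/eqP; apply: eq_lin_ext => i j.
apply: tau_free_eq => // [a b|a].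
  have t1 := tau_free_lin_ext (slin0 Kl) Kf (Xf v); have t2 := tau_free_lin_ext (slin0 Xl) Xf (KfA v).
  by rewrite !serDE t1 t2 g0f !addr0.
have e c : F v a c.+1 = (c.+1%:R)^-1 *: (\sum_(i < a.+1) bq_K B (xi v i c) (a - i)%N 0%N
    + \sum_(i < a.+1) xi (bq_K A v i 0%N) (a - i)%N c).
  have n0 : (c.+1%:R : k) != 0 by rewrite ((pcharf0P k).1 char0).
  apply: (scalerI n0); rewrite scalerA divff // scale1r scaler_nat.
  by rewrite -lin_ext_freel // -lin_ext_freer ?(slin0 xil) // -ode.
have leN : (N2 <= N.+1)%N by rewrite ltnW // ltnS leq_addl.
rewrite serDE v1 v0 -(@sum_extend _ (F v a) _ N.+1 leN) => [|b]; last exact: hN2.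
rewrite big_ord_recl; congr (_ + _); rewrite serDE lin_ext_freel // lin_ext_freer ?(slin0 Xl) //.
under eq_bigr => c _ do rewrite e scalerDr.
rewrite big_split; congr (_ + _).
  under eq_bigr => c _ do rewrite scaler_sumr.
  rewrite exchange_big /=; apply: eq_bigr => i _; rewrite /X /=.
  have h := slin_sum (index_enum 'I_N) xpredT (fun c : 'I_N => (c.+1%:R)^-1 *: xi v i c) Kl.
  have := congr1 (fun y : ser B => y (a - i)%N 0%N) h; rewrite ser_sumE => ->.
  by apply: eq_bigr => c _; rewrite (slinZ Kl).
under eq_bigr => c _ do rewrite scaler_sumr.
by rewrite exchange_big.
Qed.

End ChainHomotopy.

Section Induced.
Variables (k : fieldType) (A B : binaryQFT k) (f : A -> ser B).
Hypothesis mf : is_morphism f.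
Let fl := morph_slin mf.

Lemma classical_linear : linear (fun v => f v 0%N 0%N).
Proof. by move=> c x y; rewrite fl. Qed.

(** The coefficient of [hbar^0] in [morph_K]. *)
Lemma classical_K v : K0 (f v 0%N 0%N) = f (K0 v) 0%N 0%N.
Proof.
have := congr1 (fun y : ser B => y 0%N 0%N) (morph_K mf (cst v)).
rewrite !lin_ext_cst ?(slin0 fl) ?(slin0 (@bq_K_slin _ _)) // /lin_ext !big_ord1.
by rewrite !subn0.
Qed.

Lemma induced_cls x : K0 x = 0 ->
  induced f (cls (K0_differential A) x) = cls (K0_differential B) (f x 0%N 0%N).
Proof.
move=> dx; apply/clsP; rewrite ?classical_K ?d_crep ?dx ?(slin0 fl) //.
have [z e] := crep_cls (K0_differential A) dx; exists (f z 0%N 0%N).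
rewrite classical_K -e -[- x]scaleN1r [crep _ + _]addrC.
by rewrite classical_linear scaleN1r addrC.
Qed.

Lemma induced_linear : linear (induced f).
Proof.
move=> c u v; elim/(Defs.cohP (dP := K0_differential A)): u => x dx.
elim/(Defs.cohP (dP := K0_differential A)): v => y dy.
have dcx : K0 (c *: x) = 0 by exact: (Defs.dZ0 (K0_differential A)).
have dd z : K0 z = 0 -> K0 (f z 0%N 0%N) = 0.
  by move=> dz; rewrite classical_K dz (slin0 fl).
have e1 : c *: cls (K0_differential A) x + cls (K0_differential A) y
    = cls (K0_differential A) (c *: x + y).
  by rewrite Defs.clsD // Defs.clsZ.
rewrite e1 !induced_cls //; last exact: (Defs.dD0 (K0_differential A)).
rewrite classical_linear Defs.clsD ?Defs.clsZ //; try exact: dd.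
exact: (Defs.dZ0 (K0_differential B)) (dd _ dx).
Qed.

Lemma induced_hom : graded_hom 0 (induced f).
Proof.
split=> [|i v]; first exact: induced_linear.
elim/(Defs.cohP (dP := K0_differential A)): v => x dx.
have dh : K0 (hpart i x) = 0 by exact: (Defs.dh0 (K0_differential A)).
rewrite /homog -[hpart i _]/(coh_hpart i _) Defs.hpartE // => <-.
rewrite induced_cls // -[LHS]/(coh_hpart _ _) Defs.hpartE.
  congr cls; have [[h _] _ _ _] := mf; apply: (h 0%N 0%N).2; exact: homog_hpart.
by rewrite classical_K dh (slin0 fl).
Qed.

Lemma induced_one : induced f (oneH A) = oneH B.
Proof.
rewrite induced_cls; last by rewrite /K0 bq_K_one.
by case: mf => _ -> _ _.
Qed.

End Induced.

(** The classical part of the chain homotopy makes the composite homologous to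
    the identity on cocycles. *)
Lemma induced_cancel (k : fieldType) (A B : binaryQFT k) (f : A -> ser B) (f' : B -> ser A) X :
  is_morphism f -> is_morphism f' -> hom_hbar (-1) X ->
  (forall x : ser A, lin_ext (@cst k A) x - lin_ext (fun v => lin_ext f' (f v)) x
    = lin_ext (bq_K A) (lin_ext X x) + lin_ext X (lin_ext (bq_K A) x)) ->
  cancel (induced f) (induced f').
Proof.
move=> mf mf' hX e v; elim/(Defs.cohP (dP := K0_differential A)): v => x dx.
have Xl := hom_hbar_slin hX.
have df : K0 (f x 0%N 0%N) = 0 by rewrite classical_K // dx (slin0 (morph_slin mf)).
rewrite induced_cls // induced_cls //; symmetry; apply/clsP => //.
  by rewrite classical_K // df (slin0 (morph_slin mf')).
exists (X x 0%N 0%N); have := congr1 (fun y : ser A => y 0%N 0%N) (e (cst x)).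
rewrite !lin_ext_cst ?cst0 ?(slin0 Xl) ?(slin0 (@bq_K_slin _ _)) ?(slin0 (morph_slin mf)) //;
  last by rewrite lin_ext0 //; exact: morph_slin.
rewrite !serDE serNE /lin_ext !big_ord1 !subn0 /cst /= => ->.
by rewrite -[bq_K A x 0%N 0%N]/(K0 x) dx (slin0 Xl) addr0.
Qed.

(** * Transport of quantum structures *)

Lemma sum_blocks_exp (k : fieldType) (A : binaryQFT k) (V1 V0 : gradedType k) (J : V1 -> V0)
    (phi : seq V0 -> ser A) n (t : n.-tuple (int * V1)) :
  sum_blocks 1 (@ser_prod k A) phi (map_tuple (fun t => t.1) t) (map_tuple (ev J) t)
  = fam_exp (par (fun t : int * V1 => t.1)) (wgt (evf J phi)) t.
Proof.
rewrite sum_blocks_psum fam_exp_wgt; apply: eq_psum => bl nbl _ _.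
rewrite mul1n size_tuple; congr (mulNhbar _ (ser_prod _)).
by elim: bl nbl => //= b bl IH /andP[nb /IH->]; rewrite /evf nzE.
Qed.

(** The arity one case of the [sL]-infinity equation. *)
Lemma sL_cocycle (k : fieldType) (A : binaryQFT k) (V : gradedType k) (one : V)
    (l0 : seq V -> ser V) (phi : seq V -> ser A) :
  (forall s, l0 s = 0) -> is_sLmorphism one 1 l0 (bq_ell A) phi ->
  forall v, lin_ext (bq_K A) (phi [:: v]) = 0.
Proof.
move=> l0z hs; have phiS : sym_fam 0 phi by case: hs => /shom_hbar_sym.
have pl := sym_fam_mlin phiS; have Kl := @bq_K_slin _ A.
apply: slin_mlin_sum => [c x y|c x y|j v].
- by rewrite -[phi _]/(phi ([::] ++ (c *: x + y) :: [::])) pl lin_ext_slin.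
- by rewrite scaler0 addr0.
have := sL_flat (J := @idfun V) (fun _ _ => id) l0z hs (s := [:: (j, v)]) isT.
rewrite /ext_comp -[[:: (j, v)]]/(rcons [::] (j, v)) psum_rcons /= psum0 /=.
rewrite mul_ext_cons /evf /= => e; rewrite -[RHS]e; apply: eq_lin_ext => a b.
by rewrite -bq_ell1.
Qed.

Lemma sL_hom1 (k : fieldType) (V V' : gradedType k) one one' l l' (phi : seq V -> ser V') :
  is_sLmorphism one one' l l' phi -> hom_hbar 0 (fun v => phi [:: v]).
Proof.
case=> h _ _ _; have [h1 hf] := h 1%N isT; split; last by move=> v; exact: hf.
move=> a b; have [hl _ hd] := h1 a b; split=> [c x y|i x hx].
  exact: (hl [::] [::] c x y erefl).
by have := hd [tuple x] [tuple i]; rewrite big_ord1; apply=> j; rewrite ord1.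
Qed.

Lemma hom_hbar_shomog (k : fieldType) (V W : gradedType k) j i (F : V -> ser W) v :
  hom_hbar j F -> homog i v -> shomog (i + j) (F v).
Proof. by move=> [h _] hv a b; exact: (h a b).2. Qed.

Lemma in_hbar_lin_ext (k : fieldType) (V W : gradedType k) j i (F : V -> ser W) x :
  hom_hbar j F -> in_hbar i x -> in_hbar (i + j) (lin_ext F x).
Proof.
move=> hF [xf xh]; split; first by apply: tau_free_lin_ext => //; [exact: slin0 (hom_hbar_slin hF)|case: hF].
by apply: shomog_lin_ext => a b; exact: hom_hbar_shomog hF _.
Qed.

Lemma in_hbarD (k : fieldType) (V : gradedType k) i (x y : ser V) :
  in_hbar i x -> in_hbar i y -> in_hbar i (x + y).
Proof.
move=> [xf xh] [yf yh]; split; last exact: shomogD.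
by move=> a b; rewrite serDE xf yf addr0.
Qed.

Section DistinguishedTransport.
Variables (k : fieldType) (A B : binaryQFT k).
Variables (f : A -> ser B) (psi : seq A -> ser B) (f' : B -> ser A).
Hypotheses (mf : is_morphism f) (df : is_descendant f psi) (mf' : is_morphism f').
Variables (X : A -> ser A) (Y : B -> ser B).
Hypotheses (hX : hom_hbar (-1) X) (hY : hom_hbar (-1) Y).
Hypothesis eX : forall x : ser A, x - lin_ext f' (lin_ext f x)
  = lin_ext (bq_K A) (lin_ext X x) + lin_ext X (lin_ext (bq_K A) x).
Hypothesis eY : forall y : ser B, y - lin_ext f (lin_ext f' y)
  = lin_ext (bq_K B) (lin_ext Y y) + lin_ext Y (lin_ext (bq_K B) y).
Local Notation I := (induced f).
Local Notation J := (induced f').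
Hypotheses (IJ : cancel J I) (JI : cancel I J).
Local Notation phi' := (composite J psi).

Let Il := induced_linear mf.
Let Jl := induced_linear mf'.
Let fl := morph_slin mf.
Let f'l := morph_slin mf'.
Let Jdeg i v : homog i v -> homog i (J v).
Proof. by move=> hv; have := (induced_hom mf').2 i v hv; rewrite addr0. Qed.
Let Ideg i v : homog i v -> homog i (I v).
Proof. by move=> hv; have := (induced_hom mf).2 i v hv; rewrite addr0. Qed.
Let I0 : I 0 = 0.
Proof. by have := Il (-1) 0 0; rewrite scaler0 addr0 scaleN1r addNr. Qed.
Let hom_f : hom_hbar 0 f. Proof. by case: mf. Qed.
Let hom_f' : hom_hbar 0 f'. Proof. by case: mf'. Qed.
Let Kl := @bq_K_slin _ A.
Let KBl := @bq_K_slin _ B.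

Lemma homog_oneH : homog 0 (oneH B).
Proof.
rewrite /homog -[LHS]/(coh_hpart _ _) /oneH Defs.hpartE; first by congr cls; exact: homog1.
by rewrite /K0 bq_K_one.
Qed.

Lemma composite_lin1 phi (x : ser (cohomology B)) : sym_fam 0 phi ->
  lin_ext (fun v => phi' phi [:: v]) x
  = lin_ext f (lin_ext (fun v => phi [:: v]) (fun a b => J (x a b))).
Proof.
move=> phiS; rewrite lin_ext_comp // -[RHS]/(lin_ext (fun v => lin_ext f (phi [:: J v])) x).
by apply: eq_lin_ext => a b; rewrite (composite1 mf df Jl Jdeg).
Qed.

(** If f phi_1 J x = K z, then phi_1 J x = K (f' z + X phi_1 J x), so J x = 0 by
    injectivity of [phi_1] on cohomology.  If K y = 0, then f' y = phi_1 x + K z,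
    and y is homologous to f f' y. *)
Lemma composite_quasi_iso phi :
  is_sLmorphism (oneH A) 1 (@zero_ops k A) (bq_ell A) phi ->
  is_quasi_iso (@zero_ops k A) (bq_ell A) phi ->
  is_quasi_iso (@zero_ops k B) (bq_ell B) (phi' phi).
Proof.
move=> hs [inj sur]; have phiS : sym_fam 0 phi by case: hs => /shom_hbar_sym.
have phi1h := sL_hom1 hs.
have D0 (V : gradedType k) (x : ser V) : lin_ext (fun _ => 0 : ser V) x = 0 by exact: lin_ext_zero.
have ell1 (C : binaryQFT k) x : lin_ext (fun v => bq_ell C [:: v]) x = lin_ext (bq_K C) x.
  by apply: eq_lin_ext => a b; rewrite bq_ell1.
have Kphi x : lin_ext (bq_K A) (lin_ext (fun v => phi [:: v]) x) = 0.
  rewrite lin_ext_comp // -[RHS](lin_ext_zero A x); apply: eq_lin_ext => a b.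
  exact: sL_cocycle hs _.
split=> [j x z hx hz _ e|j y hy e].
- exists 0; first by split=> [a b|a b] //; exact: homog0.
  pose Jx : ser (cohomology A) := fun a b => J (x a b).
  have hJx : in_hbar j Jx.
    split=> a b; last by apply: Jdeg; case: hx.
    by rewrite /Jx hx.1 -[X in J X]I0 JI.
  pose y := lin_ext (fun v => phi [:: v]) Jx.
  have hy : in_hbar j y by rewrite -[j]addr0; exact: in_hbar_lin_ext.
  have ef : lin_ext f y = lin_ext (bq_K B) z.
    by rewrite -composite_lin1 //; apply: serP => a b; rewrite e -ell1.
  have [|||w _ ew] := inj j Jx (lin_ext X y + lin_ext f' z) hJx.
  + by apply: in_hbarD; [|rewrite -[j - 1]addr0]; apply: in_hbar_lin_ext.
  + by move=> a b; rewrite D0.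
  + move=> a b; rewrite ell1 lin_ext_add // (morph_K mf') -ef -/y.
    have := eX y; rewrite [lin_ext (bq_K A) y]Kphi lin_ext0 ?addr0; last exact: hom_hbar_slin hX.
    by move=> <-; rewrite subrK.
  move=> a b; rewrite -[x a b]IJ -[J _]/(Jx a b) ew.
  by rewrite !D0 I0.
- have Ky : lin_ext (bq_K B) y = 0 by apply: serP => a b; rewrite -ell1 e.
  have hf'y : in_hbar j (lin_ext f' y) by rewrite -[j]addr0; exact: in_hbar_lin_ext.
  have [|x [z [hx hz _ ex]]] := sur j (lin_ext f' y) hf'y.
    by move=> a b; rewrite ell1 (morph_K mf') Ky lin_ext0.
  exists (fun a b => I (x a b)), (lin_ext f z + lin_ext Y y); split.
  + by split=> a b; [rewrite hx.1 I0|apply: Ideg; case: hx].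
  + by apply: in_hbarD; [rewrite -[j - 1]addr0|]; apply: in_hbar_lin_ext.
  + by move=> a b; rewrite D0.
  move=> a b; rewrite -serDE; congr (_ a b); rewrite composite_lin1 // ell1.
  rewrite (_ : (fun a b => J _) = x); last by apply: serP => c d; exact: JI.
  rewrite lin_ext_add // addrA (morph_K mf) -lin_ext_add //.
  have -> : lin_ext (fun v => phi [:: v]) x + lin_ext (bq_K A) z = lin_ext f' y.
    by apply: serP => c d; rewrite ex serDE ell1.
  by have := eY y; rewrite Ky lin_ext0 ?addr0; [move=> <-; rewrite addrC subrK|exact: hom_hbar_slin hY].
Qed.

Lemma pi_series_conj pi s :
  pi_series (fun j s => I (pi j (map J s))) s = (fun a b => I (pi_series pi (map J s) a b)) :> ser _.
Proof.
case: s => [|v [|w s]]; apply: serP => a b; rewrite /pi_series /=.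
- by rewrite andbF I0.
- by rewrite /cst; case: ifP; rewrite ?IJ ?I0.
rewrite size_map; case: ifP => _; rewrite ?I0 //.
by rewrite -[_ *: _ in RHS]addr0 Il I0 addr0.
Qed.

(** The image under [f] of the relation Pi - phi_1 pi = K eta is the relation
    for the composite, because [f] sends the exponential of [phi] to that of
    the composite. *)
Lemma distinguished_composite phi pi : is_distinguished phi pi ->
  is_distinguished (phi' phi) (fun j s => I (pi j (map J s))).
Proof.
case=> [[hs hq] hrep hpi hone [eta [heta eeta]]].
have phiS : sym_fam 0 phi by case: hs => /shom_hbar_sym.
have J1 : J (oneH B) = oneH A by exact: induced_one.
have etaS : sym_fam (-1) eta by exact: shom_hbar_sym.
have etal := sym_fam_mlin etaS.
split.
- split; last exact: composite_quasi_iso.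
  exact: (composite_sL mf df Jl Jdeg J1 homog_oneH).
- move=> v; rewrite (composite1 mf df Jl Jdeg) // /lin_ext !big_ord1 subn0.
  have [dx ex] := hrep (J v); split; first by rewrite classical_K // dx (slin0 fl).
  by rewrite -(induced_cls mf dx) ex IJ.
- move=> n j le; have [h1 h2 h3] := hpi n j le; split=> [s1 s2 c x y sz|s1 s2 x y p q sz hx hy|x d hd].
  + by rewrite !map_cat /= Jl h1 ?size_map // Il.
  + rewrite !map_cat /= (h2 _ _ (J x) (J y) p q) ?size_map //; try exact: Jdeg.
    by rewrite -[_ *: _]addr0 Il I0 addr0.
  rewrite addr0; apply: Ideg; rewrite -[X in homog X]addr0.
  have := h3 (map_tuple J x) d; apply => i; rewrite tnth_map; exact: Jdeg.
- by move=> s a b ns; rewrite !pi_series_conj map_rcons J1 hone ?size_map.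
exists (fun s => lin_ext f (eta (map J s))); split.
- apply: (_ : forall g, sym_fam (-1) g -> (forall s, (0 < size s)%N -> tau_free (g s)) ->
    forall n, (0 < n)%N -> shom_hbar n (-1) g).
  + by move=> g hg hf n n0; split=> [|s ss]; [exact: hg|apply: hf; rewrite ss].
  + apply: sym_fam_of => [s1 s2 c x y|s1 s2 x y p q hx hy|l nl].
    * by rewrite !map_cat /= Jl etal lin_ext_slin.
    * by rewrite !map_cat /= (sym_fam_gsym etaS _ _ (Jdeg hx) (Jdeg hy)) lin_ext_sg.
    apply: shomog_lin_ext => a b; rewrite -[_ + _]addr0; apply: hom_hbar_shomog => //.
    rewrite -map_comp; apply: (sym_fam_deg (ev := ev J) etaS) => // t.
    exact: Jdeg (homog_hpart _ _).
  + move=> s ns; apply: tau_free_lin_ext; [exact: slin0|by case: hom_f|].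
    by have [_] := heta (size s) ns; apply; rewrite size_map.
apply: eq_homog_letters => n t n0; apply: serP => a b.
rewrite -[map_tuple (fun t0 => hpart t0.1 t0.2) t]/(map_tuple (ev id) t) sum_blocks_exp.
pose S := sum_blocks 1 (@ser_prod k A) phi (map_tuple (fun t => t.1) t) (map_tuple (ev J) t).
have -> : fam_exp (par (fun t : int * cohomology B => t.1)) (wgt (evf id (phi' phi))) t
    = lin_ext f S.
  rewrite /S sum_blocks_exp (morph_exp mf df); last exact: hfam_evf.
  apply: eq_fam_exp => l nl; rewrite !wgtE // /evf nzE // -composite_letters //; exact: desc_sym df.
have -> : S = lin_ext (fun u => phi [:: u]) (pi_series pi (map (ev J) t)) + lin_ext (bq_K A) (eta (map (ev J) t)).
  apply: serP => c d; have := eeta n (map_tuple (fun t => t.1) t) (map_tuple (ev J) t) n0 (homog_tuple_ev Jdeg t) c d.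
  by rewrite serDE => /= <-; rewrite addrC subrK.
pose P := pi_series pi (map (ev J) t).
have eJ : map J (map_tuple (ev id) t) = map (ev J) t by rewrite /= -map_comp.
have eP : pi_series (fun j s => I (pi j (map J s))) (map_tuple (ev id) t)
    = (fun a b => I (P a b)) :> ser _.
  by rewrite pi_series_conj eJ.
have JP : (fun a b => J (I (P a b))) = P :> ser _ by apply: serP => c d; rewrite JI.
have e1 := composite_lin1 (fun a b => I (P a b)) phiS; rewrite JP in e1.
rewrite eP [X in _ - X](congr1 (fun y : ser B => y a b) e1) -/P eJ.
by rewrite lin_ext_add // serDE addrC addKr (morph_K mf).
Qed.

End DistinguishedTransport.

Lemma graded_hom_hpart (k : fieldType) (V W : gradedType k) j (g : V -> W) i x :
  graded_hom j g -> g (hpart i x) = hpart (i + j) (g x).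
Proof.
case=> gl gd; have g0 : g 0 = 0.
  by have := gl (-1) 0 0; rewrite scaler0 addr0 scaleN1r addNr.
have gs (s : seq int) (F : int -> V) : g (\sum_(l <- s) F l) = \sum_(l <- s) g (F l).
  elim/big_rec2: _ => // l y z _ <-; by rewrite -[F l]scale1r gl !scale1r.
rewrite {2}(supp_sum x) gs hpart_bigsum.
have e l : hpart (i + j) (g (hpart l x)) = if l == i then g (hpart l x) else 0.
  have h := gd l _ (homog_hpart l x); rewrite /homog in h.
  by rewrite -h hpart_hpart (inj_eq (addIr _)) eq_sym; case: ifP.
under eq_bigr => l _ do rewrite e.
rewrite -big_mkcond; have [si|nsi] := boolP (i \in supp x).
  by rewrite -big_filter filter_pred1_uniq ?supp_uniq // big_seq1.
rewrite (notin_supp nsi) g0 big_seq_cond big_pred0 // => l.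
by apply/negbTE; apply: contraNN nsi => /andP[h /eqP<-].
Qed.

(** * Uniqueness of the correlation algebra *)

Section Uniqueness.
Variables (k : fieldType) (char0 : [pchar k] =i pred0) (A : binaryQFT k).
Local Notation H := (cohomology A).
Local Notation K := (bq_K A).
Let Kl := @bq_K_slin _ A.

(** Only the coefficients at time 0 are compared: the series to which this is
    applied do not depend on [tau], but the primitives [w] may. *)
Definition cohom (x y : ser A) : Prop :=
  exists w : ser A, forall a, x a 0%N - y a 0%N = lin_ext K w a 0%N.

Lemma cohom_sym x y : cohom x y -> cohom y x.
Proof.
case=> w e; exists (- w) => a.
by rewrite -[- w]/(sg true w) lin_ext_sg //= serNE -e opprB.
Qed.

Lemma cohom_trans y x z : cohom x y -> cohom y z -> cohom x z.
Proof.
move=> [w e] [w' e']; exists (w + w') => a.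
by rewrite lin_ext_add // serDE -e -e' addrA subrK.
Qed.

Lemma cohom_sum (I : Type) (r : seq I) (F G : I -> ser A) :
  (forall i, cohom (F i) (G i)) -> cohom (\sum_(i <- r) F i) (\sum_(i <- r) G i).
Proof.
move=> h; elim: r => [|i r [w e]].
  by exists 0 => a; rewrite !big_nil subrr lin_ext0.
have [w' e'] := h i; exists (w' + w) => a.
by rewrite !big_cons !serDE lin_ext_add // serDE -e -e' opprD addrACA.
Qed.

Lemma cohom_lin_ext (V : gradedType k) (F G : V -> ser A) (x : ser V) :
  (forall v, cohom (F v) (G v)) -> cohom (lin_ext F x) (lin_ext G x).
Proof.
move=> h; have [w e] := choice h; exists (lin_ext w x) => a.
rewrite lin_ext_comp // !lin_ext_b0 -sumrB; apply: eq_bigr => i _; exact: e.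
Qed.

Lemma type_cohom phi0 phi (t : seq (int * H)) : in_type_of phi0 phi ->
  cohom (fam_exp (par (fun t => t.1)) (wgt (evf id phi)) t)
        (fam_exp (par (fun t => t.1)) (wgt (evf id phi0)) t).
Proof.
case=> s0 _ [Phi [lam [hb _ ode v0 v1]]].
exact: (htpy_cobound char0 (J := id) (fun _ _ => id) (fun _ => erefl) s0 hb ode v0 v1 t).
Qed.

(** The exponential of a word of one letter is the linear part. *)
Lemma type_cohom1 phi0 phi v : in_type_of phi0 phi -> cohom (phi [:: v]) (phi0 [:: v]).
Proof.
move=> h; have [s0 s1 _] := h.
have e p : is_sLmorphism (oneH A) 1 (@zero_ops k A) (bq_ell A) p ->
    p [:: v] = \sum_(j <- supp v) p [:: hpart j v].
  by move=> /sL_hom1/hom_hbar_slin pl; rewrite {1}(supp_sum v) (slin_sum _ _ _ pl).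
rewrite (e _ s0) (e _ s1); apply: cohom_sum => j.
have := type_cohom [:: (j, v)] h.
by rewrite -[[:: (j, v)]]/(rcons [::] (j, v)) !fam_exp_rcons /= !smul1l /evf /= !mulNhbar0n.
Qed.

(** As [K] is homogeneous and independent of [tau], a primitive can be projected
    to the right degree and to time 0. *)
Lemma cohom_homog j (x : ser A) (w : ser A) : in_hbar j x ->
  (forall a, x a 0%N = lin_ext K w a 0%N) ->
  exists2 z, in_hbar (j - 1) z & x = lin_ext K z.
Proof.
move=> [xf xh] e; pose z : ser A := fun a b => if b == 0%N then hpart (j - 1) (w a 0%N) else 0.
have zf : tau_free z by [].
exists z; first by split=> // a [|b]; [exact: homog_hpart|exact: homog0].
apply: tau_free_eq => // [|a].
  by apply: tau_free_lin_ext => //; [exact: slin0|exact: bq_K_tau].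
rewrite -(xh a 0%N) e !lin_ext_b0 hpart_bigsum; apply: eq_bigr => i _.
have [h _] := bq_K_hom A.
have := graded_hom_hpart (j - 1) (w i 0%N) (h (a - i)%N 0%N).
by rewrite subrK.
Qed.

Lemma pi_series_deg pi (s : seq (int * H)) : (forall n j, (j.+2 <= n)%N -> sym_hom n 0 (pi j)) ->
  (0 < size s)%N -> in_hbar (wt (fun t => t.1) s) (pi_series pi (map (ev id) s)).
Proof.
move=> hpi; case: s => [|t [|t' s]] // _.
  split=> [a b|]; first by rewrite /= /cst andbF.
  by rewrite /wt big_seq1; apply: shomog_cst; exact: homog_ev.
split=> [a b //|a b]; rewrite /pi_series /=; case: ifP => [/andP[_ le]|_]; last exact: homog0.
apply: homogZ; set u := [:: t, t' & s].
rewrite size_map in le; have [_ _ h] := hpi (size u) a le.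
have := h (map_tuple (ev id) (in_tuple u)) (map_tuple (fun t => t.1) (in_tuple u)).
rewrite addr0 => h'; have -> : wt (fun t : int * H => t.1) u
    = \sum_(i < size u) tnth (map_tuple (fun t => t.1) (in_tuple u)) i.
  by rewrite /wt (big_tnth _ _ u); apply: eq_bigr => i _; rewrite tnth_map.
by apply: h' => i; rewrite !tnth_map; exact: homog_ev.
Qed.

(** Modulo coboundaries, phi0_1 pi0 ~ Pi0 ~ Pi ~ Pi1 ~ phi1_1 pi1 ~ phi0_1 pi1,
    and [phi0_1] is injective on cohomology, the cohomology of a space with zero
    differential being the space itself.  This gives equality on homogeneous
    arguments, then on all arguments by multilinearity. *)
Lemma distinguished_eq (phi0 phi1 phi : seq H -> ser A) pi0 pi1 :
  is_distinguished phi0 pi0 -> is_distinguished phi1 pi1 ->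
  in_type_of phi0 phi -> in_type_of phi1 phi ->
  forall s, (1 < size s)%N -> pi0 (size s - 2)%N s = pi1 (size s - 2)%N s.
Proof.
case=> [[hs0 [inj _]] _ hpi0 _ [eta0 [_ e0]]] [[hs1 _] _ hpi1 _ [eta1 [_ e1]]] ht0 ht1 s ns.
have letters (t : seq (int * H)) : (1 < size t)%N ->
    pi_series pi0 (map (ev id) t) = pi_series pi1 (map (ev id) t).
  move=> nt; have nt0 : (0 < size t)%N by exact: ltnW.
  pose P0 := pi_series pi0 (map (ev id) t); pose P1 := pi_series pi1 (map (ev id) t).
  have dP0 := pi_series_deg hpi0 nt0; have dP1 := pi_series_deg hpi1 nt0.
  have c (p eta : seq H -> ser A) (pi : nat -> seq H -> H) : eq_homog
          (fun n d v a b => sum_blocks 1 (@ser_prod k A) p d v a b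
             - lin_ext (fun u => p [:: u]) (pi_series pi v) a b)
          (fun n d v => lin_ext K (eta v)) ->
      cohom (fam_exp (par (fun t => t.1)) (wgt (evf id p)) t)
        (lin_ext (fun u => p [:: u]) (pi_series pi (map (ev id) t))).
    move=> e; exists (eta (map (ev id) t)) => a.
    have := e _ _ _ nt0 (homog_tuple_ev (fun i x => id) (in_tuple t)) a 0%N.
    by rewrite sum_blocks_exp /=.
  have l0 := hom_hbar_slin (sL_hom1 hs0).
  have [w ew] : cohom (lin_ext (fun u => phi0 [:: u]) P0) (lin_ext (fun u => phi0 [:: u]) P1).
    apply: cohom_trans (cohom_sym (c _ _ _ e0)) _.
    apply: cohom_trans (cohom_sym (type_cohom t ht0)) _.
    apply: cohom_trans (type_cohom t ht1) _.
    apply: cohom_trans (c _ _ _ e1) _.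
    apply: cohom_trans (_ : cohom _ (lin_ext (fun u => phi [:: u]) P1)) _.
      by apply: cohom_sym; apply: cohom_lin_ext => v; exact: type_cohom1.
    by apply: cohom_lin_ext => v; exact: type_cohom1.
  have dP : in_hbar (wt (fun t => t.1) t) (P0 - P1).
    apply: in_hbarD => //; case: (dP1 : in_hbar _ P1) => f h; split; last exact: shomogN.
    by move=> a b; rewrite serNE f oppr0.
  have phi1h := sL_hom1 hs0.
  have [z hz ez] : exists2 z, in_hbar (wt (fun t => t.1) t - 1) z &
      lin_ext (fun u => phi0 [:: u]) (P0 - P1) = lin_ext K z.
    apply: (cohom_homog (w := w)); first by rewrite -[wt _ _]addr0; exact: in_hbar_lin_ext.
    by move=> a; rewrite -ew -scaleN1r addrC lin_ext_slin // serDE serZE scaleN1r addrC.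
  have [||u _ eu] := inj _ _ z dP hz.
  - by move=> a b; rewrite /zero_ops lin_ext_zero.
  - move=> a b; rewrite ez; congr (_ a b); apply: eq_lin_ext => i j.
    by rewrite bq_ell1.
  apply/eqP; rewrite -subr_eq0; apply/eqP; apply: serP => a b.
  by rewrite eu /zero_ops lin_ext_zero.
pose n := size s; have lt : (1 < n)%N := ns.
have n2 : (n - 2).+2 = n by rewrite -addn2 subnK.
pose g (pi : nat -> seq H -> H) (l : seq H) := if size l == n then pi (n - 2)%N l else 0.
have gl pi : (forall n j, (j.+2 <= n)%N -> sym_hom n 0 (pi j)) -> mlin (g pi).
  move=> h s1 s2 c x y; rewrite /g !size_cat /=; case: eqP => sz; last by rewrite scaler0 addr0.
  by have [|e _ _] := h n (n - 2)%N; [rewrite n2|rewrite e // -sz addnS].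
suff : g pi0 s = g pi1 s by rewrite /g eqxx.
apply: (mlin_homog_eq (gl _ hpi0) (gl _ hpi1)) (erefl n) => l sl.
have := letters l; rewrite sl => /(_ lt) /(congr1 (fun y : ser H => y (n - 2)%N 0%N)).
rewrite /g size_map sl eqxx /=; case: l sl => [|t1 [|t2 l]] /= sl; try by rewrite -sl in lt.
rewrite !size_map; move: (sl); rewrite -{1}n2 => -[->]; rewrite leqnn.
by move/(congr1 (fun y => (-1) ^+ (n - 2) *: y)); rewrite !scalerA -exprD addnn -signr_odd odd_double !scale1r.
Qed.

End Uniqueness.

Theorem theorem1p4 (k : fieldType) (char0 : [pchar k] =i pred0)
    (A A' : binaryQFT k) (HA : anomaly_free A) (HA' : anomaly_free A')
    (f : A -> ser A') (psi : seq A -> ser A')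
    (Hf : homotopy_equivalence f) (Hpsi : is_descendant f psi) :
  let I := induced f in
  [/\ graded_hom 0 I, I (oneH A) = oneH A'
    & exists Iinv : cohomology A' -> cohomology A,
      [/\ graded_hom 0 Iinv, cancel I Iinv, cancel Iinv I
        & forall phi : seq (cohomology A) -> ser A,
          represents_quantum_structure phi ->
          exists phi' : seq (cohomology A') -> ser A',
            [/\ eq_homog (fun n d v => phi' v)
                  (fun n d v => sL_comp psi phi d [tuple of map Iinv v]),
                represents_quantum_structure phi'
              & forall m m',
                is_correlation_algebra phi m ->
                is_correlation_algebra phi' m' ->
                forall v : seq (cohomology A), (1 < size v)%N ->
                  I (m v) = m' (map I v)]]].
Proof.
case: Hf => mf [f' [mf' hX hY]] I.
have tf (C D E : binaryQFT k) (g : C -> ser D) (h : D -> ser E) : is_morphism g -> is_morphism h ->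
    forall v, tau_free (lin_ext h (g v)).
  move=> mg mh v; apply: tau_free_lin_ext; [exact: slin0 (morph_slin mh)|exact: morph_tau|exact: morph_tau].
have tc (C : binaryQFT k) (v : C) : tau_free (cst v) by move=> a b; rewrite /cst andbF.
have [X Xh eX] := homotopic_chain char0 (tf _ _ _ _ _ mf mf') (tc A) hX.
have [Y Yh eY] := homotopic_chain char0 (tf _ _ _ _ _ mf' mf) (tc A') hY.
have JI := induced_cancel mf mf' Xh eX; have IJ := induced_cancel mf' mf Yh eY.
split; [exact: induced_hom|exact: induced_one|].
exists (induced f'); split=> //; first exact: induced_hom.
have eX' (x : ser A) : x - lin_ext f' (lin_ext f x)
    = lin_ext (bq_K A) (lin_ext X x) + lin_ext X (lin_ext (bq_K A) x).
  by rewrite -eX lin_ext_cstK lin_ext_comp //; exact: morph_slin.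
have eY' (y : ser A') : y - lin_ext f (lin_ext f' y)
    = lin_ext (bq_K A') (lin_ext Y y) + lin_ext Y (lin_ext (bq_K A') y).
  by rewrite -eY lin_ext_cstK lin_ext_comp //; exact: morph_slin.
have Jl := induced_linear mf'.
have Jdeg i v : homog i v -> homog i (induced f' v).
  by move=> hv; have := (induced_hom mf').2 i v hv; rewrite addr0.
have dist := distinguished_composite mf Hpsi mf' Xh Yh eX' eY' IJ JI.
have htype phi0 phi : in_type_of phi0 phi ->
    in_type_of (composite (induced f') psi phi0) (composite (induced f') psi phi).
  apply: (composite_homotopic char0 mf Hpsi Jl Jdeg (induced_one mf')) => //.
  exact: homog_oneH.
move=> phi [phi0 [pi0 [d0 t0]]]; exists (composite (induced f') psi phi); split.
- have phiS : sym_fam 0 phi by case: t0 => _ [/shom_hbar_sym].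
  apply: eq_homog_letters => n t n0 /=.
  rewrite composite_letters //; last exact: desc_sym Hpsi.
  rewrite -sum_blocks_letters /sL_comp; congr (sum_blocks _ _ _ _ _).
  by apply: val_inj; rewrite /= -map_comp.
- by eexists; eexists; split; [exact: (dist _ _ d0)|exact: htype].
move=> m m' [phi1 [pi1 [d1 t1 em]]] [phi2 [pi2 [d2 t2 em']]] v nv.
rewrite em // em' ?size_map //.
have := distinguished_eq char0 d2 (dist _ _ d1) t2 (htype _ _ t1) (s := map I v).
by rewrite !size_map => ->//; rewrite -map_comp (eq_map JI) map_id.
Qed.
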